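(* Let $\omega$ be a weight function such that $\varphi(t)=\omega(e^{t})$ is convex, and such that $$\int_{x}^{\infty}\frac{\omega(t)}{t^{3}}\,dt = O\!\left(\frac{\omega(x)}{x^{2}}\right),\qquad x\to\infty .$$ Let $f\in L^{2}(\mathbb{R})$. For $\lambda>0$ consider the bounds $$(\mathrm{A}_\lambda)\qquad |f(x)| \lesssim e^{-\frac12 x^{2}+\lambda\omega(|x|)}\ \ (x\in\mathbb{R})\quad\text{and}\quad |\widehat f(\xi)|\lesssim e^{-\frac12\xi^{2}+\lambda\omega(|\xi|)}\ \ (\xi\in\mathbb{R}),$$ and for $r>0$ consider the bound $$(\mathrm{B}_r)\qquad |H(f,n)|\lesssim \sqrt{n!}\; e^{-\frac1r\varphi^{*}(rn)}\ \ (n\in\mathbb{N}).$$ Then: (1) $(\mathrm{A}_\lambda)$ holds for some $\lambda>0$ if and only if $(\mathrm{B}_r)$ holds for some $r>0$. (2) $(\mathrm{A}_\lambda)$ holds for every $\lambda>0$ if and only if $(\mathrm{B}_r)$ holds for every $r>0$.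
   Context: A weight function is an unbounded non-decreasing function $\omega:[0,\infty)\to[0,\infty)$. The Young conjugate of $\varphi$ is $\varphi^{*}(t)=\sup_{s>0}\,(st-\varphi(s))$ for $t\ge 0$; it may take the value $+\infty$, in which case $e^{-\frac1r\varphi^{*}(rn)}$ is read as $0$ (so that the bound forces $H(f,n)=0$). $\mathbb{N}=\{0,1,2,\dots\}$. The Fourier transform is $\widehat{f}(\xi)=(2\pi)^{-1/2}\int_{-\infty}^{\infty} f(t)e^{-it\xi}\,dt$ (extended to $L^2(\mathbb{R})$ as usual). The Hermite functions are $h_{n}(x)=(-1)^{n}\pi^{-1/4}(2^{n}n!)^{-1/2}e^{\frac12 x^{2}}\frac{d^{n}}{dx^{n}}[e^{-x^{2}}]$, $n\in\mathbb{N}$; they form an orthonormal basis of $L^2(\mathbb{R})$, and $H(f,n)=\langle f,h_n\rangle=\int_{-\infty}^{\infty} f(x)h_n(x)\,dx$. The notation $A\lesssim B$ means $A\le CB$ with a constant $C>0$ independent of the variable ($x$, $\xi$ or $n$), but possibly depending on $f$ and on the parameter ($\lambda$ or $r$). Pointwise bounds on $L^2$ functions are understood almost everywhere. *)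

(* Defs.v *)
From HB Require Import structures.
From mathcomp Require Import all_boot all_order all_algebra.
From mathcomp Require Import complex.
From mathcomp Require Import all_classical all_reals all_analysis.

Set Implicit Arguments.
Unset Strict Implicit.
Unset Printing Implicit Defensive.

Import Order.TTheory GRing.Theory Num.Theory.
Import numFieldNormedType.Exports.
Import ComplexField.Normc.

Local Open Scope classical_set_scope.
Local Open Scope ring_scope.

Section weight_functions.
Context {R : realType}.

(* A function [0,oo) -> [0,oo) is given by a total function on R; its values
   at negative arguments are never used. *)
Definition weight_function (omega : R -> R) : Prop :=
  [/\ forall x, 0 <= x -> 0 <= omega x,
      forall x y, 0 <= x -> x <= y -> omega x <= omega y
    & forall M : R, exists2 x, 0 <= x & M < omega x].

Definition phi_of (omega : R -> R) (t : R) : R := omega (expR t).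

Definition young_conjugate (phi : R -> R) (t : R) : \bar R :=
  ereal_sup [set (s * t - phi s)%:E | s in [set s : R | 0 < s]].

(* The integral is the extended real one, so the bound includes its
   finiteness. *)
Definition integral_bigO (omega : R -> R) : Prop :=
  exists C : R, \forall x \near +oo,
    (\int[lebesgue_measure]_(t in `[x, +oo[) (omega t / t ^+ 3)%:E
       <= (C * (omega x / x ^+ 2))%:E)%E.

End weight_functions.

Section complex_valued_functions.
Context {R : realType}.

Definition cintegral (D : set R) (f : R -> R[i]) : R[i] :=
  Complex (\int[lebesgue_measure]_(x in D) complex.Re (f x))
          (\int[lebesgue_measure]_(x in D) complex.Im (f x)).

Definition L2 (f : R -> R[i]) : Prop :=
  (fun x => complex.Re (f x)) \in Lfun lebesgue_measure 2%:E /\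
  (fun x => complex.Im (f x)) \in Lfun lebesgue_measure 2%:E.

Definition L2norm (f : R -> R[i]) : \bar R :=
  ('N[lebesgue_measure]_2%:E[EFin \o (fun x => normc (f x))])%E.

Definition expi (theta : R) : R[i] := Complex (cos theta) (sin theta).

Definition truncated_fourier (n : nat) (f : R -> R[i]) (xi : R) : R[i] :=
  real_complex R (Num.sqrt (2 * pi))^-1 *
  cintegral `[- n%:R, n%:R] (fun t => f t * expi (- (t * xi))).

Definition is_fourier (f g : R -> R[i]) : Prop :=
  L2 g /\
  L2norm (fun xi => truncated_fourier n f xi - g xi) @[n --> \oo] --> 0%E.

(* For f in L^2, Plancherel's theorem provides some g with is_fourier f g,
   unique up to a null set; the default value is then irrelevant. *)
Definition fourier (f : R -> R[i]) : R -> R[i] :=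
  xget (fun=> 0) [set g | is_fourier f g].

Definition hermite_fun (n : nat) (x : R) : R :=
  (-1) ^+ n * pi `^ (- 4^-1) * (2 ^+ n * n`!%:R) `^ (- 2^-1) *
  expR (2^-1 * x ^+ 2) * derive1n n (fun y : R => expR (- y ^+ 2)) x.

Definition hermite_coef (f : R -> R[i]) (n : nat) : R[i] :=
  cintegral setT (fun x => f x * real_complex R (hermite_fun n x)).

Definition gaussian_bound (omega : R -> R) (lambda : R) (f : R -> R[i]) : Prop :=
  exists2 C : R, 0 < C &
    {ae lebesgue_measure, forall x : R,
      normc (f x) <= C * expR (- (2^-1 * x ^+ 2) + lambda * omega `|x|)}.

Definition cond_A (omega : R -> R) (f : R -> R[i]) (lambda : R) : Prop :=
  gaussian_bound omega lambda f /\ gaussian_bound omega lambda (fourier f).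

(* expeR -oo = 0, so the bound forces the n-th coefficient to vanish when the
   conjugate is +oo at r * n. *)
Definition cond_B (omega : R -> R) (f : R -> R[i]) (r : R) : Prop :=
  exists2 C : R, 0 < C &
    forall n : nat,
      ((normc (hermite_coef f n))%:E <=
       (C * Num.sqrt n`!%:R)%:E *
       expeR (- (r^-1%:E * young_conjugate (phi_of omega) (r * n%:R))))%E.

End complex_valued_functions.

(* Main.v *)
(* The Bargmann transform F of f is the entire function with Taylor coefficients
   H(f,n) / sqrt(n!), and (B_r) is, after Young conjugation, the family of Cauchy
   estimates |H(f,n)| rho^n <= C sqrt(n!) exp(omega(rho) / r) for rho > 1.

   From (A) to (B): the bound on f gives
   |F(z)| <= M exp((Im z)^2 / 2 + lambda omega(2 |z|)); since H(f^,n) = (-i)^n H(f,n),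
   the transform of f^ is F(-i z), so the bound on f^ gives the same with Re z.
   Thus F is small near both coordinate axes, and the Phragmen-Lindelof principle in
   each quadrant removes the Gaussian factor: the integral condition on omega forces
   omega(r) <= K (omega(rho) + 1) (1 + (r / rho)^g) with some g < 2, so that
   B Re (e^{-i pi/4} z)^g is a harmonic majorant of the remaining growth. The outcome
   is |F| <= C exp(K' lambda omega(rho)) on |z| = rho.

   From (B) to (A): the Hermite series of f and of f^ are summed termwise, bounding
   the n-th term at x through the Cauchy estimate with rho = 3 e^2 max(|x|, 1, sqrt n).
   The sum is f because the Hermite functions are complete. *)
Require Import Defs.
From HB Require Import structures.
From mathcomp Require Import all_boot all_order all_algebra.
From mathcomp Require Import complex ring lra zify.
From mathcomp Require Import all_classical all_reals all_analysis measurable_realfun.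

Set Implicit Arguments.
Unset Strict Implicit.
Unset Printing Implicit Defensive.

Import Order.TTheory GRing.Theory Num.Theory.
Import numFieldNormedType.Exports.
Import ComplexField.Normc.

Local Open Scope classical_set_scope.
Local Open Scope ring_scope.

(** * Maximum modulus and Phragmen-Lindelof *)

(** Both equivalences come from one pair of estimates in which the weight loses only a constant
    factor depending on [omega] alone: (A) with lambda gives the Cauchy estimates with exponent
    [K3 * lambda], and exponent m gives (A) with [K1 * m]. Fixing these constants before lambda and
    m lets the same two implications serve both quantifiers. Entire functions are handled without
    contour integrals. F enters only as a locally uniform limit of polynomials ([unif_sum]). In the
    coordinate w = log z the quadrant becomes a half-strip, on whose rectangles the maximum
    principle follows from second derivatives. The quadrant has opening pi / 2, so its critical
    order is exactly 2, the order of the Gaussian factor; the integral condition is what pushes the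
    weight strictly below it. [fourier f] is a choice among L^2 limits of truncated integrals. It is
    evaluated only for f of Gaussian decay, which either bound implies, and there an inequality of
    Plancherel type identifies it with the absolutely convergent integral. *)

Section second_derivative.
Context {R : realType}.

(** At the maximum [g'] vanishes, so d > 0 would make [g'] positive just to the right of x0, and the
    mean value theorem would give larger values of g there. *)
Lemma second_derivative_max (g g' : R -> R) (a b x0 d : R) :
  a < x0 < b -> (forall x, is_derive x (1:R) g (g' x)) ->
  is_derive x0 (1:R) g' d ->
  (forall x, a < x < b -> g x <= g x0) -> d <= 0.
Proof.
move=> /andP[ax xb] dg dg' gmax; rewrite leNgt; apply/negP => d0.
have g'0 : g' x0 = 0.
  have x0ab : x0 \in `]a, b[ by rewrite in_itv/= ax xb.
  have H := @derive1_at_max R g a b x0 (ltW (lt_trans ax xb))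
    (fun t _ => @ex_derive _ _ _ _ _ _ _ (dg t)) x0ab _.
  have {}H : is_derive x0 (1:R) g 0.
    by apply: H => t; rewrite in_itv/=; exact: gmax.
  by rewrite -(@derive_val _ _ _ _ _ _ _ (dg x0)) (@derive_val _ _ _ _ _ _ _ H).
have cg : continuous g.
  by move=> x; apply: differentiable_continuous; apply/derivable1_diffP.
have /cvgrPdist_lt/(_ _ d0) := @ex_derive _ _ _ _ _ _ _ dg'.
have := @derive_val _ _ _ _ _ _ _ dg'.
rewrite /derive => ->; rewrite near_withinE /= => -[e /= e0 He].
pose t := Num.min (e / 2) ((b - x0) / 2).
have t0 : 0 < t by rewrite lt_min !divr_gt0// subr_gt0.
have te : t < e by rewrite gt_min ltr_pdivrMr// ltr_pMr// ltr1n.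
have tb : x0 + t < b.
  rewrite -ltrBrDl gt_min; apply/orP; right.
  by rewrite ltr_pdivrMr// ltr_pMr ?ltr1n// subr_gt0.
have [||c cin Hc] := @MVT R g g' x0 (x0 + t) _ (fun x _ => dg x).
- by rewrite ltrDl.
- exact: continuous_subspaceT.
have := gmax (x0 + t); rewrite (lt_trans ax) ?ltrDl// tb => /(_ isT).
rewrite -subr_le0 Hc addrAC subrr add0r pmulr_lle0//.
apply/negP; rewrite -ltNge.
move: cin; rewrite in_itv/= => /andP[xc cx].
have := He (c - x0); rewrite /ball_ /= sub0r normrN ger0_norm ?subr_ge0 ?ltW//.
rewrite ltrBlDl (lt_trans cx) ?ltrD2l// => /(_ isT).
rewrite subr_eq0 gt_eqF// => /(_ isT).
rewrite scaler1 subrK g'0 subr0 ltr_norml => /andP[_].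
rewrite ltrBlDl ltrDr pmulr_rgt0// invr_gt0 subr_gt0//.
Qed.
End second_derivative.

(** * Holomorphic functions in real coordinates *)

Section holomorphic.
Context {R : realType}.
Local Notation C := R[i].
Local Notation Re := (@complex.Re R).
Local Notation Im := (@complex.Im R).

(** Componentwise differentiation along the real line, so that only real calculus is needed. *)
Definition is_cderive (f : R -> C) (x : R) (d : C) :=
  is_derive x (1:R) (fun t => Re (f t)) (Re d) /\
  is_derive x (1:R) (fun t => Im (f t)) (Im d).

Lemma is_cderive_cst (c : C) x : is_cderive (fun=> c) x 0.
Proof. by split; exact: is_derive_cst. Qed.

Lemma ReDc (z w : C) : Re (z + w) = Re z + Re w.
Proof. by case: z w => [a b] [c d]. Qed.

Lemma ImDc (z w : C) : Im (z + w) = Im z + Im w.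
Proof. by case: z w => [a b] [c d]. Qed.

Lemma is_cderiveD f g x df dg : is_cderive f x df -> is_cderive g x dg ->
  is_cderive (fun t => f t + g t) x (df + dg).
Proof.
move=> [f1 f2] [g1 g2]; split.
  rewrite ReDc; have := is_deriveD f1 g1; congr is_derive.
  by apply/funext => t/=; rewrite ReDc.
rewrite ImDc; have := is_deriveD f2 g2; congr is_derive.
by apply/funext => t/=; rewrite ImDc.
Qed.

Lemma ReMc (z w : C) : Re (z * w) = Re z * Re w - Im z * Im w.
Proof. by case: z w => [a b] [c d]. Qed.

Lemma ImMc (z w : C) : Im (z * w) = Re z * Im w + Im z * Re w.
Proof. by case: z w => [a b] [c d]. Qed.

Lemma is_cderiveM f g x df dg : is_cderive f x df -> is_cderive g x dg ->
  is_cderive (fun t => f t * g t) x (f x * dg + df * g x).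
Proof.
move=> [f1 f2] [g1 g2]; split.
  have := is_deriveB (is_deriveM f1 g1) (is_deriveM f2 g2).
  rewrite (_ : _ - _ = Re (f x * dg + df * g x)).
    by congr is_derive; apply/funext => t/=; rewrite ReMc.
  by rewrite ReDc !ReMc /GRing.scale/=; ring.
have := is_deriveD (is_deriveM f1 g2) (is_deriveM f2 g1).
rewrite (_ : _ + _ = Im (f x * dg + df * g x)).
  by congr is_derive; apply/funext => t/=; rewrite ImMc.
by rewrite ImDc !ImMc /GRing.scale/=; ring.
Qed.

Definition cexp (w : C) : C :=
  Complex (expR (Re w) * cos (Im w)) (expR (Re w) * sin (Im w)).

Lemma cexpD (z w : C) : cexp (z + w) = cexp z * cexp w.
Proof.
rewrite /cexp ReDc ImDc expRD sinD cosD.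
by apply/eqP; rewrite eq_complex/=; apply/andP; split; apply/eqP; ring.
Qed.

Lemma cexp0 : cexp 0 = 1.
Proof. by rewrite /cexp /= cos0 sin0 expR0 mulr1 mulr0. Qed.

Lemma normc_cexp (w : C) : normc (cexp w) = expR (Re w).
Proof.
rewrite /cexp /= !exprMn -mulrDr cos2Dsin2 mulr1 sqrtr_sqr ger0_norm// expR_ge0.
Qed.

Lemma normc_ge0 (z : C) : 0 <= normc z.
Proof. by case: z => a b /=; exact: sqrtr_ge0. Qed.

Lemma normc_sqr (z : C) : normc z ^+ 2 = Re z ^+ 2 + Im z ^+ 2.
Proof. by case: z => a b /=; rewrite sqr_sqrtr// addr_ge0// sqr_ge0. Qed.

Lemma is_cderive_cexp g x dg : is_cderive g x dg ->
  is_cderive (fun t => cexp (g t)) x (dg * cexp (g x)).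
Proof.
move=> [g1 g2].
have e1 := is_derive1_comp (is_derive_expR (Re (g x))) g1.
have c1 := is_derive1_comp (is_derive_cos (Im (g x))) g2.
have s1 := is_derive1_comp (is_derive_sin (Im (g x))) g2.
split.
  have := is_deriveM e1 c1; congr is_derive.
  by rewrite ReMc /= /GRing.scale/=; ring.
have := is_deriveM e1 s1; congr is_derive.
by rewrite ImMc /= /GRing.scale/=; ring.
Qed.

(** Complex differentiability in the form of the Cauchy-Riemann equations. *)
Definition hol (f f' : C -> C) := forall s t,
  is_cderive (fun s => f (Complex s t)) s (f' (Complex s t)) /\
  is_cderive (fun t => f (Complex s t)) t (Complex 0 1 * f' (Complex s t)).

Lemma hol_cst (c : C) : hol (fun=> c) (fun=> 0).
Proof. by move=> s t; split; rewrite ?mulr0; exact: is_cderive_cst. Qed.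

Lemma hol_id : hol id (fun=> 1).
Proof.
move=> s t; split; rewrite ?mulr1; split => /=;
 [exact: is_derive_id|exact: is_derive_cst|exact: is_derive_cst|exact: is_derive_id].
Qed.

Lemma holD f f' g g' : hol f f' -> hol g g' ->
  hol (fun w => f w + g w) (fun w => f' w + g' w).
Proof.
move=> hf hg s t; have [f1 f2] := hf s t; have [g1 g2] := hg s t.
by split; rewrite ?mulrDr; exact: is_cderiveD.
Qed.

Lemma holM f f' g g' : hol f f' -> hol g g' ->
  hol (fun w => f w * g w) (fun w => f w * g' w + f' w * g w).
Proof.
move=> hf hg s t; have [f1 f2] := hf s t; have [g1 g2] := hg s t.
split; first exact: (is_cderiveM f1 g1).
have := is_cderiveM f2 g2; congr is_cderive.
by rewrite mulrDr; ring.
Qed.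

Lemma hol_cexp g g' : hol g g' ->
  hol (fun w => cexp (g w)) (fun w => g' w * cexp (g w)).
Proof.
move=> hg s t; have [g1 g2] := hg s t.
by split; rewrite ?mulrA; [exact: (is_cderive_cexp g1)|exact: (is_cderive_cexp g2)].
Qed.

Definition ccont (f : C -> C) :=
  continuous (fun p : R * R => Re (f (Complex p.1 p.2))) /\
  continuous (fun p : R * R => Im (f (Complex p.1 p.2))).

Lemma ccont_cst c : ccont (fun=> c).
Proof. by split => x; exact: cvg_cst. Qed.

Lemma ccont_id : ccont id.
Proof. by split => x /=; [exact: cvg_fst|exact: cvg_snd]. Qed.

Lemma ccontD f g : ccont f -> ccont g -> ccont (fun w => f w + g w).
Proof.
move=> [f1 f2] [g1 g2]; split => x; rewrite /continuous_at ?ReDc ?ImDc;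
  [under eq_fun do rewrite ReDc|under eq_fun do rewrite ImDc].
  by apply: cvgD; [exact: f1|exact: g1].
by apply: cvgD; [exact: f2|exact: g2].
Qed.

Lemma ccontM f g : ccont f -> ccont g -> ccont (fun w => f w * g w).
Proof.
move=> [f1 f2] [g1 g2]; split => x.
  under eq_fun do rewrite ReMc.
  apply: cvgB; apply: cvgM;[exact: f1|exact: g1|exact: f2|exact: g2].
under eq_fun do rewrite ImMc.
apply: cvgD; apply: cvgM; [exact: f1|exact: g2|exact: f2|exact: g1].
Qed.

Lemma ccont_cexp f : ccont f -> ccont (fun w => cexp (f w)).
Proof.
move=> [f1 f2]; split => x /=; apply: cvgM.
- by apply: continuous_comp; [exact: f1|exact: continuous_expR].
- by apply: continuous_comp; [exact: f2|exact: continuous_cos].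
- by apply: continuous_comp; [exact: f1|exact: continuous_expR].
- by apply: continuous_comp; [exact: f2|exact: continuous_sin].
Qed.

(* At an interior maximum of |f|^2 + e s^2 the two pure second derivatives would add
   up to 4 |f'|^2 + 2 e > 0. *)
Lemma maximum_modulus (f f' f'' : C -> C) (a b c d M : R) :
  hol f f' -> hol f' f'' -> ccont f -> a <= b -> c <= d ->
  (forall s t, a <= s <= b -> c <= t <= d ->
    [|| s == a, s == b, t == c | t == d] -> normc (f (Complex s t)) <= M) ->
  forall s t, a <= s <= b -> c <= t <= d -> normc (f (Complex s t)) <= M.
Proof.
move=> hf hf' [cf1 cf2] ab cd hM s0 t0 s0ab t0cd.
have M0 : 0 <= M.
  by apply: le_trans (hM a c _ _ _); rewrite ?lexx ?eqxx//; exact: normc_ge0.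
rewrite leNgt; apply/negP => Mf.
(* [K] exceeds s^2 on [a, b] and [e * K] is the supposed excess of |f|^2 over M^2 at (s0, t0), so
   |f|^2 + e s^2 is smaller on the boundary than at (s0, t0). *)
pose K := a ^+ 2 + b ^+ 2 + 1.
have K0 : 0 < K by rewrite ltr_wpDl// addr_ge0// sqr_ge0.
pose e := (normc (f (Complex s0 t0)) ^+ 2 - M ^+ 2) / K.
have e0 : 0 < e.
  by rewrite divr_gt0// subr_gt0 ltr_pXn2r// nnegrE// normc_ge0.
pose W (p : R * R) := Re (f (Complex p.1 p.2)) ^+ 2 +
   Im (f (Complex p.1 p.2)) ^+ 2 + e * p.1 ^+ 2.
have cW : continuous W.
  move=> x; apply: cvgD; first apply: cvgD.
  - by apply: cvgM; exact: cf1.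
  - by apply: cvgM; exact: cf2.
  - apply: cvgM; first exact: cvg_cst.
    by apply: cvgM; exact: cvg_fst.
pose A := `[a, b]%classic `*` `[c, d]%classic.
have [|||/= [s1 t1] + Wmax] := @compact_EVT_max _ R W A.
- by exists (s0, t0); split; rewrite /= in_itv.
- by apply: compact_setX; exact: segment_compact.
- exact: continuous_subspaceT.
rewrite inE /A /= !in_itv/= => -[s1ab t1cd].
have Wmax' s t : a <= s <= b -> c <= t <= d -> W (s, t) <= W (s1, t1).
  by move=> sab tcd; apply: Wmax; rewrite inE; split; rewrite /= in_itv.
have W1 : M ^+ 2 + e * K <= W (s1, t1).
  have := Wmax' _ _ s0ab t0cd.
  apply: le_trans; rewrite /W/= -normc_sqr /e divfK ?gt_eqF//.
  by rewrite addrC subrK lerDl mulr_ge0 ?sqr_ge0// ltW.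
have Ws s : a <= s <= b -> s ^+ 2 < K.
  move=> /andP[as_ sb]; rewrite /K.
  have [s0'|s0'] := leP 0 s; nra.
have nb : ~~ [|| s1 == a, s1 == b, t1 == c | t1 == d].
  apply/negP => /(hM _ _ s1ab t1cd).
  rewrite -(@ler_pXn2r _ 2)// ?nnegrE ?normc_ge0// normc_sqr => hb.
  have := Ws _ s1ab; rewrite -(ltr_pM2l e0) => he.
  by have := lt_le_trans (ler_ltD hb he) W1; rewrite /W ltxx.
move: nb; rewrite !negb_or => /and4P[s1a s1b t1c t1d].
move: (s1ab) (t1cd) => /andP[as1 s1b'] /andP[ct1 t1d'].
have {}as1 : a < s1 by rewrite lt_neqAle eq_sym s1a.
have {}s1b' : s1 < b by rewrite lt_neqAle s1b.
have {}ct1 : c < t1 by rewrite lt_neqAle eq_sym t1c.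
have {}t1d' : t1 < d by rewrite lt_neqAle t1d.
pose u s t := Re (f (Complex s t)); pose v s t := Im (f (Complex s t)).
pose u1 s t := Re (f' (Complex s t)); pose v1 s t := Im (f' (Complex s t)).
pose u2 s t := Re (f'' (Complex s t)); pose v2 s t := Im (f'' (Complex s t)).
have us s t : is_derive s (1:R) (u ^~ t) (u1 s t) := ((hf s t).1).1.
have vs s t : is_derive s (1:R) (v ^~ t) (v1 s t) := ((hf s t).1).2.
have u1s s t : is_derive s (1:R) (u1 ^~ t) (u2 s t) := ((hf' s t).1).1.
have v1s s t : is_derive s (1:R) (v1 ^~ t) (v2 s t) := ((hf' s t).1).2.
have ut s t : is_derive t (1:R) (u s) (- v1 s t).
  by have := ((hf s t).2).1; rewrite ReMc/= mul0r mul1r sub0r.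
have vt s t : is_derive t (1:R) (v s) (u1 s t).
  by have := ((hf s t).2).2; rewrite ImMc/= mul0r mul1r add0r.
have u1t s t : is_derive t (1:R) (u1 s) (- v2 s t).
  by have := ((hf' s t).2).1; rewrite ReMc/= mul0r mul1r sub0r.
have v1t s t : is_derive t (1:R) (v1 s) (u2 s t).
  by have := ((hf' s t).2).2; rewrite ImMc/= mul0r mul1r add0r.
have Hs : 2 * (u1 s1 t1 ^+ 2 + v1 s1 t1 ^+ 2 + u s1 t1 * u2 s1 t1 +
   v s1 t1 * v2 s1 t1) + 2 * e <= 0.
  apply: (@second_derivative_max R (fun s => W (s, t1))
    (fun s => 2 * (u s t1 * u1 s t1 + v s t1 * v1 s t1) + 2 * e * s) a b s1).
  - by rewrite as1.
  - move=> s; have := is_deriveD (is_deriveD (is_deriveX 2 (us s t1))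
      (is_deriveX 2 (vs s t1)))
      (is_deriveM (is_derive_cst e s 1) (is_deriveX 2 (is_derive_id s 1))).
    by congr is_derive; rewrite /GRing.scale/= /u /v /cst; ring.
  - have := is_deriveD (is_deriveM (is_derive_cst (2:R) s1 1)
      (is_deriveD (is_deriveM (us s1 t1) (u1s s1 t1))
        (is_deriveM (vs s1 t1) (v1s s1 t1))))
      (is_deriveM (is_derive_cst (2 * e) s1 1) (is_derive_id s1 1)).
    by congr is_derive; rewrite /GRing.scale/= /cst; ring.
  - move=> s /andP[as_ sb]; by apply: Wmax'; rewrite // !ltW.
have Ht : 2 * (u1 s1 t1 ^+ 2 + v1 s1 t1 ^+ 2 - u s1 t1 * u2 s1 t1 -
   v s1 t1 * v2 s1 t1) <= 0.
  apply: (@second_derivative_max R (fun t => W (s1, t))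
    (fun t => 2 * (- (u s1 t * v1 s1 t) + v s1 t * u1 s1 t)) c d t1).
  - by rewrite ct1.
  - move=> t; have := is_deriveD (is_deriveD (is_deriveX 2 (ut s1 t))
      (is_deriveX 2 (vt s1 t))) (is_derive_cst (e * s1 ^+ 2) t 1).
    by congr is_derive; rewrite /GRing.scale/= /u /v /cst; ring.
  - have := is_deriveM (is_derive_cst (2:R) t1 1)
      (is_deriveD (is_deriveN (is_deriveM (ut s1 t1) (v1t s1 t1)))
        (is_deriveM (vt s1 t1) (u1t s1 t1))).
    by congr is_derive; rewrite /GRing.scale/= /cst; ring.
  - move=> t /andP[ct td]; by apply: Wmax'; rewrite // !ltW.
have := sqr_ge0 (u1 s1 t1); have := sqr_ge0 (v1 s1 t1).
lra.
Qed.

End holomorphic.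

(** * Phragmen-Lindelof principle in a quadrant *)

Section phragmen_lindelof.
Context {R : realType}.
Local Notation C := R[i].

(** The regularity that the maximum principle consumes, with the derivatives hidden so that sums,
    products and exponentials compose without naming them. *)
Definition hol2 (f : C -> C) := exists f' f'',
  [/\ hol f f', hol f' f'' & ccont f].

Lemma hol2_cst c : hol2 (fun=> c).
Proof.
by exists (fun=> 0), (fun=> 0); split; [exact: hol_cst|exact: hol_cst|exact: ccont_cst].
Qed.

Lemma hol2_id : hol2 id.
Proof.
by exists (fun=> 1), (fun=> 0); split; [exact: hol_id|exact: hol_cst|exact: ccont_id].
Qed.

Lemma hol2D f g : hol2 f -> hol2 g -> hol2 (fun w => f w + g w).
Proof.
move=> [f1 [f2 [hf hf1 cf]]] [g1 [g2 [hg hg1 cg]]].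
exists (fun w => f1 w + g1 w), (fun w => f2 w + g2 w).
by split; [exact: holD|exact: holD|exact: ccontD].
Qed.

Lemma hol2M f g : hol2 f -> hol2 g -> hol2 (fun w => f w * g w).
Proof.
move=> [f1 [f2 [hf hf1 cf]]] [g1 [g2 [hg hg1 cg]]].
have h1 := holM hf hg1; have h2 := holM hf1 hg.
exists (fun w => f w * g1 w + f1 w * g w); eexists.
by split; [exact: holM|exact: (holD h1 h2)|exact: ccontM].
Qed.

Lemma hol2_cexp g : hol2 g -> hol2 (fun w => cexp (g w)).
Proof.
move=> [g1 [g2 [hg hg1 cg]]].
exists (fun w => g1 w * cexp (g w)); eexists.
split; [exact: hol_cexp|exact: (holM hg1 (hol_cexp hg))|exact: ccont_cexp].
Qed.

Lemma hol2X g n : hol2 g -> hol2 (fun w => g w ^+ n).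
Proof.
move=> hg; elim: n => [|n IH]; first exact: hol2_cst.
by under eq_fun do rewrite exprS; exact: hol2M.
Qed.

Lemma hol2_sum N (f : nat -> C -> C) : (forall n, hol2 (f n)) ->
  hol2 (fun w => \sum_(i < N) f i w).
Proof.
move=> hf; elim: N => [|N IH].
  by under eq_fun do rewrite big_ord0; exact: hol2_cst.
by under eq_fun do rewrite big_ord_recr/=; exact: hol2D.
Qed.

Lemma hol2_max_modulus (f : C -> C) (a b c d M : R) :
  hol2 f -> a <= b -> c <= d ->
  (forall s t, a <= s <= b -> c <= t <= d ->
    [|| s == a, s == b, t == c | t == d] -> normc (f (Complex s t)) <= M) ->
  forall s t, a <= s <= b -> c <= t <= d -> normc (f (Complex s t)) <= M.
Proof. by move=> [f1 [f2 [hf hf1 cf]]]; exact: maximum_modulus hf hf1 cf. Qed.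

(** Serves the passage k -> 0 in the Phragmen-Lindelof argument. If X > Y, the choice k = log (X /
    Y) / (K + 1) contradicts the hypothesis. *)
Lemma le_limit_expR (X Y K : R) : 0 < Y -> 0 <= K ->
  (forall k, 0 < k -> X <= Y * expR (k * K)) -> X <= Y.
Proof.
move=> Y0 K0 H; rewrite leNgt; apply/negP => YX.
have XY : 1 < X / Y by rewrite ltr_pdivlMr// mul1r.
have L0 : 0 < ln (X / Y) by rewrite ln_gt0.
have K1 : 0 < K + 1 by rewrite ltr_wpDl.
have := H (ln (X / Y) / (K + 1)); rewrite divr_gt0// => /(_ isT).
apply/negP; rewrite -ltNge mulrC -ltr_pdivlMr// -[ltRHS]lnK; last first.
  by rewrite posrE (lt_trans _ XY).
by rewrite ltr_expR mulrAC ltr_pdivrMr// ltr_pM2l// ltrDl.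
Qed.

(** Locally uniform convergence of the power series, the only form in which F is known to be
    entire. *)
Definition unif_sum (c : nat -> C) (F : C -> C) := forall rho e : R, 0 < e ->
  exists N0 : nat, forall N, (N0 <= N)%N -> forall z, normc z <= rho ->
    normc (F z - \sum_(i < N) c i * z ^+ i) <= e.

(** The maximum principle is applied to P(e^w) exp(-H(w)) for a partial sum P of the series. As Re H
    >= 0, the factor exp(-H) has modulus at most 1 and does not amplify the error F - P. *)
Lemma unif_sum_max_modulus (c : nat -> C) (F H : C -> C) (a b t0 t1 M : R) :
  unif_sum c F -> hol2 H -> a <= b -> t0 <= t1 ->
  (forall s t, a <= s <= b -> t0 <= t <= t1 -> 0 <= complex.Re (H (Complex s t))) ->
  (forall s t, a <= s <= b -> t0 <= t <= t1 ->
    [|| s == a, s == b, t == t0 | t == t1] ->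
    normc (F (cexp (Complex s t))) <= M * expR (complex.Re (H (Complex s t)))) ->
  forall s t, a <= s <= b -> t0 <= t <= t1 ->
    normc (F (cexp (Complex s t))) <= M * expR (complex.Re (H (Complex s t))).
Proof.
move=> cF hH ab t01 H0 bd s t sab tt.
rewrite -ler_pdivrMr ?expR_gt0// -expRN; apply/ler_addgt0Pl => e e0.
(* On the rectangle |e^w| = e^s <= e^b, so convergence on the disc of radius e^b suffices. *)
have [N0 hN] := cF (expR b) _ (divr_gt0 e0 (ltr0n R 2)).
pose P z := \sum_(i < N0) c i * z ^+ i.
pose Phi w := P (cexp w) * cexp (-1 * H w).
have hPhi : hol2 Phi.
  apply: hol2M; last by apply: hol2_cexp; apply: hol2M => //; exact: hol2_cst.
  apply: (@hol2_sum N0 (fun i w => c i * cexp w ^+ i)) => n.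
  apply: hol2M; first exact: hol2_cst.
  by apply: hol2X; apply: hol2_cexp; exact: hol2_id.
have nH u v : normc (cexp (-1 * H (Complex u v))) =
    expR (- complex.Re (H (Complex u v))).
  by rewrite normc_cexp; congr expR; rewrite ReMc /= oppr0 mul0r subr0 mulN1r.
have close u v : a <= u <= b ->
    normc (F (cexp (Complex u v)) - P (cexp (Complex u v))) <= e / 2.
  move=> /andP[au ub]; apply: hN => //.
  by rewrite normc_cexp/= ler_expR.
have expH u v : a <= u <= b -> t0 <= v <= t1 ->
   expR (- complex.Re (H (Complex u v))) <= 1.
  by move=> uab vt; rewrite -expR0 ler_expR oppr_le0 H0.
have Phib u v : a <= u <= b -> t0 <= v <= t1 ->
    normc (Phi (Complex u v)) <= M + e / 2.
  apply: hol2_max_modulus => // {}u {}v uab vt uv.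
  rewrite /Phi normcM nH.
  have -> : P (cexp (Complex u v)) = F (cexp (Complex u v)) +
    - (F (cexp (Complex u v)) - P (cexp (Complex u v))) by rewrite opprB addrC subrK.
  apply: (@le_trans _ _ ((normc (F (cexp (Complex u v))) + e / 2) *
     expR (- complex.Re (H (Complex u v))))).
    rewrite ler_wpM2r ?expR_ge0//; apply: (le_trans (le_normcD _ _)).
    by rewrite lerD2l normcN close.
  rewrite mulrDl lerD//.
    by rewrite expRN ler_pdivrMr ?expR_gt0// bd.
  by rewrite ler_piMr ?expH// ltW// divr_gt0.
have -> : F (cexp (Complex s t)) = P (cexp (Complex s t)) +
    (F (cexp (Complex s t)) - P (cexp (Complex s t))) by rewrite addrC subrK.
apply: (@le_trans _ _ ((normc (P (cexp (Complex s t))) + e / 2) *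
     expR (- complex.Re (H (Complex s t))))).
  rewrite ler_wpM2r ?expR_ge0//; apply: (le_trans (le_normcD _ _)).
  by rewrite lerD2l close.
rewrite mulrDl [leRHS]addrC [e in leRHS]splitr addrA lerD//.
  by have := Phib _ _ sab tt; rewrite /Phi normcM nH.
by rewrite ler_piMr ?expH// ltW// divr_gt0.
Qed.

Lemma cos_le_cos (x y : R) : `|x| <= y -> y <= pi -> cos y <= cos x.
Proof.
move=> xy ypi; rewrite -[cos x]cos_norm.
by rewrite leNgt ltr_cos ?in_itv/= ?normr_ge0 ?(le_trans xy)// -?leNgt ?ypi ?(le_trans _ xy).
Qed.

Lemma sin_le_id (x : R) : 0 <= x -> sin x <= x.
Proof.
rewrite le_eqVlt => /orP[/eqP <-|x0]; first by rewrite sin0.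
have [|y _] := @MVT R sin cos 0 x x0 (fun y _ => is_derive_sin y).
  exact/continuous_subspaceT/continuous_sin.
by rewrite sin0 !subr0 => ->; rewrite ler_piMl ?cos_le1// ltW.
Qed.

Lemma sin2E (x : R) : sin (2 * x) = 2 * sin x * cos x.
Proof. by rewrite mulr_natl sin_mulr2n; ring. Qed.

(* With w = s + i t = log z, the comparison function below is exp (Re (H w)), where
   H w = A + 1/2 + B' e^{g (w - i pi/4)} - i k e^{2 w} + k e^{(2 + eta) (w - i pi/4)}:
   on the sides t = eta and t = pi/2 - eta the term in e^{2 w} absorbs sin^2(eta) e^{2 s} / 2,
   on the side s = S the last one absorbs e^{2 s} / 2, and then k tends to 0. *)
Lemma phragmen_lindelof (c : nat -> C) (F : C -> C) (M A B g : R) :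
  unif_sum c F -> 0 < M -> 0 <= A -> 0 <= B -> 0 < g < 2 ->
  (forall s t, 0 <= s -> 0 <= t <= pi / 2 ->
    normc (F (cexp (Complex s t))) <=
    M * expR (Num.min (cos t ^+ 2) (sin t ^+ 2) / 2 * expR (2 * s) +
       A + B * expR (g * s))) ->
  forall s t, 0 <= s -> 0 <= t <= pi / 2 ->
    normc (F (cexp (Complex s t))) <=
    M * expR (1 / 2 + A + B / cos (g * (pi / 4)) * expR (g * s)).
Proof.
move=> cF M0 A0 B0 /andP[g0 g2] hF s0 th0 s00 th01.
have pi0 := pi_gt0 R.
have cg0 : 0 < cos (g * (pi / 4)).
  apply: cos_gt0_pihalf; apply/andP; split; last nra.
  by apply: (@lt_trans _ _ 0); [lra|apply: mulr_gt0; lra].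
have cg1 : cos (g * (pi / 4)) <= 1 by exact: cos_le1.
set B' := B / _.
have BB' : B <= B' by rewrite ler_pdivlMr// ler_piMr.
have B'0 : 0 <= B' by exact: le_trans BB'.
(* g < 2 keeps g (t - pi / 4) strictly between -pi / 2 and pi / 2 on the whole quadrant, so the
   harmonic majorant has a positive cosine there. *)
have cosg t : 0 <= t <= pi / 2 -> cos (g * (pi / 4)) <= cos (g * (t - pi / 4)).
  move=> /andP[t0 t1]; apply: cos_le_cos; last nra.
  rewrite normrM gtr0_norm// ler_pM2l// ler_norml; apply/andP; split; lra.
have Bcos t : 0 <= t <= pi / 2 -> B <= B' * cos (g * (t - pi / 4)).
  move=> tt; rewrite /B' mulrAC ler_pdivlMr//.
  by apply: ler_wpM2l => //; exact: cosg.
clearbody B'.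
(* On the two axes the minimum of cos^2 and sin^2 is 0 and the hypothesis already gives the
   conclusion, as [B <= B']. Only interior angles need the comparison function. *)
have [mid|edge] := boolP (0 < th0 < pi / 2); last first.
  apply: le_trans (hF _ _ s00 th01) _; rewrite ler_pM2l// ler_expR.
  have -> : Num.min (cos th0 ^+ 2) (sin th0 ^+ 2) = 0.
    have : th0 = 0 \/ th0 = pi / 2 by lra.
    case=> ->; first by rewrite sin0 cos0 expr0n/= expr1n min_r.
    by rewrite cos_pihalf sin_pihalf expr0n/= expr1n min_l.
  rewrite mul0r mul0r add0r lerD//; first by lra.
  by rewrite ler_wpM2r ?expR_ge0.
apply: (@le_limit_expR _ _ (expR (2 * s0) + expR (3 * s0))).
- by rewrite mulr_gt0 ?expR_gt0.
- by rewrite addr_ge0 ?expR_ge0.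
move=> k k0.
(* [eta <= 1 / 2] gives cos eta >= 1/2 and 2 + eta <= 3; with [eta <= 2 * k] this yields sin^2(eta)
   / 2 <= k sin(2 eta), the inequality needed on the sides. The last two bounds keep th0 inside the
   shrunken sector. *)
pose eta := Num.min (Num.min (2 * k) (1 / 2)) (Num.min (th0 / 2) ((pi / 2 - th0) / 2)).
have [eta0 etak eta12 etath etath'] : [/\ 0 < eta, eta <= 2 * k, eta <= 1 / 2,
   eta <= th0 / 2 & eta <= (pi / 2 - th0) / 2].
  rewrite /eta !lt_min !ge_min !lexx !orbT /=; split => //.
  by apply/andP; split; lra.
clearbody eta.
have se0 : 0 < sin eta by apply: sin_gt0_pi; apply/andP; split; lra.
have se1 : sin eta <= eta by exact: sin_le_id (ltW eta0).
have sek : sin eta <= 2 * k by lra.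
have ce0 : 0 <= cos eta by apply: cos_ge0_pihalf; apply/andP; split; lra.
have ce : 1 / 2 <= cos eta.
  have := cos2Dsin2 eta; nra.
have kce : sin eta ^+ 2 / 2 <= k * (2 * sin eta * cos eta).
  have -> : k * (2 * sin eta * cos eta) = sin eta * (2 * (k * cos eta)) by ring.
  rewrite expr2 -mulrA ler_pM2l//.
  have : k * (1 / 2) <= k * cos eta by rewrite ler_pM2l.
  lra.
have [b2 b2E] : exists b2, b2 = 2 + eta by exists (2 + eta).
have b23 : b2 <= 3 by lra.
(* On the side s = S the exponent 2 + eta must beat e^{2 s} / 2, that is k sin(eta) e^{eta S} >=
   1/2; the witness comes from e^x >= 1 + x. *)
have [S [S0 sS hS]] : exists S, [/\ 0 <= S, s0 <= S &
     1 / 2 <= k * sin eta * expR (eta * S)].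
  have ks0 : 0 < k * sin eta by exact: mulr_gt0.
  exists (s0 + (k * sin eta)^-1 / eta); split.
  - by rewrite addr_ge0// ltW// divr_gt0// invr_gt0.
  - by rewrite lerDl ltW// divr_gt0// invr_gt0.
  rewrite mulrDr mulrCA divff ?gt_eqF// mulr1.
  apply: (@le_trans _ _ (k * sin eta * (k * sin eta)^-1)).
    by rewrite divff ?gt_eqF//; lra.
  rewrite ler_pM2l//; apply: le_trans (expR_ge1Dx _).
  have : 0 <= eta * s0 by rewrite mulr_ge0// ltW.
  lra.
(* Although 2 + eta > 2, the cosine stays at least sin eta on the shrunken sector: [pi <= 4] gives
   (2 + eta) (pi / 4 - eta) <= pi / 2 - eta. *)
have cosb t : eta <= t <= pi / 2 - eta -> sin eta <= cos (b2 * (t - pi / 4)).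
  move=> /andP[t0 t1].
  have -> : sin eta = cos (pi / 2 - eta) by rewrite cosB cos_pihalf sin_pihalf; ring.
  apply: cos_le_cos; last by lra.
  rewrite normrM gtr0_norm; last by lra.
  apply: (@le_trans _ _ (b2 * (pi / 4 - eta))).
    rewrite ler_pM2l; last by lra.
    by rewrite ler_norml; apply/andP; split; lra.
  rewrite b2E; have : pi <= 4 :> R by have /andP[_ ?] := pihalf_02 R; lra.
  by move=> ?; nra.
have sin2 t : eta <= t <= pi / 2 - eta -> 0 <= sin (2 * t).
  by move=> /andP[t0 t1]; apply: sin_ge0_pi; apply/andP; split; lra.
pose i4 : C := Complex 0 (- (pi / 4)).
pose H (w : C) := Complex 0 (- k) * cexp (Complex 2 0 * w) + Complex (A + 1 / 2) 0 +
  Complex B' 0 * cexp (Complex g 0 * (w + i4)) +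
  Complex k 0 * cexp (Complex b2 0 * (w + i4)).
have HRe s t : complex.Re (H (Complex s t)) =
    k * expR (2 * s) * sin (2 * t) + (A + 1 / 2) +
    B' * expR (g * s) * cos (g * (t - pi / 4)) +
    k * expR (b2 * s) * cos (b2 * (t - pi / 4)).
  rewrite /H /cexp !ReDc !ReMc /=.
  have -> : 2 * s - 0 * t = 2 * s by ring.
  have -> : 2 * t + 0 * s = 2 * t by ring.
  have -> : g * (s + 0) - 0 * (t - pi / 4) = g * s by ring.
  have -> : g * (t - pi / 4) + 0 * (s + 0) = g * (t - pi / 4) by ring.
  have -> : b2 * (s + 0) - 0 * (t - pi / 4) = b2 * s by ring.
  have -> : b2 * (t - pi / 4) + 0 * (s + 0) = b2 * (t - pi / 4) by ring.
  ring.
have hH : hol2 H.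
  rewrite /H; repeat (apply: hol2D || apply: hol2M || apply: hol2_cst ||
    apply: hol2_id || apply: hol2_cexp).
clearbody H.
have kE x : 0 <= k * expR x by rewrite mulr_ge0 ?expR_ge0// ltW.
have e1 : eta <= pi / 2 - eta by lra.
have s0S : 0 <= s0 <= S by rewrite s00.
have eth : eta <= th0 <= pi / 2 - eta by lra.
apply: le_trans (@unif_sum_max_modulus c F H 0 S eta (pi / 2 - eta) M cF hH S0 e1
  _ _ s0 th0 s0S eth) _; last rewrite HRe.
- move=> s t s01 tt; rewrite HRe.
  have tt' : 0 <= t <= pi / 2 by lra.
  have h1 := sin2 _ tt; have h2 := Bcos _ tt'; have h3 := cosb _ tt.
  rewrite !addr_ge0//.
  + by rewrite mulr_ge0// mulr_ge0 ?expR_ge0// ltW.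
  + by rewrite mulrAC mulr_ge0 ?expR_ge0// (le_trans B0).
  + exact: mulr_ge0 (kE _) (le_trans (ltW se0) h3).
- move=> s t /andP[s1 s2] tt edge; have tt' : 0 <= t <= pi / 2 by lra.
  apply: le_trans (hF _ _ s1 tt') _; rewrite ler_pM2l// ler_expR HRe.
  have h1 := sin2 _ tt; have h2 := Bcos _ tt'; have h3 := cosb _ tt.
  have k1 : 0 <= k * expR (2 * s) * sin (2 * t).
    by rewrite mulr_ge0// mulr_ge0 ?expR_ge0// ltW.
  have k2 : 0 <= k * expR (b2 * s) * cos (b2 * (t - pi / 4)).
    exact: mulr_ge0 (kE _) (le_trans (ltW se0) h3).
  have k3 : B * expR (g * s) <= B' * expR (g * s) * cos (g * (t - pi / 4)).
    by rewrite mulrAC ler_wpM2r ?expR_ge0.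
  suff : Num.min (cos t ^+ 2) (sin t ^+ 2) / 2 * expR (2 * s) <=
    1 / 2 + k * expR (2 * s) * sin (2 * t) +
      k * expR (b2 * s) * cos (b2 * (t - pi / 4)) by lra.
  have k2' : k * expR (2 * s) * sin (2 * t) <= 1 / 2 + k * expR (2 * s) * sin (2 * t) +
      k * expR (b2 * s) * cos (b2 * (t - pi / 4)) by lra.
  have e20 := expR_gt0 (2 * s).
  have min1 : Num.min (cos t ^+ 2) (sin t ^+ 2) <= 1.
    by rewrite ge_min; apply/orP; left; rewrite -(cos2Dsin2 t) lerDl sqr_ge0.
  have edgeb : Num.min (cos t ^+ 2) (sin t ^+ 2) <= sin eta ^+ 2 ->
      sin (2 * t) = 2 * sin eta * cos eta ->
    Num.min (cos t ^+ 2) (sin t ^+ 2) / 2 * expR (2 * s) <=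
      k * expR (2 * s) * sin (2 * t).
    move=> mn ->; rewrite [leRHS]mulrAC ler_pM2r//.
    by apply: le_trans kce; rewrite ler_pM2r.
  case/or4P : edge => /eqP E.
  + rewrite E mulr0 expR0 in k1 k2 *; by lra.
  + apply: (@le_trans _ _ (k * expR (b2 * s) * cos (b2 * (t - pi / 4)))); last by lra.
    apply: (@le_trans _ _ (1 / 2 * expR (2 * s))); first by rewrite ler_pM2r// ler_pM2r.
    apply: (@le_trans _ _ (k * expR (b2 * s) * sin eta)); last by rewrite ler_wpM2l.
    have -> : b2 * s = 2 * s + eta * s by rewrite b2E; ring.
    rewrite expRD (_ : k * _ * _ = k * sin eta * expR (eta * s) * expR (2 * s)).
      by rewrite ler_pM2r// E.
    by ring.
  + apply: le_trans (edgeb _ _) k2'; last by rewrite E sin2E.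
    by rewrite E ge_min lexx orbT.
  + have sE : sin (2 * t) = 2 * sin eta * cos eta.
      have -> : 2 * t = pi - 2 * eta by rewrite E; field.
      by rewrite sinB sinpi cospi sin2E; ring.
    apply: le_trans (edgeb _ sE) k2'.
    by rewrite E cosB cos_pihalf sin_pihalf mul0r add0r mul1r ge_min lexx.
(* At the fixed point (s0, th0) the two terms in k are at most k (e^{2 s0} + e^{3 s0}), since 2 +
   eta <= 3; this bound involves neither eta nor S, so k may tend to 0. *)
rewrite -[leRHS]mulrA -expRD ler_pM2l// ler_expR.
have e20 := expR_gt0 (2 * s0).
have b0 : expR (b2 * s0) <= expR (3 * s0) by rewrite ler_expR ler_wpM2r.
have h1 : k * expR (2 * s0) * sin (2 * th0) <= k * expR (2 * s0).
  by rewrite ler_piMr ?sin_le1// mulr_ge0// ltW.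
have h2 : k * expR (b2 * s0) * cos (b2 * (th0 - pi / 4)) <= k * expR (3 * s0).
  apply: (@le_trans _ _ (k * expR (b2 * s0))); last by rewrite ler_pM2l.
  by rewrite ler_piMr ?cos_le1// mulr_ge0 ?expR_ge0// ltW.
have h3 : B' * expR (g * s0) * cos (g * (th0 - pi / 4)) <= B' * expR (g * s0).
  by rewrite ler_piMr ?cos_le1// mulr_ge0 ?expR_ge0// ltW.
lra.
Qed.

End phragmen_lindelof.

(** * Growth of the weight function *)

Section growth.
Context {R : realType}.
Local Notation mu := (@lebesgue_measure R).

Lemma pow2_bracket (y : R) : 1 <= y -> exists k : nat, 2 ^+ k <= y < 2 ^+ k.+1.
Proof.
move=> y1; have ex : exists k : nat, y < 2 ^+ k.+1.
  exists (Num.truncn y); apply: (lt_trans (truncnS_gt y)).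
  by rewrite -natrX ltr_nat ltn_expl.
case: (ex_minnP ex) => k yk kmin; exists k; rewrite yk andbT.
case: k yk kmin => [|k] _ kmin; first by rewrite expr0.
by rewrite leNgt; apply/negP => /kmin; rewrite ltnn.
Qed.

Variable omega : R -> R.
Hypothesis omega_weight : weight_function omega.
Hypothesis omega_integral : integral_bigO omega.

Let omega_ge0 x : 0 <= x -> 0 <= omega x.
Proof. by case: omega_weight => + _ _; exact. Qed.

Let omega_homo x y : 0 <= x -> x <= y -> omega x <= omega y.
Proof. by case: omega_weight => _ + _; exact. Qed.

Let tail x := (\int[mu]_(t in `[x, +oo[) (omega t / t ^+ 3)%:E)%E.

Let measurable_integrand (a : R) (b : itv_bound R) : 0 < a ->
  measurable_fun [set` Interval (BLeft a) b] (fun t : R => omega t / t ^+ 3).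
Proof.
move=> a0.
(* [omega] is monotone only on [0, oo); precomposition with [Num.max 0] makes it monotone on the
   whole line, hence measurable. *)
apply: (eq_measurable_fun (fun t : R => omega (Num.max 0 t) * (t ^+ 3)^-1)).
  move=> t; rewrite inE/= in_itv/= => /andP[at_ _].
  by rewrite max_r// ltW// (lt_le_trans a0).
apply: measurable_funM.
  apply: measurable_funTS; apply: nondecreasing_measurable => //.
  move=> x y xy; apply: omega_homo; first by rewrite le_max lexx.
  by rewrite ge_max !le_max lexx xy orbT.
apply: subspace_continuous_measurable_fun => //.
apply: continuous_in_subspaceT => t; rewrite inE/= in_itv/= => /andP[at_ _].
apply: cvgV; last exact: exprn_continuous.
by rewrite expf_eq0/= gt_eqF// (lt_le_trans a0).
Qed.

Let integrand_ge0 (a t : R) : 0 < a -> a <= t -> (0 <= (omega t / t ^+ 3)%:E)%E.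
Proof.
move=> a0 at_; have t0 : 0 <= t by rewrite ltW// (lt_le_trans a0).
by rewrite lee_fin divr_ge0 ?exprn_ge0 ?omega_ge0.
Qed.

(** On [x, 2 x) the integrand is at least omega(x) / (2 x)^3, and the interval has length x. *)
Lemma tail_dyadic (x : R) : 0 < x ->
  ((omega x / (8 * x ^+ 2))%:E + tail (2 * x)%R <= tail x)%E.
Proof.
move=> x0; have x2 : x < 2 * x by rewrite ltr_pMl// ltr1n.
have E : `[x, (2 * x)%R[%classic `|` `[(2 * x)%R, +oo[%classic = `[x, +oo[%classic.
  by rewrite -itv_bndbnd_setU// bnd_simp//; exact: ltW.
have -> : tail x = (\int[mu]_(t in `[x, (2 * x)%R[) (omega t / t ^+ 3)%:E +
    tail (2 * x)%R)%E.
  rewrite /tail -ge0_integral_setU//= ?E//.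
  - by apply/measurable_EFinP; exact: measurable_integrand.
  - move=> t tx; have : (`[x, +oo[%classic : set R) t by rewrite -E; exact: tx.
    by rewrite /= in_itv/= andbT; exact: integrand_ge0.
  - apply/disj_setPS => t/=; rewrite !in_itv/= andbT => -[/andP[_ t2]].
    by rewrite leNgt t2.
apply: leeD => //.
have -> : (omega x / (8 * x ^+ 2))%:E =
    (\int[mu]_(t in `[x, (2 * x)%R[) cst (omega x / (2 * x) ^+ 3)%R%:E t)%E.
  rewrite integral_cst//=.
  rewrite lebesgue_measure_itv/= lte_fin x2 -EFinD -EFinM.
  by congr EFin; have : x != 0 by [rewrite gt_eqF]; move=> ?; field.
apply: ge0_le_integral => //.
- by move=> t _; rewrite lee_fin divr_ge0 ?omega_ge0 ?exprn_ge0 ?ltW// mulr_gt0.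
- by apply/measurable_EFinP; exact: measurable_integrand.
- move=> t; rewrite /= in_itv/= => /andP[xt t2]; rewrite lee_fin.
  have t0 : 0 < t by exact: lt_le_trans xt.
  apply: ler_pM; rewrite ?omega_ge0 ?invr_ge0 ?exprn_ge0 ?omega_homo// ?ltW//.
    by rewrite mulr_gt0.
  by rewrite ltf_pV2 ?posrE ?exprn_gt0// ?mulr_gt0// ltrXn2r ?nnegrE ?ltW// mulr_gt0.
Qed.

(* The tail J x of the integral of omega(t) / t^3 satisfies J (2 x) <= q J x with q < 1,
   whence omega (2^k x) = O((4 q)^k omega x); thus g = log_2 (4 q) < 2. *)
Lemma omega_growth : exists K g : R, [/\ 1 <= K, 0 < g < 2 &
  forall rho r, 0 < rho -> 0 <= r ->
    omega r <= K * (omega rho + 1) * (1 + (r / rho) `^ g)].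
Proof.
have [C0 [x1 [x1r hC0]]] := omega_integral.
(* C >= 1 gives q >= 7/8 below, hence 4 q > 1 and g > 0. The bound at infinity holds strictly beyond
   x1, whence x1 + 1. *)
pose C := Num.max C0 1; pose x0 := Num.max (x1 + 1) 1.
have C1 : 1 <= C by rewrite le_max lexx orbT.
have C'0 : 0 < C by exact: lt_le_trans C1.
have x01 : 1 <= x0 by rewrite le_max lexx orbT.
have tail_le x : x0 <= x -> (tail x <= (C * (omega x / x ^+ 2))%:E)%E.
  move=> x0x; have xx1 : x1 < x.
    by apply: lt_le_trans x0x; rewrite lt_max ltrDl ltr01.
  apply: le_trans (hC0 _ xx1) _; rewrite lee_fin ler_wpM2r//.
    by rewrite divr_ge0 ?omega_ge0 ?sqr_ge0// (le_trans _ x0x)// (le_trans _ x01).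
  by rewrite le_max lexx.
have tail_ge0 x : x0 <= x -> (0 <= tail x)%E.
  move=> x0x; have xp : 0 < x by rewrite (lt_le_trans _ x0x)// (lt_le_trans _ x01).
  apply: integral_ge0 => t/=; rewrite in_itv/= andbT; exact: integrand_ge0.
pose J x := fine (tail x).
have JE x : x0 <= x -> tail x = (J x)%:E.
  move=> x0x; rewrite fineK// ge0_fin_numE ?tail_ge0//.
  by apply: le_lt_trans (tail_le _ x0x) _; rewrite ltry.
have J0 x : x0 <= x -> 0 <= J x by move=> xx; rewrite fine_ge0 ?tail_ge0.
have JC x : x0 <= x -> J x <= C * (omega x / x ^+ 2).
  by move=> xx; rewrite -lee_fin -JE ?tail_le.
have pos x : x0 <= x -> 0 < x.
  by move=> xx; rewrite (lt_le_trans _ xx)// (lt_le_trans _ x01).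
have dbl x : x0 <= x -> x0 <= 2 * x.
  by move=> xx; rewrite (le_trans xx)// ler_peMl ?ler1n// ltW ?pos.
have Jd x : x0 <= x -> omega x / (8 * x ^+ 2) + J (2 * x) <= J x.
  move=> xx; have := tail_dyadic (pos _ xx).
  by rewrite !JE ?dbl// -EFinD lee_fin.
(* J x <= C omega(x) / x^2 makes the dyadic loss omega(x) / (8 x^2) at least J x / (8 C). *)
pose q := 1 - (8 * C)^-1.
have C8 : 0 < (8 * C)^-1 <= 8^-1.
  rewrite invr_gt0 mulr_gt0//= lef_pV2 ?posrE ?mulr_gt0//.
  by rewrite ler_pMr.
have q78 : 7 / 8 <= q < 1 by rewrite /q; apply/andP; split; lra.
have Jq x : x0 <= x -> J (2 * x) <= q * J x.
  move=> xx; have h1 := Jd _ xx; have h2 := JC _ xx.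
  have : (8 * C)^-1 * J x <= omega x / (8 * x ^+ 2).
    rewrite ler_pdivrMl ?mulr_gt0//; apply: le_trans h2 _.
    by rewrite le_eqVlt; apply/orP; left; apply/eqP; have := pos _ xx => ?; field; rewrite gt_eqF.
  by rewrite /q mulrBl mul1r; lra.
have dbln k x : x0 <= x -> x0 <= 2 ^+ k * x.
  by move=> xx; elim: k => [|k IH]; rewrite ?mul1r// exprS -mulrA dbl.
have Jqk k x : x0 <= x -> J (2 ^+ k * x) <= q ^+ k * J x.
  move=> xx; elim: k => [|k IH]; first by rewrite !mul1r.
  rewrite !exprS -!mulrA; apply: le_trans (Jq _ (dbln _ _ xx)) _.
  by rewrite ler_wpM2l//; lra.
(* At y = 2^k x the dyadic loss bounds omega(y) by 8 y^2 J y; the factor y^2 costs 4^k while the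
   tail gains q^k. *)
have om2 k x : x0 <= x -> omega (2 ^+ k * x) <= 8 * C * (4 * q) ^+ k * omega x.
  move=> xx; have px := pos _ xx; have ppx := pos _ (dbln k _ xx).
  have h1 := Jd _ (dbln k _ xx).
  have h2 : omega (2 ^+ k * x) <= 8 * (2 ^+ k * x) ^+ 2 * J (2 ^+ k * x).
    rewrite -ler_pdivrMl ?mulr_gt0 ?exprn_gt0// mulrC.
    by apply: le_trans h1; rewrite lerDl J0// dbl// dbln.
  apply: le_trans h2 _.
  apply: (@le_trans _ _ (8 * (2 ^+ k * x) ^+ 2 * (q ^+ k * (C * (omega x / x ^+ 2))))).
    apply: ler_wpM2l; first by rewrite mulr_ge0 ?sqr_ge0.
    apply: le_trans (Jqk _ _ xx) _.
    by rewrite ler_wpM2l ?exprn_ge0 ?JC//; lra.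
  rewrite le_eqVlt; apply/orP; left; apply/eqP.
  have -> : (4 * q) ^+ k = (2 ^+ k) ^+ 2 * q ^+ k :> R.
    by rewrite exprMn -exprM mulnC exprM; congr (_ ^+ _ * _); rewrite -natrX.
  by field; rewrite gt_eqF.
pose g := ln (4 * q) / ln 2.
have ln2 : 0 < ln (2 : R) by rewrite ln_gt0 ?ltr1n.
have q4 : 1 < 4 * q by lra.
have g02 : 0 < g < 2.
  rewrite /g divr_gt0 ?ln_gt0 ?ltr1n//=.
  rewrite ltr_pdivrMr// [ltRHS]mulr_natl -lnXn// ltr_ln ?posrE -?natrX//; lra.
have pow_g k : (2 ^+ k) `^ g = (4 * q) ^+ k.
  rewrite -powR_mulrn// -powRrM mulrC powRrM powR_mulrn ?powR_ge0//; congr (_ ^+ _).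
  by rewrite /powR pnatr_eq0/= /g divfK ?gt_eqF// lnK// posrE; lra.
(* With 2^k <= r / x < 2^(k+1), rounding up to the next power costs a factor 4 q <= 4, so that 8
   becomes 32. *)
have omr x r : x0 <= x -> x <= r -> omega r <= 32 * C * (r / x) `^ g * omega x.
  move=> xx xr; have px := pos _ xx.
  have [|k /andP[k1 k2]] := @pow2_bracket (r / x); first by rewrite ler_pdivlMr// mul1r.
  have rk : r <= 2 ^+ k.+1 * x by rewrite -ler_pdivrMr// ltW.
  apply: le_trans (omega_homo _ rk) _; first by rewrite ltW// (lt_le_trans px).
  apply: le_trans (om2 _ _ xx) _.
  apply: ler_wpM2r; first by rewrite omega_ge0 ?ltW.
  have : (4 * q) ^+ k <= (r / x) `^ g.
    rewrite -pow_g ge0_ler_powR ?nnegrE ?exprn_ge0//; first by lra.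
    by rewrite divr_ge0// ltW// (lt_le_trans px).
  move=> h; rewrite exprS.
  have h0 : 0 <= (4 * q) ^+ k by rewrite exprn_ge0//; lra.
  apply: (@le_trans _ _ (8 * C * (4 * (4 * q) ^+ k))).
    by rewrite ler_wpM2l ?mulr_ge0// ?ler_wpM2r//; lra.
  by have := @ler_wpM2l _ (32 * C) _ _ _ h; rewrite mulr_ge0 ?(ltW C'0)// => /(_ isT); lra.
pose K := 32 * C * (omega x0 + 1).
have w0 : 0 <= omega x0 by rewrite omega_ge0// (le_trans _ x01).
have CK : 32 * C <= K by rewrite ler_peMr ?mulr_ge0 ?(ltW C'0)// lerDr.
exists K, g; split => //; first by lra.
move=> rho r rho0 r0.
have wr := omega_ge0 (ltW rho0).
have P0 : 0 <= (r / rho) `^ g by exact: powR_ge0.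
have K0 : 0 <= K by lra.
have [rr|rr] := leP r rho.
  apply: le_trans (omega_homo r0 rr) _.
  apply: (@le_trans _ _ (1 * (omega rho + 1) * 1)); first by rewrite mul1r mulr1 lerDl.
  apply: ler_pM => //; [by rewrite mul1r addr_ge0| |by rewrite lerDl].
  by rewrite ler_wpM2r ?addr_ge0//; lra.
have [x0r|x0r] := leP x0 rho.
  apply: le_trans (omr _ _ x0r (ltW rr)) _; rewrite mulrAC.
  apply: ler_pM => //; first by rewrite mulr_ge0// mulr_ge0 ?(ltW C'0).
    by apply: ler_pM => //; [rewrite mulr_ge0 ?(ltW C'0)|rewrite lerDl].
  by rewrite lerDr.
have [rx0|rx0] := leP r x0.
  apply: le_trans (omega_homo r0 rx0) _.
  apply: (@le_trans _ _ (K * 1 * 1)).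
    rewrite !mulr1 /K; apply: (@le_trans _ _ (1 * (omega x0 + 1))).
      by rewrite mul1r lerDl.
    by rewrite ler_wpM2r ?addr_ge0//; lra.
  apply: ler_pM => //; last by rewrite lerDl.
    by rewrite mulr1.
  by rewrite ler_wpM2l// lerDr.
apply: le_trans (omr _ _ (lexx _) (ltW rx0)) _.
rewrite mulrAC; apply: ler_pM; [|exact: powR_ge0| |].
- by rewrite mulr_ge0// mulr_ge0 ?(ltW C'0).
- apply: (@le_trans _ _ (K * 1)); last by rewrite ler_wpM2l// lerDr.
  by rewrite mulr1 /K ler_wpM2l ?mulr_ge0 ?(ltW C'0)// lerDl.
- apply: (@le_trans _ _ ((r / rho) `^ g)); last by rewrite lerDr.
  rewrite ge0_ler_powR ?nnegrE//.
  + by lra.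
  + by rewrite divr_ge0// (le_trans _ x01).
  + by rewrite divr_ge0// ltW.
  + by rewrite ler_wpM2l// lef_pV2 ?posrE ?ltW// (lt_trans rho0).
Qed.

End growth.

(** * Integration over the line *)

Section integration.
Context {R : realType}.
Local Notation mu := (@lebesgue_measure R).

Definition L1 (f : R -> R) := mu.-integrable [set: R] (EFin \o f).

Lemma ae_imp (P Q : R -> Prop) : (forall x, P x -> Q x) ->
  {ae mu, forall x, P x} -> {ae mu, forall x, Q x}.
Proof.
by move=> PQ p; apply: (@filterS _ _ (ae_filter_ringOfSetsType mu) _ _ _ p).
Qed.

Lemma ae_imp2 (P Q S : R -> Prop) : (forall x, P x -> Q x -> S x) ->
  {ae mu, forall x, P x} -> {ae mu, forall x, Q x} -> {ae mu, forall x, S x}.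
Proof.
by move=> PQ p; apply: (@filterS2 _ _ (ae_filter_ringOfSetsType mu) _ _ _ _ p).
Qed.

Lemma measurable_EFin (f : R -> R) : measurable_fun setT f ->
  measurable_fun setT (EFin \o f).
Proof. by move=> ?; apply/measurable_EFinP. Qed.

Lemma L1_measurable f : L1 f -> measurable_fun setT f.
Proof. by move=> /integrableP[+ _]; move=> /measurable_EFinP. Qed.

Lemma continuous_measurable (f : R -> R) : continuous f -> measurable_fun setT f.
Proof. exact: continuous_measurable_fun. Qed.

Lemma L1_le (g f : R -> R) : measurable_fun setT f -> (forall x, `|f x| <= g x) ->
  L1 g -> L1 f.
Proof.
move=> mf fg; apply: le_integrable => //; first exact: measurable_EFin.
by move=> x _ /=; rewrite lee_fin (le_trans (fg x))// ler_norm.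
Qed.

Lemma L1D f g : L1 f -> L1 g -> L1 (fun x => f x + g x).
Proof. by move=> f1 g1; have := integrableD measurableT f1 g1; apply: eq_integrable. Qed.

Lemma L1B f g : L1 f -> L1 g -> L1 (fun x => f x - g x).
Proof. by move=> f1 g1; have := integrableB measurableT f1 g1; apply: eq_integrable. Qed.

Lemma L1Z k f : L1 f -> L1 (fun x => k * f x).
Proof. by move=> f1; have := integrableZl measurableT k f1; apply: eq_integrable. Qed.

Lemma L1_norm f : L1 f -> L1 (fun x => `|f x|).
Proof. by move=> /integrable_norm. Qed.

Lemma L1_mulb (K : R) (f g : R -> R) : measurable_fun setT g -> (forall x, `|g x| <= K) ->
  L1 f -> L1 (fun x => f x * g x).
Proof.
move=> mg gK f1; apply: (L1_le _ _ (L1Z K (L1_norm f1))).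
  by apply: measurable_funM => //; exact: L1_measurable.
by move=> x; rewrite normrM mulrC ler_wpM2r.
Qed.

Lemma L1_sum (I : Type) (s : seq I) (P : pred I) (f : I -> R -> R) :
  (forall i, P i -> L1 (f i)) -> L1 (fun x => \sum_(i <- s | P i) f i x).
Proof.
move=> hf; elim: s => [|i s IH].
  by under eq_fun do rewrite big_nil; exact: integrable0.
under eq_fun do rewrite big_cons.
by have [Pi|//] := boolP (P i); apply: L1D => //; exact: hf.
Qed.

Lemma Rint0 : \int[mu]_x (0 : R) = 0.
Proof. by rewrite Rintegral_cst// mul0r. Qed.

Lemma Rint_sum (I : Type) (s : seq I) (f : I -> R -> R) :
  (forall i, L1 (f i)) ->
  \int[mu]_x (\sum_(i <- s) f i x) = \sum_(i <- s) \int[mu]_x f i x.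
Proof.
move=> hf; elim: s => [|i s IH].
  rewrite big_nil -[RHS]Rint0.
  by apply: eq_Rintegral => x _; rewrite big_nil.
rewrite big_cons -IH -RintegralD//; [|exact: hf|exact: L1_sum].
by apply: eq_Rintegral => x _; rewrite big_cons.
Qed.

Lemma Rint_fin f : L1 f -> (\int[mu]_x (f x)%:E)%E = (\int[mu]_x f x)%:E.
Proof. by move=> f1; rewrite /Rintegral fineK//; exact: integrable_fin_num. Qed.

Lemma L1_ae_le (g f : R -> R) : measurable_fun setT f ->
  {ae mu, forall x, `|f x| <= g x} -> L1 g -> L1 f.
Proof.
move=> mf fg g1.
apply/integrableP; split; first exact: measurable_EFin.
have /integrableP[mg] := L1_norm g1; apply: le_lt_trans.
apply: ae_ge0_le_integral => //.
- by apply: measurableT_comp => //; exact: measurable_EFin.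
- by apply: measurableT_comp.
- apply: ae_imp fg => x /= fgx _; rewrite lee_fin normr_id.
  by rewrite (le_trans fgx)// ler_norm.
Qed.

Lemma Rint_dct (u : nat -> R -> R) (f g : R -> R) :
  (forall n, measurable_fun setT (u n)) -> measurable_fun setT f -> L1 g ->
  {ae mu, forall x, forall n, `|u n x| <= g x} ->
  {ae mu, forall x, u n x @[n --> \oo] --> f x} ->
  L1 f /\ \int[mu]_x u n x @[n --> \oo] --> \int[mu]_x f x.
Proof.
move=> mu_ mf g1 ug uf.
have [] := @dominated_convergence _ _ _ mu setT measurableT (fun n => EFin \o u n)
  (EFin \o f) (EFin \o g).
- by move=> n; exact: measurable_EFin.
- exact: measurable_EFin.
- apply: ae_imp uf => x ux _ /=; apply: cvg_EFin => //.
  exact: nearW.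
- exact: g1.
- by apply: ae_imp ug => x ux n _ /=; rewrite lee_fin.
move=> f1 _ cv; split => //.
by rewrite /Rintegral; apply: fine_cvg; rewrite fineK; [exact: cv|exact: integrable_fin_num].
Qed.

(** Domination by a product of integrable functions gives integrability on the plane; the exchanges
    of integrals below have this shape. *)
Lemma Rint_fubini (F : R * R -> R) (a b : R -> R) :
  measurable_fun setT F -> L1 a -> L1 b ->
  (forall x y, `|F (x, y)| <= a x * b y) ->
  \int[mu]_x \int[mu]_y F (x, y) = \int[mu]_y \int[mu]_x F (x, y).
Proof.
move=> mF a1 b1 Fab.
have mE : measurable_fun [set: R * R] (EFin \o F) by apply/measurable_EFinP.
have sx x : measurable_fun setT (fun y => F (x, y)).
  exact: (measurableT_comp mF (measurable_pair1 x)).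
have sy y : measurable_fun setT (fun x => F (x, y)).
  exact: (measurableT_comp mF (measurable_pair2 y)).
have Fx x : L1 (fun y => F (x, y)).
  by apply: (L1_le (sx x) (Fab x)); exact: L1Z.
have Fy y : L1 (fun x => F (x, y)).
  apply: (L1_le (sy y) (fun x => Fab x y)).
  by under eq_fun do rewrite mulrC; exact: L1Z.
have iF : (mu \x mu)%E.-integrable setT (EFin \o F).
  apply/integrable12ltyP => //.
  apply: (@le_lt_trans _ _ (\int[mu]_x (`|a x| * \int[mu]_y `|b y|)%:E)%E).
    apply: ge0_le_integral => //.
    - by move=> x _; apply: integral_ge0.
    - apply: (@measurable_fun_fubini_tonelli_F _ _ _ _ _ mu (abse \o (EFin \o F))).
        exact: measurableT_comp.
      by move=> p; exact: abse_ge0.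
    - apply/measurable_EFinP; apply: measurable_funM => //.
      by apply: measurableT_comp => //; exact: L1_measurable.
    - move=> x _; rewrite -RintegralZl//; last exact: L1_norm.
      rewrite -Rint_fin; last exact/L1Z/L1_norm.
      apply: ge0_le_integral => //.
      + by apply: (@measurable_EFin (fun y => `|F (x, y)|)); apply: measurableT_comp.
      + apply/measurable_EFinP; apply: measurable_funM => //.
        by apply: measurableT_comp => //; exact: L1_measurable.
      + by move=> y _; rewrite lee_fin -normrM (le_trans (Fab x y))// ler_norm.
  rewrite Rint_fin ?ltry//.
  by under eq_fun do rewrite mulrC; apply: L1Z; exact: L1_norm.
have := Fubini iF.
rewrite /= /Rintegral => E.
congr fine; transitivity (\int[mu]_x \int[mu]_y (F (x, y))%:E)%E.
  by apply: eq_integral => x _; rewrite Rint_fin.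
by rewrite E; apply: eq_integral => y _; rewrite Rint_fin.
Qed.

(** Tonelli's theorem gives measurability for nonnegative integrands, so F is written as (F + |F|) -
    |F|; the majorant makes both inner integrals finite. *)
Lemma L1_fubini_inner (F : R * R -> R) (a b : R -> R) :
  measurable_fun setT F -> L1 a -> L1 b ->
  (forall x y, `|F (x, y)| <= a x * b y) ->
  measurable_fun setT (fun x => \int[mu]_y F (x, y)).
Proof.
move=> mF a1 b1 Fab.
have pos x : measurable_fun setT (fun y => F (x, y)).
  exact: (measurableT_comp mF (measurable_pair1 x)).
have Fx x : L1 (fun y => F (x, y)).
  by apply: (L1_le (pos x) (Fab x)); exact: L1Z.
pose G (p : R * R) := F p + `|F p|.
have mG : measurable_fun setT G.
  by apply: measurable_funD => //; exact: measurableT_comp.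
have G0 p : 0 <= G p by rewrite /G -lerBlDl sub0r -normrN ler_norm.
have mI (H : R * R -> R) : measurable_fun setT H -> (forall p, 0 <= H p) ->
    measurable_fun setT (fun x => \int[mu]_y H (x, y)).
  move=> mH H0; rewrite /Rintegral; apply: (@measurableT_comp _ _ _ _ _ _ (@fine R)); first exact: fine_measurable.
  apply: (@measurable_fun_fubini_tonelli_F _ _ _ _ _ mu (EFin \o H)).
    by apply/measurable_EFinP.
  by move=> p /=; rewrite lee_fin.
rewrite (_ : (fun x => _) = fun x => \int[mu]_y G (x, y) - \int[mu]_y `|F (x, y)|).
  apply: measurable_funB; first exact: mI.
  by apply: (mI (fun p => `|F p|)) => //; exact: measurableT_comp.
apply/funext => x; rewrite -RintegralB//; last exact: L1_norm.
  by apply: eq_Rintegral => y _; rewrite /G addrK.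
by apply: L1D => //; exact: L1_norm.
Qed.

End integration.

(** * Gaussian integrals and integration by parts *)

Section gaussian.
Context {R : realType}.
Local Notation mu := (@lebesgue_measure R).

Lemma continuous_quad_exp (c b : R) : continuous (fun x : R => expR (- (c * (x - b) ^+ 2))).
Proof.
move=> x; apply: continuous_comp; last exact: continuous_expR.
apply: cvgN; apply: cvgM; first exact: cvg_cst.
by rewrite /= expr2; apply: cvgM; apply: cvgB => //; exact: cvg_cst.
Qed.

Lemma integral_gaussian (c b : R) : 0 < c ->
  (\int[mu]_x (expR (- (c * (x - b) ^+ 2)))%:E)%E = (Num.sqrt (pi / c))%:E.
Proof.
move=> c0; have s0 : 0 < Num.sqrt c by rewrite sqrtr_gt0.
have dF (x : R) : is_derive x (1:R) (fun x => Num.sqrt c * (x - b)) (Num.sqrt c).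
  have := is_deriveM (is_derive_cst (Num.sqrt c) x 1)
    (is_deriveB (is_derive_id x 1) (is_derive_cst b x 1)).
  by congr is_derive; rewrite /GRing.scale/=; ring.
have dFE : derive1 (fun x : R => Num.sqrt c * (x - b)) = fun=> Num.sqrt c.
  by apply/funext => x; rewrite derive1E (@derive_val _ _ _ _ _ _ _ (dF x)).
have := @increasing_ge0_integration_by_substitutionT R
  (fun x => Num.sqrt c * (x - b)) (@gauss_fun R).
rewrite integralT_gauss dFE => /(_ _ _ _ _ _ _ _ _ _) H.
have {}H : (Num.sqrt pi)%:E = (\int[mu]_x (Num.sqrt c * expR (- (c * (x - b) ^+ 2)))%:E)%E.
  rewrite H.
  - apply: eq_integral => x _; congr EFin; rewrite /= [RHS]mulrC.
    rewrite [LHS](_ : _ = expR (- (Num.sqrt c * (x - b)) ^+ 2) * Num.sqrt c)//.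
    by rewrite exprMn sqr_sqrtr// ltW.
  - by move=> x y xy; rewrite ltr_pM2l// ltrD2r.
  - by move=> x; exact: cvg_cst.
  - exact: is_cvg_cst.
  - exact: is_cvg_cst.
  - by move=> x; exact: (@ex_derive _ _ _ _ _ _ _ (dF x)).
  - apply/cvgrNyPle => A; near=> x.
    rewrite -ler_pdivlMl// lerBlDr; near: x; apply: nbhs_ninfty_le; exact: num_real.
  - apply/cvgryPge => A; near=> x.
    rewrite -ler_pdivrMl// lerBrDr; near: x; apply: nbhs_pinfty_ge; exact: num_real.
  - exact: continuous_gauss_fun.
  - by move=> x; exact: gauss_fun_ge0.
move: H; under eq_integral do rewrite EFinM.
rewrite ge0_integralZl_EFin//.
- move=> H; apply/eqP; rewrite sqrtrM ?pi_ge0// sqrtrV ?(ltW c0)// mulrC EFinM H muleA.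
  by rewrite -EFinM mulVf; [rewrite mul1e|rewrite gt_eqF].
- by apply: measurable_EFin; apply: continuous_measurable; exact: continuous_quad_exp.
Unshelve. all: end_near.
Qed.

Lemma L1_gaussian (c b : R) : 0 < c -> L1 (fun x => expR (- (c * (x - b) ^+ 2))).
Proof.
move=> c0; apply/integrableP; split.
  by apply: measurable_EFin; apply: continuous_measurable; exact: continuous_quad_exp.
under eq_integral do rewrite /= ger0_norm ?expR_ge0//.
by rewrite integral_gaussian// ltry.
Qed.

Lemma Rint_gaussian (c b : R) : 0 < c ->
  \int[mu]_x expR (- (c * (x - b) ^+ 2)) = Num.sqrt (pi / c).
Proof. by move=> c0; rewrite /Rintegral integral_gaussian. Qed.

Lemma L1_gaussian0 (c : R) : 0 < c -> L1 (fun x => expR (- (c * x ^+ 2))).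
Proof. by move=> /(L1_gaussian 0); under eq_fun do rewrite subr0. Qed.

Lemma Rint_gaussian0 (c : R) : 0 < c ->
  \int[mu]_x expR (- (c * x ^+ 2)) = Num.sqrt (pi / c).
Proof. by move=> /(Rint_gaussian 0); under eq_Rintegral do rewrite subr0. Qed.

Lemma continuous_gaussian0 (c : R) : continuous (fun x : R => expR (- (c * x ^+ 2))).
Proof. by have := @continuous_quad_exp c 0; under eq_fun do rewrite subr0. Qed.

(** For |x| > 1 the exponent is raised to 2 (n + 1), where a single Taylor term of exp(c x^2)
    dominates the power. *)
Lemma natpow_gaussian_bound (c : R) n : 0 < c ->
  exists2 K : R, 0 < K & forall x : R, `|x| ^+ n <= K * expR (c * x ^+ 2).
Proof.
move=> c0; exists (1 + n.+1`!%:R / c ^+ n.+1).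
  by rewrite ltr_pwDl// divr_ge0 ?exprn_ge0 ?ltW.
move=> x; have e1 : 1 <= expR (c * x ^+ 2).
  by rewrite -expR0 ler_expR mulr_ge0 ?sqr_ge0 ?ltW.
have [x1|x1] := leP `|x| 1.
  apply: (@le_trans _ _ (1 * 1)); first by rewrite mulr1 exprn_ile1.
  by apply: ler_pM => //; rewrite lerDl divr_ge0 ?exprn_ge0 ?ltW.
apply: (@le_trans _ _ (`|x| ^+ (n.+1 * 2))).
  by rewrite ler_weXn2l ?ltW// mulnC mul2n -addnn -[leqLHS]addn0 leq_add.
have cx : 0 <= c * x ^+ 2 by rewrite mulr_ge0 ?sqr_ge0 ?ltW.
have := @expR_ge1Dxn R _ n cx; rewrite -lerBrDl => h.
have {}h : (c * x ^+ 2) ^+ n.+1 / n.+1`!%:R <= expR (c * x ^+ 2) by lra.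
rewrite mulnC exprM real_normK ?num_real//.
move: h; rewrite ler_pdivrMr ?ltr0n ?fact_gt0// exprMn => h.
rewrite mulrDl mul1r; apply: ler_wpDl; first exact: expR_ge0.
by rewrite mulrAC ler_pdivlMr ?exprn_gt0// mulrC [leRHS]mulrC.
Qed.

Lemma poly_gaussian_bound (c : R) (p : {poly R}) : 0 < c ->
  exists2 K : R, 0 < K & forall x : R, `|p.[x]| <= K * expR (c * x ^+ 2).
Proof.
move=> c0; elim/poly_ind: p => [|p a _].
  by exists 1 => // x; rewrite horner0 normr0 mulr_ge0// expR_ge0.
have: exists2 K : R, 0 < K & forall x : R,
    \sum_(i < size (p * 'X + a%:P)) `|(p * 'X + a%:P)`_i| * `|x| ^+ i <=
    K * expR (c * x ^+ 2).
  elim: (size _) => [|n [K K0 HK]].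
    by exists 1 => // x; rewrite big_ord0 mulr_ge0// expR_ge0.
  have [K' K'0 HK'] := natpow_gaussian_bound n c0.
  exists (K + `|(p * 'X + a%:P)`_n| * K').
    by rewrite ltr_pwDl// mulr_ge0// ltW.
  move=> x; rewrite big_ord_recr/= mulrDl lerD//.
  by rewrite -mulrA ler_wpM2l.
move=> [K K0 HK]; exists K => // x; apply: le_trans (HK x).
rewrite horner_coef; apply: le_trans (ler_norm_sum _ _ _) _.
by apply: ler_sum => i _; rewrite normrM normrX.
Qed.

Lemma continuous_horner (p : {poly R}) : continuous (fun x : R => p.[x]).
Proof.
elim/poly_ind: p => [|p a IH].
  by under eq_fun do rewrite horner0; move=> x; exact: cvg_cst.
under eq_fun do rewrite hornerMXaddC.
by move=> x; apply: cvgD; [apply: cvgM; [exact: IH|exact: cvg_id]|exact: cvg_cst].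
Qed.

Lemma is_derive_horner (p : {poly R}) (x : R) :
  is_derive x (1:R) (fun x : R => p.[x]) p^`().[x].
Proof.
elim/poly_ind: p => [|p a IH].
  rewrite deriv0 horner0 (_ : (fun x => _) = cst 0); first exact: is_derive_cst.
  by apply/funext => y; rewrite horner0.
have := is_deriveD (is_deriveM IH (is_derive_id x 1)) (is_derive_cst a x 1).
congr is_derive; first by apply/funext => y; rewrite hornerMXaddC.
by rewrite derivMXaddC hornerD hornerMX /GRing.scale/=; ring.
Qed.

(** The fundamental theorem of calculus on [-(n + 1), n + 1], with boundary terms tending to 0. The
    integrations by parts below apply it to products. *)
Lemma Rint_derive_eq0 (g g' : R -> R) (K c : R) : 0 < c ->
  (forall x, is_derive x (1:R) g (g' x)) -> continuous g' ->
  (forall x, `|g x| <= K * expR (- (c * x ^+ 2))) ->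
  (forall x, `|g' x| <= K * expR (- (c * x ^+ 2))) ->
  \int[mu]_x g' x = 0.
Proof.
move=> c0 dg cg' gK g'K.
have G1 := L1Z K (L1_gaussian0 c0).
pose A n : set R := `[- n.+1%:R, n.+1%:R]%classic.
have [|||||_ cv] := @Rint_dct R (fun n => g' \_ (A n)) g' (fun x => K * expR (- (c * x ^+ 2))).
- move=> n; apply/(measurable_restrictT _ _).1; first exact: measurable_itv.
  by apply: measurable_funTS; exact: continuous_measurable.
- exact: continuous_measurable.
- exact: G1.
- apply: aeW => x n; rewrite patchE; case: ifP => // _; rewrite normr0.
  exact: le_trans (g'K x).
- apply: aeW => x; apply: cvg_near_cst.
  near=> n; rewrite patchE ifT// inE /A/= in_itv/= -ler_norml.
  have : (Num.truncn `|x| <= n)%N by near: n; exact: nbhs_infty_ge.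
  rewrite -ltnS => h; apply: (le_trans (ltW (truncnS_gt _))).
  by rewrite ler_nat.
have cv0 : \int[mu]_x (g' \_ (A n)) x @[n --> \oo] --> (0 : R).
  have E n : \int[mu]_x (g' \_ (A n)) x = g n.+1%:R - g (- n.+1%:R).
    rewrite -Rintegral_mkcond /Rintegral (@continuous_FTC2 _ g' g)//.
    - by rewrite gtrN.
    - exact: continuous_subspaceT.
    - have cg : continuous g.
        by move=> x; apply: differentiable_continuous; apply/derivable1_diffP.
      by split => [x _||]; [exact: (@ex_derive _ _ _ _ _ _ _ (dg x))|
        apply: cvg_at_right_filter; exact: cg|apply: cvg_at_left_filter; exact: cg].
    - by move=> x _; rewrite derive1E (@derive_val _ _ _ _ _ _ _ (dg x)).
  under eq_fun do rewrite E.
  apply: (@squeeze_cvgr _ _ _ _ (fun n : nat => - (2 * K * (c^-1 * n.+1%:R^-1)))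
     (fun n : nat => 2 * K * (c^-1 * n.+1%:R^-1))).
  - near=> n; rewrite -ler_norml.
    have K0 : 0 <= K.
      have := le_trans (normr_ge0 _) (gK 0).
      by rewrite pmulr_lge0 ?expR_gt0.
    (* From 1 + y <= e^y, exp(-c m^2) <= 1 / (c m^2) <= 1 / (c m) at m = n + 1; this slow rate is
       enough. *)
    have B (x : R) : `|x| = n.+1%:R -> `|g x| <= K * (c^-1 * n.+1%:R^-1).
      move=> xn; apply: le_trans (gK x) _; rewrite ler_wpM2l//.
      rewrite expRN -invfM lef_pV2 ?posrE ?expR_gt0 ?mulr_gt0//.
      apply: le_trans (expR_ge1Dx _); rewrite ler_wpDl//.
      rewrite ler_pM2l// -real_normK ?num_real// xn expr2 ler_peMr//.
      by rewrite ler1n.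
    rewrite mulr2n !mulrDl mul1r; apply: le_trans (ler_normB _ _) _.
    by apply: lerD; apply: B; rewrite ?normrN ger0_norm.
  - rewrite -[X in _ --> X]oppr0; apply: cvgN.
    rewrite -(mulr0 (2 * K)); apply: cvgM; first exact: cvg_cst.
    by rewrite -(mulr0 c^-1); apply: cvgM; [exact: cvg_cst|exact: cvg_harmonic].
  - rewrite -(mulr0 (2 * K)); apply: cvgM; first exact: cvg_cst.
    by rewrite -(mulr0 c^-1); apply: cvgM; [exact: cvg_cst|exact: cvg_harmonic].
exact: (cvg_unique _ cv cv0).
Unshelve. all: end_near.
Qed.

End gaussian.

(** * Hermite functions and their generating function *)

Section hermite.
Context {R : realType}.
Local Notation mu := (@lebesgue_measure R).

(** The physicists' Hermite polynomials, produced by the recurrence that differentiation of p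
    exp(-x^2) induces on p, up to sign. *)
Fixpoint hermite_poly n : {poly R} :=
  if n is m.+1 then 'X *+ 2 * hermite_poly m - (hermite_poly m)^`() else 1.

Lemma hermite_polyS n :
  hermite_poly n.+1 = 'X *+ 2 * hermite_poly n - (hermite_poly n)^`().
Proof. by []. Qed.

Lemma deriv_hermite_poly n :
  (hermite_poly n.+1)^`() = hermite_poly n *+ n.+1.*2.
Proof.
elim: n => [|n IH].
  by rewrite /= mulr1 derivC subr0 derivMn derivX.
rewrite (hermite_polyS n.+1) derivB derivM derivMn derivX IH derivMn.
rewrite [n.+2.*2]doubleS -[n.+1.*2.+2]addn2 mulrnDr (hermite_polyS n).
ring.
Qed.

Lemma hermite_polySE n (x : R) : (hermite_poly n.+2).[x] =
  2 * x * (hermite_poly n.+1).[x] - 2 * n.+1%:R * (hermite_poly n).[x].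
Proof.
rewrite (hermite_polyS n.+1) hornerD hornerN deriv_hermite_poly.
rewrite hornerM !hornerMn hornerX -mul2n -[_ *+ (2 * _)]mulr_natl natrM; ring.
Qed.

Lemma hermite_poly0E (x : R) : (hermite_poly 0).[x] = 1.
Proof. by rewrite hornerC. Qed.

Lemma hermite_poly1E (x : R) : (hermite_poly 1).[x] = 2 * x.
Proof. by rewrite /= mulr1 derivC subr0 hornerMn hornerX mulr_natl. Qed.

Lemma is_derive_gauss (c x : R) :
  is_derive x (1:R) (fun x => expR (- (c * x ^+ 2))) (- (2 * c * x) * expR (- (c * x ^+ 2))).
Proof.
have h : is_derive x (1:R) (fun x => - (c * x ^+ 2)) (- (2 * c * x)).
  have := is_deriveN (is_deriveM (is_derive_cst c x 1) (is_deriveX 2 (is_derive_id x 1))).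
  by congr is_derive; rewrite /GRing.scale/= /cst; ring.
have := @is_derive1_comp R expR (fun x => - (c * x ^+ 2)) x _ _ (is_derive_expR _) h.
by congr is_derive; rewrite mulrC.
Qed.

Lemma is_derive_poly_gauss (c x : R) (p : {poly R}) :
  is_derive x (1:R) (fun x => p.[x] * expR (- (c * x ^+ 2)))
    ((p^`() - (2 * c) *: 'X * p).[x] * expR (- (c * x ^+ 2))).
Proof.
have := is_deriveM (is_derive_horner p x) (is_derive_gauss c x).
congr is_derive.
by rewrite hornerD hornerN hornerM hornerZ hornerX /GRing.scale/=; ring.
Qed.

(** Rodrigues' formula, the link between the iterated derivative in [hermite_fun] and the polynomial
    recurrence. *)
Lemma derive1n_gauss n (x : R) : derive1n n (fun y : R => expR (- y ^+ 2)) x =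
  (-1) ^+ n * (hermite_poly n).[x] * expR (- x ^+ 2).
Proof.
elim: n x => [|n IH] x; first by rewrite /= hornerC !mul1r.
rewrite derive1nS [derive1n _ _](_ : _ = fun x => ((-1) ^+ n *: hermite_poly n).[x] *
    expR (- (1 * x ^+ 2))); last first.
  by apply/funext => y; rewrite IH hornerZ mul1r.
rewrite derive1E (@derive_val _ _ _ _ _ _ _ (is_derive_poly_gauss _ _ _)) mul1r.
congr (_ * _); rewrite exprS /= derivZ !(hornerD, hornerN, hornerM, hornerZ, hornerMn, hornerX).
ring.
Qed.

Definition hermite_norm n : R := pi `^ (- 4^-1) * (2 ^+ n * n`!%:R) `^ (- 2^-1).

Lemma hermite_funE n (x : R) : hermite_fun n x =
  hermite_norm n * (hermite_poly n).[x] * expR (- (2^-1 * x ^+ 2)).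
Proof.
rewrite /hermite_fun derive1n_gauss /hermite_norm.
have -> : expR (2^-1 * x ^+ 2) = expR (- (2^-1 * x ^+ 2)) * expR (x ^+ 2) :> R.
  by rewrite -expRD; congr expR; field.
have E : expR (x ^+ 2) * expR (- x ^+ 2) = 1 :> R by rewrite -expRD subrr expR0.
have s1 : (-1) ^+ n * (-1) ^+ n = 1 :> R by rewrite -expr2 sqrr_sign.
transitivity (((-1) ^+ n * (-1) ^+ n) * (expR (x ^+ 2) * expR (- x ^+ 2)) *
  (pi `^ (- 4^-1) * (2 ^+ n * n`!%:R) `^ (- 2^-1) * (hermite_poly n).[x] *
   expR (- (2^-1 * x ^+ 2)))); first by ring.
by rewrite E s1 !mul1r.
Qed.

Lemma pow2fact_gt0 n : 0 < 2 ^+ n * n`!%:R :> R.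
Proof. by rewrite mulr_gt0 ?exprn_gt0 ?ltr0n ?fact_gt0. Qed.

Lemma hermite_normE n : hermite_norm n = pi `^ (- 4^-1) / Num.sqrt (2 ^+ n * n`!%:R).
Proof. by rewrite /hermite_norm [X in _ * X]powRN powR12_sqrt// ltW// pow2fact_gt0. Qed.

Lemma pi_pow_gt0 : 0 < pi `^ (- 4^-1) :> R.
Proof. by rewrite powR_gt0// pi_gt0. Qed.

Lemma pi_pow_le1 : pi `^ (- 4^-1) <= 1 :> R.
Proof.
rewrite powRN invf_le1 ?powR_gt0 ?pi_gt0//.
rewrite [leLHS](_ : 1 = 1 `^ (4^-1)); last by rewrite powR1.
apply: ge0_ler_powR => //; rewrite ?nnegrE ?pi_ge0//.
by rewrite (le_trans _ (pi_ge2 R))// ler1n.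
Qed.

Lemma pi_pow_sqr : (pi `^ (- 4^-1)) ^+ 2 = (Num.sqrt pi)^-1 :> R.
Proof.
rewrite -powR_mulrn ?powR_ge0// -powRrM -powR12_sqrt ?pi_ge0// -powRN.
by congr (_ `^ _); field.
Qed.

Lemma hermite_norm_ge0 n : 0 <= hermite_norm n.
Proof. by rewrite hermite_normE divr_ge0 ?sqrtr_ge0 ?ltW ?pi_pow_gt0. Qed.

Lemma hermite_norm_sqr n :
  hermite_norm n ^+ 2 = (2 ^+ n * n`!%:R * Num.sqrt pi)^-1.
Proof.
rewrite hermite_normE exprMn pi_pow_sqr exprVn sqr_sqrtr ?ltW ?pow2fact_gt0//.
by rewrite [RHS]invfM mulrC.
Qed.

(** In the three-term recurrence the coefficients are at most 2 Y and 2 Y^2 in modulus; growth by a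
    factor 3 Y per step is consistent with it because 2 * 3 + 2 <= 3^2. *)
Lemma hermite_poly_le n (x Y : R) : `|x| <= Y -> n%:R <= Y ^+ 2 ->
  `|(hermite_poly n).[x]| <= (3 * Y) ^+ n.
Proof.
move=> xY; have Y0 : 0 <= Y by exact: le_trans xY.
suff H m : m%:R <= Y ^+ 2 -> `|(hermite_poly m).[x]| <= (3 * Y) ^+ m /\
    (m.+1%:R <= Y ^+ 2 -> `|(hermite_poly m.+1).[x]| <= (3 * Y) ^+ m.+1).
  by move=> /H[].
elim: m => [|m IH] hm.
  split; first by rewrite hermite_poly0E normr1.
  move=> _; rewrite hermite_poly1E normrM ger0_norm// expr1.
  by apply: ler_pM => //; rewrite ler_nat.
have hm' : m%:R <= Y ^+ 2 by rewrite (le_trans _ hm)// ler_nat.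
have [h1 h2] := IH hm'; split; first exact: h2.
move=> hm2; rewrite hermite_polySE; apply: le_trans (ler_normB _ _) _.
rewrite !normrM !normr_nat !exprS.
have P0 : 0 <= (3 * Y) ^+ m by rewrite exprn_ge0// mulr_ge0.
have {}h2 := h2 hm; rewrite exprS in h2.
have e1 : 2 * `|x| * `|(hermite_poly m.+1).[x]| <= 2 * Y * (3 * Y * (3 * Y) ^+ m).
  by apply: ler_pM => //; rewrite ?mulr_ge0// ler_wpM2l.
have e2 : 2 * m.+1%:R * `|(hermite_poly m).[x]| <= 2 * Y ^+ 2 * (3 * Y) ^+ m.
  by apply: ler_pM => //; rewrite ler_wpM2l.
apply: le_trans (lerD e1 e2) _.
have : 0 <= Y ^+ 2 * (3 * Y) ^+ m by rewrite mulr_ge0 ?sqr_ge0.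
by rewrite expr2; lra.
Qed.

Lemma expR_ge_pow (x : R) n : 0 <= x -> x ^+ n / n`!%:R <= expR x.
Proof.
case: n => [|n] x0; first by rewrite expr0 fact0 divr1 -expR0 ler_expR.
by apply: le_trans (expR_ge1Dxn n x0); rewrite lerDr.
Qed.

Lemma sqrt_fact_gt0 n : 0 < Num.sqrt n`!%:R :> R.
Proof. by rewrite sqrtr_gt0 ltr0n fact_gt0. Qed.

(** After squaring, C^(2 n) / n! is one term of the series of exp(C^2). *)
Lemma pow_le_sqrt_fact (C : R) n : 0 <= C ->
  C ^+ n <= expR (C ^+ 2 / 2) * Num.sqrt n`!%:R.
Proof.
move=> C0; rewrite -(@ler_pXn2r _ 2)// ?nnegrE ?exprn_ge0 ?mulr_ge0 ?expR_ge0 ?sqrtr_ge0//.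
rewrite [leRHS]exprMn sqr_sqrtr// [expR _ ^+ 2]expr2 -expRD -splitr.
rewrite -ler_pdivrMr ?ltr0n ?fact_gt0// exprAC.
by apply: expR_ge_pow; exact: sqr_ge0.
Qed.

(** A weak form of Stirling's formula: the preceding bound at C = sqrt n. *)
Lemma sqrtn_pow_le n : (Num.sqrt n%:R) ^+ n <= expR (2^-1) ^+ n * Num.sqrt n`!%:R :> R.
Proof.
apply: le_trans (pow_le_sqrt_fact _ (sqrtr_ge0 _)) _.
rewrite sqr_sqrtr// ler_wpM2r ?sqrtr_ge0//.
by rewrite -expRM_natl.
Qed.

Lemma exprD_le (a b : R) n : 0 <= a -> 0 <= b ->
  (a + b) ^+ n <= (2 * a) ^+ n + (2 * b) ^+ n.
Proof.
move=> a0 b0; wlog ab : a b a0 b0 / a <= b.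
  move=> W; have [ab|ab] := leP a b; first exact: W.
  by rewrite addrC [leRHS]addrC W// ltW.
apply: (@le_trans _ _ ((2 * b) ^+ n)); last by rewrite lerDr exprn_ge0// mulr_ge0.
by apply: lerXn2r; rewrite ?nnegrE ?addr_ge0 ?mulr_ge0//; lra.
Qed.

(** [hermite_poly_le] is used with Y = |x| + sqrt n and the power of the sum is split: the part in
    |x| is paid by exp(x^2 / 4), the part in sqrt n by n!. In the constant, 12 is 3 from the
    polynomial bound, 2 from the splitting and 2 for the factor 2^n. *)
Lemma hermite_term_bound (r : R) : 0 <= r -> exists2 D : R, 0 < D &
  forall n x, `|(hermite_poly n).[x]| * r ^+ n / n`!%:R <= D / 2 ^+ n * expR (4^-1 * x ^+ 2).
Proof.
move=> r0; pose C := 12 * r * expR (2^-1).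
have C0 : 0 <= C by rewrite !mulr_ge0 ?expR_ge0.
exists (expR (144 * r ^+ 2) + expR (C ^+ 2 / 2)); first by rewrite addr_gt0 ?expR_gt0.
move=> n x.
have f0 : 0 < n`!%:R :> R by rewrite ltr0n fact_gt0.
have s0 := sqrt_fact_gt0 n.
have h1 : `|(hermite_poly n).[x]| <= (3 * (`|x| + Num.sqrt n%:R)) ^+ n.
  apply: hermite_poly_le; first by rewrite lerDl sqrtr_ge0.
  rewrite sqrrD sqr_sqrtr// lerDr addr_ge0 ?sqr_ge0//.
have P1 : (12 * r * `|x|) ^+ n / n`!%:R <= expR (144 * r ^+ 2) * expR (4^-1 * x ^+ 2).
  apply: le_trans (expR_ge_pow _ _) _; first by rewrite !mulr_ge0.
  rewrite -expRD ler_expR -[x ^+ 2]real_normK ?num_real//.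
  have := sqr_ge0 (12 * r - 2^-1 * `|x|); rewrite sqrrB !exprMn; lra.
have P2 : (12 * r * Num.sqrt n%:R) ^+ n / n`!%:R <= expR (C ^+ 2 / 2).
  rewrite ler_pdivrMr// exprMn.
  apply: (@le_trans _ _ ((12 * r) ^+ n * (expR (2^-1) ^+ n * Num.sqrt n`!%:R))).
    by rewrite ler_wpM2l ?sqrtn_pow_le// exprn_ge0// mulr_ge0.
  rewrite mulrA -exprMn -/C.
  rewrite -[X in _ <= _ * X]sqr_sqrtr ?(ltW f0)// [X in _ <= _ * X]expr2 mulrA.
  by rewrite ler_pM2r// pow_le_sqrt_fact.
rewrite [leRHS]mulrAC ler_pdivlMr ?exprn_gt0// [leLHS]mulrAC -[X in X / _]mulrA -exprMn.
have e1 : 1 <= expR (4^-1 * x ^+ 2) :> R by rewrite -expR0 ler_expR mulr_ge0 ?sqr_ge0.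
apply: (@le_trans _ _ ((12 * r * `|x|) ^+ n / n`!%:R + (12 * r * Num.sqrt n%:R) ^+ n / n`!%:R)).
  rewrite -mulrDl ler_pM2r ?invr_gt0//.
  apply: (@le_trans _ _ ((6 * r * `|x| + 6 * r * Num.sqrt n%:R) ^+ n)).
    have -> : 6 * r * `|x| + 6 * r * Num.sqrt n%:R =
      3 * (`|x| + Num.sqrt n%:R) * (r * 2) by ring.
    by rewrite [leRHS]exprMn ler_wpM2r// exprn_ge0// mulr_ge0.
  apply: le_trans (exprD_le _ _ _) _; rewrite ?mulr_ge0 ?sqrtr_ge0//.
  have -> : 2 * (6 * r * `|x|) = 12 * r * `|x| by ring.
  by have -> : 2 * (6 * r * Num.sqrt n%:R) = 12 * r * Num.sqrt n%:R by ring.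
rewrite [leRHS]mulrDl lerD//.
by apply: le_trans P2 _; rewrite ler_peMr ?expR_ge0.
Qed.

Lemma hermite_fun_le n (x : R) : `|hermite_fun n x| <=
  `|(hermite_poly n).[x]| / Num.sqrt (2 ^+ n * n`!%:R) * expR (- (2^-1 * x ^+ 2)).
Proof.
rewrite hermite_funE normrM (ger0_norm (expR_ge0 _)) normrM (ger0_norm (hermite_norm_ge0 n)).
rewrite ler_wpM2r ?expR_ge0// mulrC ler_wpM2l// hermite_normE.
by rewrite ler_piMl ?invr_ge0 ?sqrtr_ge0// pi_pow_le1.
Qed.

(** The factor exp(-x^2 / 2) outweighs the growth exp(x^2 / 4) of the polynomial bound. The result
    is a summable majorant, at every radius r, of the series of the Bargmann kernel. *)
Lemma hermite_fun_bound (r : R) : 0 <= r -> exists2 D : R, 0 < D &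
  forall n x, `|hermite_fun n x| * r ^+ n / Num.sqrt n`!%:R <=
    D / 2 ^+ n * expR (- (4^-1 * x ^+ 2)).
Proof.
move=> r0; have [D D0 HD] := hermite_term_bound r0; exists D => // n x.
have s0 := sqrt_fact_gt0 n.
have f0 : 0 < n`!%:R :> R by rewrite ltr0n fact_gt0.
have := HD n x; rewrite -(ler_pM2r (expR_gt0 (- (2^-1 * x ^+ 2)))).
rewrite -[leRHS]mulrA -expRD.
have -> : 4^-1 * x ^+ 2 - 2^-1 * x ^+ 2 = - (4^-1 * x ^+ 2) by field.
apply: le_trans; rewrite -!mulrA.
apply: (@le_trans _ _ (`|(hermite_poly n).[x]| / Num.sqrt (2 ^+ n * n`!%:R) *
   expR (- (2^-1 * x ^+ 2)) * (r ^+ n / Num.sqrt n`!%:R))).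
  by rewrite ler_wpM2r ?hermite_fun_le// divr_ge0 ?exprn_ge0// ltW.
rewrite sqrtrM ?exprn_ge0// -!mulrA ler_wpM2l// invfM.
rewrite [X in X <= _](_ : _ = (Num.sqrt (2 ^+ n))^-1 * (r ^+ n *
  ((Num.sqrt n`!%:R * Num.sqrt n`!%:R)^-1 * expR (- (2^-1 * x ^+ 2))))); last first.
  by rewrite invfM; ring.
rewrite -expr2 sqr_sqrtr ?(ltW f0)// ler_piMl//.
  by rewrite !mulr_ge0 ?expR_ge0 ?exprn_ge0// invr_ge0 ltW.
rewrite invf_le1 ?sqrtr_gt0 ?exprn_gt0// -[leLHS]sqrtr1 ler_wsqrtr//.
by rewrite exprn_ege1// ler1n.
Qed.

Lemma hermite_fun_gauss n : exists2 D : R, 0 < D &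
  forall x, `|hermite_fun n x| <= D * expR (- (4^-1 * x ^+ 2)).
Proof.
have [D D0 HD] := @hermite_fun_bound 1 ler01.
exists (D * Num.sqrt n`!%:R); first by rewrite mulr_gt0// sqrt_fact_gt0.
move=> x; have := HD n x; rewrite expr1n mulr1 ler_pdivrMr ?sqrt_fact_gt0//.
move/le_trans; apply; rewrite mulrAC ler_wpM2r ?expR_ge0// ler_wpM2r ?sqrtr_ge0//.
by rewrite ler_pdivrMr ?exprn_gt0// ler_peMr ?(ltW D0)// exprn_ege1// ler1n.
Qed.

Lemma continuous_hermite_fun n : continuous (@hermite_fun R n).
Proof.
rewrite (_ : @hermite_fun R n = fun x =>
  hermite_norm n * (hermite_poly n).[x] * expR (- (2^-1 * x ^+ 2))).
  move=> x; apply: cvgM; last exact: continuous_gaussian0.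
  by apply: cvgM; [exact: cvg_cst|exact: continuous_horner].
by apply/funext => x; rewrite hermite_funE.
Qed.

Lemma measurable_hermite_fun n : measurable_fun setT (@hermite_fun R n).
Proof. by apply: continuous_measurable; exact: continuous_hermite_fun. Qed.

Lemma L1_poly_gauss (c : R) (p : {poly R}) : 0 < c ->
  L1 (fun x => p.[x] * expR (- (c * x ^+ 2))).
Proof.
move=> c0; have c2 : 0 < c / 2 by rewrite divr_gt0.
have [K K0 HK] := poly_gaussian_bound p c2.
apply: (L1_le _ _ (L1Z K (L1_gaussian0 c2))).
  apply: continuous_measurable => x.
  by apply: cvgM; [exact: continuous_horner|exact: continuous_gaussian0].
move=> x; rewrite normrM [X in _ * X]ger0_norm ?expR_ge0//.
apply: le_trans (ler_wpM2r (expR_ge0 _) (HK x)) _; rewrite -[leLHS]mulrA -expRD.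
rewrite ler_wpM2l ?(ltW K0)// ler_expR; lra.
Qed.

Lemma Rint_poly_gauss_deriv (c : R) (p : {poly R}) : 0 < c ->
  \int[mu]_x ((p^`() - (2 * c) *: 'X * p).[x] * expR (- (c * x ^+ 2))) = 0.
Proof.
move=> c0; have c2 : 0 < c / 2 by rewrite divr_gt0.
have [K K0 HK] := poly_gaussian_bound p c2.
have [K' K'0 HK'] := poly_gaussian_bound (p^`() - (2 * c) *: 'X * p) c2.
have B (q : {poly R}) k x : 0 < k -> `|q.[x]| <= k * expR (c / 2 * x ^+ 2) ->
   `|q.[x] * expR (- (c * x ^+ 2))| <= k * expR (- (c / 2 * x ^+ 2)).
  move=> k0 h; rewrite normrM [X in _ * X]ger0_norm ?expR_ge0//.
  apply: le_trans (ler_wpM2r (expR_ge0 _) h) _; rewrite -[leLHS]mulrA -expRD.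
  rewrite ler_wpM2l ?(ltW k0)// ler_expR; lra.
apply: (@Rint_derive_eq0 R (fun x => p.[x] * expR (- (c * x ^+ 2))) _ (K + K') (c / 2)) => //.
- by move=> x; exact: is_derive_poly_gauss.
- by move=> x; apply: cvgM; [exact: continuous_horner|exact: continuous_gaussian0].
- move=> x; apply: le_trans (B _ _ _ K0 (HK x)) _.
  by rewrite ler_wpM2r ?expR_ge0// lerDl ltW.
- move=> x; apply: le_trans (B _ _ _ K'0 (HK' x)) _.
  by rewrite ler_wpM2r ?expR_ge0// lerDr ltW.
Qed.

(** Against exp(-x^2) the raising operator is the adjoint of d/dx, and d/dx lowers H_(n+1) to 2 (n +
    1) H_n; each exchange lowers both indices by one. *)
Lemma hermite_poly_orthogonal m n :
  \int[mu]_x ((hermite_poly m * hermite_poly n).[x] * expR (- (1 * x ^+ 2))) =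
  (m == n)%:R * (2 ^+ n * n`!%:R * Num.sqrt pi).
Proof.
pose G p := \int[mu]_x ((p : {poly R}).[x] * expR (- (1 * x ^+ 2))).
have i1 p : L1 (fun x => (p : {poly R}).[x] * expR (- (1 * x ^+ 2))) by exact: L1_poly_gauss.
have GB p q : G (p - q) = G p - G q.
  rewrite /G -RintegralB//; [|exact: i1|exact: i1].
  by apply: eq_Rintegral => x _; rewrite hornerD hornerN mulrBl.
have GZ k p : G (k *: p) = k * G p.
  rewrite /G -RintegralZl//; last exact: i1.
  by apply: eq_Rintegral => x _; rewrite hornerZ -[LHS]mulrA.
have GMn p k : G (p *+ k) = k%:R * G p by rewrite -GZ scaler_nat.
have Gd p : G (p^`() - 2 *: 'X * p) = 0.
  by have := @Rint_poly_gauss_deriv 1 p ltr01; rewrite mulr1.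
have step p k : G (p * hermite_poly k.+1) = G (p^`() * hermite_poly k).
  have := Gd (p * hermite_poly k); rewrite derivM => E.
  apply/eqP; rewrite -subr_eq0 -GB -oppr0 -E -[X in X - _]opprK -opprD; apply/eqP.
  rewrite -[RHS]mulN1r -GZ; congr G.
  rewrite hermite_polyS scaleN1r (_ : 2 *: 'X = 'X *+ 2); last by rewrite scaler_nat.
  by ring.
rewrite -/(G _); elim: n m => [|n IH] [|m].
- rewrite mulr1 eqxx mul1r expr0 fact0 !mul1r /G.
  under eq_Rintegral do rewrite hornerC mul1r.
  by rewrite Rint_gaussian0// divr1.
- by rewrite mulrC step derivC mul0r -(scale0r 0) GZ !mul0r.
- by rewrite step derivC mul0r -(scale0r 0) GZ !mul0r.
- rewrite step deriv_hermite_poly [X in G X]mulrnAl GMn IH eqSS.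
  rewrite exprS factS natrM -mul2n natrM; case: eqP => [->|_]; last by rewrite !mul0r mulr0.
  ring.
Qed.

Lemma hermite_orthonormal m n :
  \int[mu]_x (hermite_fun m x * hermite_fun n x) = (m == n)%:R.
Proof.
transitivity (\int[mu]_x (hermite_norm m * hermite_norm n *
    ((hermite_poly m * hermite_poly n).[x] * expR (- (1 * x ^+ 2))))).
  apply: eq_Rintegral => x _; rewrite !hermite_funE hornerM.
  have -> : expR (- (1 * x ^+ 2)) = expR (- (2^-1 * x ^+ 2)) * expR (- (2^-1 * x ^+ 2)) :> R.
    by rewrite -expRD; congr expR; field.
  by ring.
rewrite RintegralZl//; last exact: L1_poly_gauss.
rewrite hermite_poly_orthogonal; case: eqP => [->|_]; last by rewrite mul0r mulr0.
rewrite mul1r -expr2 hermite_norm_sqr mulVf//.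
by rewrite gt_eqF// mulr_gt0 ?pow2fact_gt0// sqrtr_gt0 pi_gt0.
Qed.

End hermite.

(** * Complex limits and power series *)

Section complex_limits.
Context {R : realType}.
Local Notation C := R[i].
Local Notation Re := (@complex.Re R).
Local Notation Im := (@complex.Im R).
Local Notation toC := (real_complex R).

Lemma Re_le_normc (z : C) : `|Re z| <= normc z.
Proof. by case: z => a b /=; rewrite -sqrtr_sqr ler_wsqrtr// lerDl sqr_ge0. Qed.

Lemma Im_le_normc (z : C) : `|Im z| <= normc z.
Proof. by case: z => a b /=; rewrite -sqrtr_sqr ler_wsqrtr// lerDr sqr_ge0. Qed.

Lemma normc_le_ReIm (z : C) : normc z <= `|Re z| + `|Im z|.
Proof.
rewrite -(@ler_pXn2r _ 2)// ?nnegrE ?normc_ge0 ?addr_ge0// normc_sqr.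
by rewrite sqrrD !real_normK ?num_real// addrAC lerDl mulrn_wge0// mulr_ge0.
Qed.

Lemma normc_toC (a : R) : normc (toC a) = `|a|.
Proof. by rewrite /= expr0n/= addr0 sqrtr_sqr. Qed.

Lemma normcX (z : C) n : normc (z ^+ n) = normc z ^+ n.
Proof. by elim: n => [|n IH]; rewrite ?expr0 ?normc1// !exprS normcM IH. Qed.

Lemma normcB (z w : C) : normc (z - w) = normc (w - z).
Proof. by rewrite -opprB normcN. Qed.

Lemma normc_sum (I : Type) (s : seq I) (f : I -> C) :
  normc (\sum_(i <- s) f i) <= \sum_(i <- s) normc (f i).
Proof.
elim: s => [|i s IH]; first by rewrite !big_nil normc0.
by rewrite !big_cons (le_trans (le_normcD _ _))// lerD2l.
Qed.

Definition ccvg (u : nat -> C) (l : C) :=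
  Re (u n) @[n --> \oo] --> Re l /\ Im (u n) @[n --> \oo] --> Im l.

Lemma ccvg_normc (u : nat -> C) l (e : nat -> R) : e n @[n --> \oo] --> (0 : R) ->
  (forall n, normc (u n - l) <= e n) -> ccvg u l.
Proof.
move=> e0 ue; split; apply/cvgrPdist_le => d d0;
  near=> n; rewrite distrC.
  rewrite (_ : _ - _ = Re (u n - l)); last by rewrite ReDc raddfN.
  apply: le_trans (Re_le_normc _) _; apply: le_trans (ue n) _.
  by near: n; move/cvgrPdist_le : e0 => /(_ _ d0); apply: filterS => n;
    rewrite sub0r normrN => h; apply: le_trans (ler_norm _) h.
rewrite (_ : _ - _ = Im (u n - l)); last by rewrite ImDc raddfN.
apply: le_trans (Im_le_normc _) _; apply: le_trans (ue n) _.
by near: n; move/cvgrPdist_le : e0 => /(_ _ d0); apply: filterS => n;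
    rewrite sub0r normrN => h; apply: le_trans (ler_norm _) h.
Unshelve. all: end_near.
Qed.

Lemma ccvg_ex (u : nat -> C) l (e : R) : ccvg u l -> 0 < e ->
  exists N, forall n, (N <= n)%N -> normc (u n - l) <= e.
Proof.
move=> [u1 u2] e0; have e2 : 0 < e / 2 by rewrite divr_gt0.
move/cvgrPdist_le : u1 => /(_ _ e2)[N1 _ h1].
move/cvgrPdist_le : u2 => /(_ _ e2)[N2 _ h2].
exists (maxn N1 N2) => n; rewrite geq_max => /andP[n1 n2].
apply: le_trans (normc_le_ReIm _) _; rewrite [leRHS]splitr ReDc ImDc !raddfN/=.
by rewrite lerD// distrC; [exact: h1|exact: h2].
Qed.

Lemma ccvgZ k u l : ccvg u l -> ccvg (fun n => k * u n) (k * l).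
Proof.
move=> [u1 u2]; split.
  rewrite ReMc; under eq_fun do rewrite ReMc.
  by apply: cvgB; apply: cvgM => //; exact: cvg_cst.
rewrite ImMc; under eq_fun do rewrite ImMc.
by apply: cvgD; apply: cvgM => //; exact: cvg_cst.
Qed.

Lemma geometric_half (D : R) N m : 0 <= D ->
  \sum_(N <= i < N + m) D / 2 ^+ i <= 2 * D / 2 ^+ N.
Proof.
move=> D0; have -> : \sum_(N <= i < N + m) D / 2 ^+ i = 2 * D / 2 ^+ N - 2 * D / 2 ^+ (N + m).
  elim: m => [|m IH]; first by rewrite addn0 big_geq// subrr.
  rewrite addnS big_nat_recr/= ?leq_addr// IH exprS invfM.
  have h2 : 2 * 2^-1 = 1 :> R by rewrite divff.
  have -> : 2 * D * (2^-1 / 2 ^+ (N + m)) = 2 * 2^-1 * (D / 2 ^+ (N + m)) by ring.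
  by rewrite h2; ring.
by rewrite gerBl divr_ge0 ?exprn_ge0 ?mulr_ge0.
Qed.

Lemma cvg_half (D : R) : D / 2 ^+ n @[n --> \oo] --> (0 : R).
Proof.
rewrite -(mulr0 D); apply: cvgM; first exact: cvg_cst.
under eq_fun do rewrite -exprVn.
by apply: cvg_expr; rewrite ger0_norm ?invr_ge0// invf_lt1// ltr1n.
Qed.

(** The geometric tail beyond N is at most 2 D / 2^N on the whole disc. The number M of further
    terms may depend on z because this bound does not depend on M. *)
Lemma unif_sumI (c : nat -> C) (F : C -> C) :
  (forall rho, 0 <= rho -> exists2 D, 0 <= D & forall n, normc (c n) * rho ^+ n <= D / 2 ^+ n) ->
  (forall z, ccvg (fun N => \sum_(i < N) c i * z ^+ i) (F z)) -> unif_sum c F.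
Proof.
move=> hD hF rho e e0.
have [D D0 HD] := hD _ (normr_ge0 rho).
have [N0 _ hN0] : \forall n \near \oo, 2 * D / 2 ^+ n <= e.
  have /cvgrPdist_le/(_ _ e0) := cvg_half (2 * D).
  by apply: filterS => n; rewrite sub0r normrN => h; apply: le_trans (ler_norm _) h.
exists N0 => N N0N z zr; apply/ler_addgt0Pr => d d0.
have [M hM] := ccvg_ex (hF z) d0.
have := hM _ (leq_addl N M); set SM := \sum_(i < _) _ => hSM.
have -> : F z - \sum_(i < N) c i * z ^+ i = - (SM - F z) + (SM - \sum_(i < N) c i * z ^+ i).
  by ring.
apply: le_trans (le_normcD _ _) _; rewrite normcN addrC; apply: lerD => //.
have -> : SM - \sum_(i < N) c i * z ^+ i = \sum_(N <= i < N + M) c i * z ^+ i.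
  rewrite /SM -[X in X - _](big_mkord xpredT (fun i => c i * z ^+ i)) -(big_mkord xpredT (fun i => c i * z ^+ i)).
  by rewrite (big_cat_nat (n := N))/= ?leq_addr// addrAC subrr add0r.
apply: le_trans (normc_sum _ _) _; apply: le_trans (hN0 _ N0N).
apply: le_trans (geometric_half N M D0).
apply: ler_sum => i _; rewrite normcM normcX; apply: le_trans (HD i).
rewrite ler_wpM2l ?normc_ge0// lerXn2r ?nnegrE ?normc_ge0//.
by rewrite (le_trans zr)// ler_norm.
Qed.

Lemma unif_sumD (c d : nat -> C) (F G : C -> C) : unif_sum c F -> unif_sum d G ->
  unif_sum (fun n => c n + d n) (fun z => F z + G z).
Proof.
move=> cF dG rho e e0; have e2 : 0 < e / 2 by rewrite divr_gt0.
have [N1 h1] := cF rho _ e2; have [N2 h2] := dG rho _ e2.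
exists (maxn N1 N2) => N; rewrite geq_max => /andP[n1 n2] z zr.
have -> : F z + G z - \sum_(i < N) (c i + d i) * z ^+ i =
  (F z - \sum_(i < N) c i * z ^+ i) + (G z - \sum_(i < N) d i * z ^+ i).
  under eq_bigr do rewrite mulrDl.
  by rewrite big_split/=; ring.
apply: le_trans (le_normcD _ _) _; rewrite [leRHS]splitr lerD//; [exact: h1|exact: h2].
Qed.

Lemma unif_sumZ (k : C) (c : nat -> C) (F : C -> C) : unif_sum c F -> unif_sum (fun n => k * c n) (fun z => k * F z).
Proof.
move=> cF rho e e0; have k0 : 0 < normc k + 1 by rewrite ltr_wpDl ?normc_ge0.
have [N1 h1] := cF rho _ (divr_gt0 e0 k0).
exists N1 => N n1 z zr.
have -> : k * F z - \sum_(i < N) k * c i * z ^+ i = k * (F z - \sum_(i < N) c i * z ^+ i).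
  by rewrite mulrBr mulr_sumr; congr (_ - _); apply: eq_bigr => i _; rewrite mulrA.
rewrite normcM; apply: (@le_trans _ _ ((normc k + 1) * (e / (normc k + 1)))).
  by apply: ler_pM; rewrite ?normc_ge0 ?lerDl ?h1.
by rewrite mulrC divfK ?gt_eqF.
Qed.

Lemma is_cderiveX f (x : R) df n : is_cderive f x df ->
  is_cderive (fun t => f t ^+ n) x (n%:R * f x ^+ n.-1 * df).
Proof.
move=> hf; elim: n => [|n IH]; first by rewrite !mul0r; exact: is_cderive_cst.
have := is_cderiveM hf IH.
rewrite (_ : _ + _ = n.+1%:R * f x ^+ n.+1.-1 * df).
  by under [X in is_cderive X]eq_fun do rewrite -exprS.
case: n {IH} => [|n] /=; first by rewrite expr0; ring.
by rewrite exprS -[n.+2%:R]natr1; ring.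
Qed.

Lemma is_cderive_toC (x : R) : is_cderive toC x 1.
Proof. by split; [exact: is_derive_id|exact: is_derive_cst]. Qed.

Lemma is_cderive_sum N (f : nat -> R -> C) df x : (forall n, is_cderive (f n) x (df n)) ->
  is_cderive (fun t => \sum_(i < N) f i t) x (\sum_(i < N) df i).
Proof.
move=> hf; elim: N => [|N IH].
  by rewrite big_ord0; under eq_fun do rewrite big_ord0; exact: is_cderive_cst.
by rewrite big_ord_recr; under eq_fun do rewrite big_ord_recr/=; exact: is_cderiveD.
Qed.

(** The mean value theorem fails for complex values; applying it to the real and the imaginary part
    costs the factor 2. *)
Lemma cmean_value (f df : R -> C) (B : R) : (forall t, is_cderive f t (df t)) ->
  (forall t, 0 <= t <= 1 -> normc (df t) <= B) -> normc (f 1 - f 0) <= 2 * B.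
Proof.
move=> hf hB.
have aux (g dg : R -> R) : (forall t, is_derive t (1:R) g (dg t)) ->
    (forall t, 0 <= t <= 1 -> `|dg t| <= B) -> `|g 1 - g 0| <= B.
  move=> hg hdg.
  have [|c c01 ->] := @MVT R g dg 0 1 ltr01 (fun x _ => hg x).
    apply: continuous_subspaceT => x.
    by apply: differentiable_continuous; apply/derivable1_diffP; exact: ex_derive.
  rewrite subr0 mulr1 hdg//; move: c01; rewrite in_itv/= => /andP[c0 c1].
  by rewrite !ltW.
apply: le_trans (normc_le_ReIm _) _; rewrite mulr2n mulrDl mul1r ReDc ImDc !raddfN/=.
rewrite lerD//.
  apply: (aux (fun t => Re (f t)) (fun t => Re (df t))); first by move=> t; exact: (hf t).1.
  by move=> t t01; apply: le_trans (Re_le_normc _) (hB _ t01).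
apply: (aux (fun t => Im (f t)) (fun t => Im (df t))); first by move=> t; exact: (hf t).2.
by move=> t t01; apply: le_trans (Im_le_normc _) (hB _ t01).
Qed.

End complex_limits.

(** * Generating function and Bargmann kernel *)

Section generating_function.
Context {R : realType}.
Local Notation C := R[i].
Local Notation Re := (@complex.Re R).
Local Notation Im := (@complex.Im R).
Local Notation toC := (real_complex R).
Local Notation mu := (@lebesgue_measure R).

Let hcoef (x : R) n : C := toC ((hermite_poly n).[x] / n`!%:R).

Let hcoef0 x : hcoef x 0 = 1.
Proof. by rewrite /hcoef hermite_poly0E fact0 divr1. Qed.

Let hcoef1 x : hcoef x 1 = 2 * toC x.
Proof. by rewrite /hcoef hermite_poly1E (_ : 1`! = 1%N)// divr1 rmorphM rmorph_nat. Qed.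

Let hcoefS x n : n.+2%:R * hcoef x n.+2 = 2 * toC x * hcoef x n.+1 - 2 * hcoef x n.
Proof.
have tn k : k%:R = toC k%:R by rewrite rmorph_nat.
have E : n.+2%:R * ((hermite_poly n.+2).[x] / n.+2`!%:R) =
    2 * x * ((hermite_poly n.+1).[x] / n.+1`!%:R) - 2 * ((hermite_poly n).[x] / n`!%:R).
  have f0 : n`!%:R != 0 :> R by rewrite pnatr_eq0 -lt0n fact_gt0.
  have a0 : n.+1%:R != 0 :> R by rewrite pnatr_eq0.
  have b0 : n.+2%:R != 0 :> R by rewrite pnatr_eq0.
  rewrite hermite_polySE !factS !natrM.
  move: (n`!%:R : R) (n.+1%:R : R) (n.+2%:R : R) f0 a0 b0 => f a b f0 a0 b0.
  by field; rewrite f0 a0 b0.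
by rewrite /hcoef (tn 2) (tn n.+2) -!rmorphM -rmorphB E.
Qed.

(* The partial sums of the generating series satisfy the differential equation of
   exp (2 x z t - z^2 t^2) up to the two boundary terms of the recurrence. *)
Let partial_sum_ode x z n t :
  \sum_(i < n.+1) hcoef x i * z ^+ i * (i%:R * t ^+ i.-1) =
  (2 * toC x * z - 2 * z ^+ 2 * t) * (\sum_(i < n.+1) hcoef x i * z ^+ i * t ^+ i)
  + (2 * hcoef x n * z ^+ n.+2 * t ^+ n.+1 - n.+1%:R * hcoef x n.+1 * z ^+ n.+1 * t ^+ n).
Proof.
elim: n => [|n IH].
  by rewrite !big_ord1 /= hcoef0 hcoef1; ring.
rewrite big_ord_recr/= [in RHS]big_ord_recr/= IH.
have -> : n.+2%:R * hcoef x n.+2 * z ^+ n.+2 * t ^+ n.+1 =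
  (2 * toC x * hcoef x n.+1 - 2 * hcoef x n) * z ^+ n.+2 * t ^+ n.+1 by rewrite hcoefS.
by rewrite !exprS; ring.
Qed.

(** The product S_n(t) exp(-(2 x z t - z^2 t^2)) is 1 at t = 0 and, by [partial_sum_ode], has
    derivative O(2^(-n)) on [0, 1]. The mean value inequality then compares S_n(1) with the
    exponential. *)
Lemma hermite_generating (x : R) (z : C) :
  ccvg (fun N => \sum_(i < N) toC ((hermite_poly i).[x] / i`!%:R) * z ^+ i)
    (cexp (2 * toC x * z - z ^+ 2)).
Proof.
(* Radius 2 |z| instead of |z|: the spare power of 2 absorbs the factor n + 1 of the boundary
   term. *)
have [D D0 HD] := @hermite_term_bound R (2 * normc z) (mulr_ge0 (ler0n _ _) (normc_ge0 z)).
have tn k : k%:R = toC k%:R by rewrite rmorph_nat.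
pose q (t : R) : C := - (2 * toC x * z * toC t - z ^+ 2 * toC t ^+ 2).
pose S N t := \sum_(i < N) hcoef x i * z ^+ i * toC t ^+ i.
have dS n t : is_cderive (S n) t (\sum_(i < n) hcoef x i * z ^+ i * (i%:R * toC t ^+ i.-1)).
  apply: (@is_cderive_sum R n (fun i t => hcoef x i * z ^+ i * toC t ^+ i)
    (fun i => hcoef x i * z ^+ i * (i%:R * toC t ^+ i.-1))) => i.
  have := is_cderiveM (is_cderive_cst (hcoef x i * z ^+ i) t) (is_cderiveX i (is_cderive_toC t)).
  by rewrite mul0r addr0 mulr1.
have dq t : is_cderive q t (- (2 * toC x * z - 2 * z ^+ 2 * toC t)).
  have h1 := is_cderiveM (is_cderive_cst (- (2 * toC x * z)) t) (is_cderive_toC t).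
  have h2 := is_cderiveM (is_cderive_cst (z ^+ 2) t) (is_cderiveX 2 (is_cderive_toC t)).
  have := is_cderiveD h1 h2.
  rewrite (_ : _ + _ = - (2 * toC x * z - 2 * z ^+ 2 * toC t)); last by rewrite /=; ring.
  by congr is_cderive; apply/funext => s; rewrite /q; ring.
pose rem n (t : R) := (2 * hcoef x n * z ^+ n.+2 * toC t ^+ n.+1 -
   n.+1%:R * hcoef x n.+1 * z ^+ n.+1 * toC t ^+ n) * cexp (q t).
have dD n t : is_cderive (fun t => S n.+1 t * cexp (q t)) t (rem n t).
  have := is_cderiveM (dS n.+1 t) (is_cderive_cexp (dq t)).
  by congr is_cderive; rewrite partial_sum_ode /rem /S; ring.
pose L := 2 * `|x| * normc z + normc z ^+ 2.
have normq t : 0 <= t <= 1 -> `|Re (q t)| <= L.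
  move=> /andP[t0 t1]; apply: le_trans (Re_le_normc _) _.
  rewrite /q normcN; apply: le_trans (le_normcD _ _) _.
  rewrite normcN !(normcX, normcM) !normc_toC (ger0_norm t0) (tn 2) normc_toC normr_nat.
  rewrite lerD// ler_piMr// ?mulr_ge0 ?normc_ge0 ?exprn_ge0 ?normc_ge0//.
  by rewrite expr2 mulr_ile1.
pose E := expR (4^-1 * x ^+ 2).
have Hc n : normc (hcoef x n) * (2 * normc z) ^+ n <= D / 2 ^+ n * E.
  rewrite /hcoef normc_toC normrM normfV normr_nat mulrAC.
  exact: HD.
have nz := normc_ge0 z.
pose B := (2 * normc z ^+ 2 * D + D) * E * expR L.
have E0 : 0 <= E := expR_ge0 _.
have remB n t : 0 <= t <= 1 -> normc (rem n t) <= B / 2 ^+ n.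
  move=> t01; rewrite /rem normcM normc_cexp.
  have -> : B / 2 ^+ n = ((2 * normc z ^+ 2 * D + D) * E / 2 ^+ n) * expR L.
    by rewrite /B mulrAC.
  apply: ler_pM; rewrite ?normc_ge0 ?expR_ge0//; last first.
    by rewrite ler_expR (le_trans (ler_norm _))// normq.
  have /andP[t0 t1] := t01.
  apply: le_trans (le_normcD _ _) _; rewrite normcN !(normcX, normcM) !(normc_toC t) (ger0_norm t0).
  rewrite (tn 2) (tn n.+1) (normc_toC 2%:R) (normc_toC n.+1%:R) !normr_nat.
  rewrite (mulrDl (2 * normc z ^+ 2 * D) D) (mulrDl _ (D * E)); apply: lerD.
    apply: (@le_trans _ _ (2 * normc (hcoef x n) * normc z ^+ n.+2)).
      apply: ler_piMr; last exact: exprn_ile1.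
      exact: mulr_ge0 (mulr_ge0 (ler0n _ _) (normc_ge0 _)) (exprn_ge0 _ nz).
    have -> : 2 * normc (hcoef x n) * normc z ^+ n.+2 =
      2 * normc z ^+ 2 * (normc (hcoef x n) * normc z ^+ n) by rewrite !exprS; ring.
    rewrite -!mulrA; rewrite !ler_wpM2l// ?exprn_ge0//.
    rewrite (mulrC E) mulrA; apply: le_trans (Hc n).
    rewrite ler_wpM2l ?normc_ge0// lerXn2r ?nnegrE ?mulr_ge0// ler_peMl// ler1n//.
  apply: (@le_trans _ _ (n.+1%:R * normc (hcoef x n.+1) * normc z ^+ n.+1)).
    apply: ler_piMr; last exact: exprn_ile1.
      exact: mulr_ge0 (mulr_ge0 (ler0n _ _) (normc_ge0 _)) (exprn_ge0 _ nz).
  apply: (@le_trans _ _ (D / 2 ^+ n.+1 * E)).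
    apply: le_trans (Hc n.+1); rewrite exprMn mulrCA mulrA ler_wpM2r ?exprn_ge0//.
    rewrite mulrC [leRHS]mulrC ler_wpM2l ?normc_ge0// -natrX ler_nat.
    exact/ltnW/ltn_expl.
  rewrite mulrAC ler_wpM2l ?mulr_ge0 ?(ltW D0)// lef_pV2 ?posrE ?exprn_gt0//.
  by rewrite exprS ler_peMl ?exprn_ge0// ler1n.
have S0 n : S n.+1 0 = 1.
  rewrite /S big_ord_recl big1 ?addr0; first by rewrite hcoef0 !mulr1.
  by move=> i _; rewrite /= expr0n mulr0.
have q0 : cexp (q 0) = 1.
  rewrite (_ : q 0 = 0) ?cexp0// /q (rmorph0 toC); ring.
have q1 : cexp (q 1) * cexp (2 * toC x * z - z ^+ 2) = 1.
  by rewrite -cexpD -[RHS]cexp0; congr cexp; rewrite /q rmorph1; ring.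
have Sn1 n : \sum_(i < n) toC ((hermite_poly i).[x] / i`!%:R) * z ^+ i = S n 1.
  by rewrite /S; apply: eq_bigr => i _; rewrite rmorph1 expr1n mulr1.
suff: ccvg (fun n => S n.+1 1) (cexp (2 * toC x * z - z ^+ 2)).
  move=> [h1 h2].
  rewrite (_ : (fun N => _) = fun N => S N 1); last by apply/funext => N; rewrite Sn1.
  split.
    by rewrite -(@cvg_shiftS _ (fun n => Re (S n 1))).
  by rewrite -(@cvg_shiftS _ (fun n => Im (S n 1))).
apply: (@ccvg_normc _ _ _ (fun n => 2 * B * expR L / 2 ^+ n)); first exact: cvg_half.
move=> n; have -> : S n.+1 1 - cexp (2 * toC x * z - z ^+ 2) =
   (S n.+1 1 * cexp (q 1) - S n.+1 0 * cexp (q 0)) * cexp (2 * toC x * z - z ^+ 2).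
  by rewrite S0 q0 mulr1 mulrBl -(mulrA (S _ _)) q1 mulr1 mul1r.
rewrite normcM normc_cexp.
have -> : 2 * B * expR L / 2 ^+ n = (2 * (B / 2 ^+ n)) * expR L by ring.
apply: ler_pM; rewrite ?normc_ge0 ?expR_ge0//.
  by apply: (@cmean_value R (fun t => S n.+1 t * cexp (q t)) (rem n)) => // t; exact: remB.
rewrite ler_expR; have := normq 1; rewrite ler01 lexx => /(_ isT).
rewrite (_ : q 1 = - (2 * toC x * z - z ^+ 2)); last by rewrite /q rmorph1; ring.
by rewrite raddfN/= normrN => h; apply: le_trans (ler_norm _) h.
Qed.

(** The usual kernel pi^(-1/4) exp(-x^2 / 2 + sqrt 2 x z - z^2 / 2). *)
Definition bargmann_kernel (x : R) (z : C) : C :=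
  toC (pi `^ (- 4^-1) * expR (- (2^-1 * x ^+ 2))) *
  cexp (toC (Num.sqrt 2 * x) * z - 2^-1 * z ^+ 2).

(** The generating function at z / sqrt 2, a rescaling that accounts for the factor 2^(-n/2) in
    [hermite_norm]. *)
Lemma bargmann_kernel_series (x : R) (z : C) :
  ccvg (fun N => \sum_(i < N) toC (hermite_fun i x / Num.sqrt i`!%:R) * z ^+ i)
    (bargmann_kernel x z).
Proof.
have s2 : Num.sqrt 2 != 0 :> R by rewrite gt_eqF// sqrtr_gt0.
have hs : toC (Num.sqrt 2) ^+ 2 = 2 by rewrite -rmorphXn sqr_sqrtr// rmorph_nat.
have si : (Num.sqrt 2)^-1 = Num.sqrt 2 / 2 :> R.
  by apply: (mulfI s2); rewrite divff// mulrA -expr2 sqr_sqrtr// divff.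
have -> : bargmann_kernel x z = toC (pi `^ (- 4^-1) * expR (- (2^-1 * x ^+ 2))) *
    cexp (2 * toC x * (toC (Num.sqrt 2)^-1 * z) - (toC (Num.sqrt 2)^-1 * z) ^+ 2).
  have e1 : toC (Num.sqrt 2)^-1 = toC (Num.sqrt 2) / 2.
    by rewrite si rmorphM fmorphV rmorph_nat.
  have e2 : 2 * toC x * (toC (Num.sqrt 2)^-1 * z) = toC (Num.sqrt 2 * x) * z.
    by rewrite e1 rmorphM; field.
  have e3 : (toC (Num.sqrt 2)^-1 * z) ^+ 2 = 2^-1 * z ^+ 2.
    by rewrite e1 exprMn exprMn hs; field.
  by rewrite e2 e3.
have := ccvgZ (toC (pi `^ (- 4^-1) * expR (- (2^-1 * x ^+ 2))))
  (hermite_generating x (toC (Num.sqrt 2)^-1 * z)).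
suff -> : (fun N => toC (pi `^ (- 4^-1) * expR (- (2^-1 * x ^+ 2))) *
    \sum_(i < N) toC ((hermite_poly i).[x] / i`!%:R) * (toC (Num.sqrt 2)^-1 * z) ^+ i) =
  (fun N => \sum_(i < N) toC (hermite_fun i x / Num.sqrt i`!%:R) * z ^+ i) by [].
apply/funext => N; rewrite mulr_sumr; apply: eq_bigr => i _.
rewrite exprMn -rmorphXn (mulrA (toC _)) (mulrA _ (toC _) (z ^+ i)) -!rmorphM; congr (toC _ * _).
rewrite hermite_funE hermite_normE sqrtrM ?exprn_ge0// exprVn.
have -> : Num.sqrt (2 ^+ i) = Num.sqrt 2 ^+ i :> R.
  apply/eqP; rewrite -(@eqrXn2 _ 2)// ?sqrtr_ge0 ?exprn_ge0 ?sqrtr_ge0//.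
  by rewrite sqr_sqrtr ?exprn_ge0// exprAC sqr_sqrtr.
have -> : (i`!%:R)^-1 = (Num.sqrt i`!%:R)^-1 * (Num.sqrt i`!%:R)^-1 :> R.
  by rewrite -invfM -expr2 sqr_sqrtr.
by rewrite invfM; ring.
Qed.

End generating_function.

(** * Fourier transform of the Hermite functions *)

Section trigonometric_transform.
Context {R : realType}.
Local Notation mu := (@lebesgue_measure R).

(* The phases th = 0 and th = - pi / 2 give the cosine and the sine integral. *)
Definition trig_int (f : R -> R) (xi th : R) : R :=
  \int[mu]_x (f x * cos (x * xi + th)).

Lemma continuous_cos_affine (xi th : R) : continuous (fun x : R => cos (x * xi + th)).
Proof.
move=> x; apply: continuous_comp; last exact: continuous_cos.
by apply: cvgD; [apply: cvgM; [exact: cvg_id|exact: cvg_cst]|exact: cvg_cst].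
Qed.

Lemma cos_abs_le1 (x : R) : `|cos x| <= 1.
Proof. by rewrite ler_norml cos_geN1 cos_le1. Qed.

Lemma L1_cos (f : R -> R) xi th : L1 f -> L1 (fun x => f x * cos (x * xi + th)).
Proof.
apply: (@L1_mulb _ 1); last by move=> x; exact: cos_abs_le1.
by apply: continuous_measurable; exact: continuous_cos_affine.
Qed.

Lemma trig_intD f g xi th : L1 f -> L1 g ->
  trig_int (fun x => f x + g x) xi th = trig_int f xi th + trig_int g xi th.
Proof.
move=> f1 g1; rewrite /trig_int -RintegralD//; try exact: L1_cos.
by apply: eq_Rintegral => x _; rewrite mulrDl.
Qed.

Lemma trig_intZ k f xi th : L1 f -> trig_int (fun x => k * f x) xi th = k * trig_int f xi th.
Proof.
move=> f1; rewrite /trig_int -RintegralZl//; last exact: L1_cos.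
by apply: eq_Rintegral => x _; rewrite mulrA.
Qed.

Lemma trig_int_phase f xi th : L1 f ->
  trig_int f xi th = cos th * trig_int f xi 0 - sin th * trig_int f xi (- (pi / 2)).
Proof.
move=> f1; rewrite /trig_int -!RintegralZl//; try exact: L1_cos.
rewrite -RintegralB//; try by apply: L1Z; exact: L1_cos.
apply: eq_Rintegral => x _; rewrite addr0 -[_ - pi / 2]opprK cosN opprB.
by rewrite cosB cos_pihalf sin_pihalf cosD; ring.
Qed.

Lemma le_trig_int f xi th : L1 f -> `|trig_int f xi th| <= \int[mu]_x `|f x|.
Proof.
move=> f1; apply: le_trans (le_normr_Rintegral _ _) _ => //; first exact: L1_cos.
apply: le_Rintegral => //; [by apply: L1_norm; exact: L1_cos|exact: L1_norm|].
by move=> x _; rewrite normrM ler_piMr ?cos_abs_le1.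
Qed.

Lemma is_derive_cos_affine (x th xi : R) :
  is_derive xi (1:R) (fun xi => cos (x * xi + th)) (x * cos (x * xi + (th + pi / 2))).
Proof.
have h : is_derive xi (1:R) (fun xi => x * xi + th) x.
  have := is_deriveD (is_deriveM (is_derive_cst x xi 1) (is_derive_id xi 1)) (is_derive_cst th xi 1).
  by rewrite /= scaler0 addr0 addr0 /GRing.scale/= mulr1.
have := @is_derive1_comp R cos (fun xi => x * xi + th) xi _ _ (is_derive_cos _) h.
by rewrite addrA cosDpihalf [X in _ -> is_derive _ _ _ X]mulrC.
Qed.

(** Differentiation under the integral sign with majorant |x f(x)|. A derivative of the cosine is a
    phase shift by pi / 2, so the family [trig_int] is closed under differentiation. *)
Lemma is_derive_trig_int (f : R -> R) xi th : L1 f -> L1 (fun x => x * f x) ->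
  is_derive xi (1:R) (fun xi => trig_int f xi th)
    (trig_int (fun x => x * f x) xi (th + pi / 2)).
Proof.
move=> f1 xf1.
pose F xi x := f x * cos (x * xi + th).
have dF x y : is_derive y (1:R) (F ^~ x) (f x * (x * cos (x * y + (th + pi / 2)))).
  have := is_deriveM (is_derive_cst (f x) y 1) (is_derive_cos_affine x th y).
  by rewrite /= scaler0 addr0.
have xiI : `]xi - 1, xi + 1[%classic xi by rewrite /= in_itv/=; apply/andP; split; lra.
have hyp1 : forall x, `]xi - 1, xi + 1[%classic x -> mu.-integrable [set: R] (EFin \o F x).
  by move=> x _; exact: L1_cos.
have hd : forall x y, `]xi - 1, xi + 1[%classic x -> [set: R] y -> derivable (F ^~ y) x 1.
  by move=> x y _ _; have [] := dF y x.
have p1 x y : partial1of2 F x y = f y * (y * cos (y * x + (th + pi / 2))).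
  by rewrite partial1of2E; have [_] := dF y x.
have G0 x : 0 <= `|x * f x| by exact: normr_ge0.
have GL : mu.-integrable [set: R] (EFin \o (fun x : R => `|x * f x|)) by exact: L1_norm.
have ub : forall x y, `]xi - 1, xi + 1[%classic x -> [set: R] y -> `|partial1of2 F x y| <= `|y * f y|.
  by move=> x y _ _; rewrite p1 mulrA (mulrC (f y)) normrM ler_piMr ?cos_abs_le1.
have dv := @derivable_under_integral R _ _ mu F setT measurableT _ _ _ xiI hyp1 hd _ G0 GL ub.
have vl := @differentiation_under_integral R _ _ mu F setT measurableT _ _ _ xiI hyp1 hd _ G0 GL ub.
split; first exact: dv.
rewrite -derive1E [LHS]vl /trig_int; apply: eq_Rintegral => x _.
by rewrite p1 mulrCA mulrA.
Qed.

Section gaussian.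
Variable c : R.
Hypothesis c_gt0 : 0 < c.
Let T (p : {poly R}) := trig_int (fun x => p.[x] * expR (- (c * x ^+ 2))).
Let L1p (p : {poly R}) := L1_poly_gauss p c_gt0.


Lemma trig_gaussD p q xi th : T (p + q) xi th = T p xi th + T q xi th.
Proof.
rewrite /T -trig_intD//; congr (trig_int _ _ _); apply/funext => x.
by rewrite hornerD mulrDl.
Qed.

Lemma trig_gaussZ k p xi th : T (k *: p) xi th = k * T p xi th.
Proof.
rewrite /T -trig_intZ//; congr (trig_int _ _ _); apply/funext => x.
by rewrite hornerZ -mulrA.
Qed.

Lemma is_derive_trig_gauss p xi th :
  is_derive xi (1:R) (fun xi => T p xi th) (T ('X * p) xi (th + pi / 2)).
Proof.
have e : (fun x => x * (p.[x] * expR (- (c * x ^+ 2)))) =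
    (fun x => ('X * p).[x] * expR (- (c * x ^+ 2))).
  by apply/funext => x; rewrite hornerM hornerX mulrA.
rewrite /T -e; apply: is_derive_trig_int => //.
by rewrite e.
Qed.

(** Integration by parts in x: differentiating the cosine produces xi and a phase shift, the
    counterpart of [is_derive_trig_gauss]. *)
Lemma trig_gauss_parts p xi th :
  T (p^`() - (2 * c) *: ('X * p)) xi th = - xi * T p xi (th + pi / 2).
Proof.
have c2 : 0 < c / 2 by rewrite divr_gt0.
have [K1 K10 H1] := poly_gaussian_bound p c2.
have [K2 K20 H2] := poly_gaussian_bound (p^`() - (2 * c) *: ('X * p)) c2.
pose K := K1 + K2 + `|xi| * K1.
have split2 (q : {poly R}) (K' : R) (x : R) : `|q.[x]| <= K' * expR (c / 2 * x ^+ 2) ->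
    `|q.[x] * expR (- (c * x ^+ 2))| <= K' * expR (- (c / 2 * x ^+ 2)).
  move=> qK; rewrite normrM (ger0_norm (expR_ge0 _)).
  apply: le_trans (ler_wpM2r (expR_ge0 _) qK) _.
  by rewrite -(mulrA K') -expRD le_eqVlt; apply/orP; left; apply/eqP; congr (_ * expR _); field.
have dg x : is_derive x (1:R) (fun x => p.[x] * expR (- (c * x ^+ 2)) * cos (x * xi + th))
   ((p^`() - (2 * c) *: ('X * p)).[x] * expR (- (c * x ^+ 2)) * cos (x * xi + th) +
    xi * (p.[x] * expR (- (c * x ^+ 2)) * cos (x * xi + (th + pi / 2)))).
  have := is_deriveM (is_derive_poly_gauss c x p) (is_derive_cos_affine xi th x).
  rewrite /= [x * xi]mulrC (_ : (fun x0 : R => p.[x0] * _ * cos (x0 * _ + _)) =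
    (fun x : R => p.[x] * expR (- (c * x ^+ 2))) * (fun x : R => cos (xi * x + th))); last first.
    by apply/funext => y; rewrite [y * xi]mulrC.
  move=> h; apply: is_derive_eq h _.
  by rewrite -(scalerAl (2 * c) 'X p); set q := (p^`() - _).[x]; rewrite /GRing.scale/=; ring.
have cg : continuous (fun x =>
   ((p^`() - (2 * c) *: ('X * p)).[x] * expR (- (c * x ^+ 2)) * cos (x * xi + th) +
    xi * (p.[x] * expR (- (c * x ^+ 2)) * cos (x * xi + (th + pi / 2))))).
  move=> x; apply: cvgD; [apply: cvgM|apply: cvgM; first exact: cvg_cst].
    - by apply: cvgM; [exact: continuous_horner|exact: continuous_gaussian0].
    - exact: continuous_cos_affine.
  apply: cvgM; last exact: continuous_cos_affine.
  by apply: cvgM; [exact: continuous_horner|exact: continuous_gaussian0].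
have := @Rint_derive_eq0 R _ _ K (c / 2) c2 dg cg.
have e x : 0 <= expR (- (c / 2 * x ^+ 2)) by exact: expR_ge0.
have cb := cos_abs_le1.
move=> H; have {H} : \int[mu]_x
   ((p^`() - (2 * c) *: ('X * p)).[x] * expR (- (c * x ^+ 2)) * cos (x * xi + th) +
    xi * (p.[x] * expR (- (c * x ^+ 2)) * cos (x * xi + (th + pi / 2)))) = 0.
  apply: H => x.
    rewrite normrM; apply: le_trans (ler_piMr (normr_ge0 _) (cb _)) _.
    apply: le_trans (split2 _ _ _ (H1 x)) _; rewrite ler_wpM2r// /K -addrA lerDl.
    by rewrite addr_ge0 ?(ltW K20)// mulr_ge0// ltW.
  apply: le_trans (ler_normD _ _) _; rewrite /K [leRHS](_ : _ =
    K2 * expR (- (c / 2 * x ^+ 2)) + (`|xi| * (K1 * expR (- (c / 2 * x ^+ 2))) +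
    K1 * expR (- (c / 2 * x ^+ 2)))); last by ring.
  apply: lerD.
    rewrite normrM; apply: le_trans (ler_piMr (normr_ge0 _) (cb _)) _.
    exact: split2 (H2 x).
  apply: ler_wpDr; first by rewrite mulr_ge0// ltW.
  rewrite normrM ler_wpM2l// normrM; apply: le_trans (ler_piMr (normr_ge0 _) (cb _)) _.
  exact: split2 (H1 x).
rewrite RintegralD//; first last.
- by apply: L1Z; exact: L1_cos.
- exact: L1_cos.
rewrite RintegralZl//; last exact: L1_cos.
by move/eqP; rewrite addr_eq0 => /eqP h; rewrite mulNr -h.
Qed.

End gaussian.

(** As a function of xi the transform solves y' = -xi y / (2 c), so its product with exp(xi^2 / (4
    c)) is constant. *)
Lemma trig_gaussian (c xi th : R) : 0 < c ->
  trig_int (fun x => expR (- (c * x ^+ 2))) xi th =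
  Num.sqrt (pi / c) * expR (- ((4 * c)^-1 * xi ^+ 2)) * cos th.
Proof.
move=> c0.
pose T (p : {poly R}) := trig_int (fun x => p.[x] * expR (- (c * x ^+ 2))).
have T1 : trig_int (fun x => expR (- (c * x ^+ 2))) = T 1.
  by rewrite /T; congr trig_int; apply/funext => x; rewrite hornerC mul1r.
have dT t y : is_derive y (1:R) (fun xi => T 1 xi t) (- (2 * (4 * c)^-1 * y) * T 1 y t).
  have := is_derive_trig_gauss c0 1 y t; rewrite mulr1.
  have := trig_gauss_parts c0 1 y (t + pi / 2).
  rewrite derivC sub0r mulr1 -scaleNr trig_gaussZ// -/(T 'X y _) -/(T 1 y _).
  have -> : T 1 y (t + pi / 2 + pi / 2) = - T 1 y t.
    rewrite /T -mulN1r -trig_intZ; last exact: L1_poly_gauss.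
    apply: eq_Rintegral => x _; rewrite !addrA !cosDpihalf sinDpihalf; ring.
  move=> h; congr is_derive; apply: (@mulfI _ (- (2 * c))).
    by rewrite oppr_eq0 mulf_neq0// gt_eqF.
  by rewrite h; field; rewrite gt_eqF.
have dE : forall y : R, is_derive y (1:R) (fun y => T 1 y th * expR ((4 * c)^-1 * y ^+ 2)) 0.
  move=> y; have := is_derive_gauss (- (4 * c)^-1) y.
  under eq_fun do rewrite mulNr opprK.
  move=> h; have := is_deriveM (dT th y) h.
  rewrite /= /GRing.scale/= [X in is_derive _ _ _ X](_ : _ = 0)//.
  rewrite (_ : - (- (4 * c)^-1 * y ^+ 2) = (4 * c)^-1 * y ^+ 2); first ring.
  by rewrite mulNr opprK.
have := is_derive_0_is_cst xi 0 dE.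
rewrite expr0n/= mulr0 expR0 mulr1 => h.
rewrite T1 (_ : T 1 xi th = T 1 0 th * expR (- ((4 * c)^-1 * xi ^+ 2))); last first.
  by rewrite -h -mulrA expRxMexpNx_1 mulr1.
rewrite mulrAC; congr (_ * _).
rewrite /T /trig_int -Rint_gaussian0// mulrC -RintegralZl//; last exact: L1_gaussian0.
by apply: eq_Rintegral => x _; rewrite hornerC mul1r mulr0 add0r mulrC.
Qed.

(** The operator x - d/dx sends H_n exp(-x^2 / 2) to H_(n+1) exp(-x^2 / 2) and commutes with the
    Fourier transform up to the factor -i, which appears here as a phase shift by pi / 2. *)
Lemma trig_hermite_poly n (xi th : R) :
  trig_int (fun x => (hermite_poly n).[x] * expR (- (2^-1 * x ^+ 2))) xi th =
  Num.sqrt (2 * pi) * ((hermite_poly n).[xi] * expR (- (2^-1 * xi ^+ 2))) *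
  cos (th + n%:R * (pi / 2)).
Proof.
have c0 : 0 < 2^-1 :> R by rewrite invr_gt0.
pose T (p : {poly R}) := trig_int (fun x => p.[x] * expR (- (2^-1 * x ^+ 2))).
pose P n xi := (@hermite_poly R n).[xi] * expR (- (2^-1 * xi ^+ 2)).
rewrite -/(T (hermite_poly n) _ _) -/(P n xi).
elim: n xi th => [|n IH] xi th.
  rewrite mul0r addr0 /P hermite_poly0E mul1r.
  have -> : T (hermite_poly 0) = trig_int (fun x => expR (- (2^-1 * x ^+ 2))).
    by rewrite /T; congr trig_int; apply/funext => x; rewrite hermite_poly0E mul1r.
  rewrite trig_gaussian// invrK [pi * 2]mulrC.
  by have -> : (4 * 2^-1)^-1 = 2^-1 :> R by field.
have p1 := trig_gauss_parts c0 (hermite_poly n) xi th.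
(* Differentiation in xi raises the phase by pi / 2, so it starts from [th - pi / 2]. *)
have d1 := is_derive_trig_gauss c0 (hermite_poly n) xi (th - pi / 2).
rewrite subrK -/(T _ _ _) in d1.
have d2 := is_derive_poly_gauss 2^-1 xi (@hermite_poly R n).
have := is_deriveM (is_derive_cst (Num.sqrt (2 * pi) * cos (th - pi / 2 + n%:R * (pi / 2))) xi 1) d2.
rewrite /= scaler0 addr0 => d3.
have e : T ('X * hermite_poly n) xi th = Num.sqrt (2 * pi) * cos (th - pi / 2 + n%:R * (pi / 2)) *
    (((hermite_poly n)^`() - (2 * 2^-1) *: 'X * hermite_poly n).[xi] * expR (- (2^-1 * xi ^+ 2))).
  have ef : (fun y => T (hermite_poly n) y (th - pi / 2)) =
      cst (Num.sqrt (2 * pi) * cos (th - pi / 2 + n%:R * (pi / 2))) *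
      (fun x : R => (hermite_poly n).[x] * expR (- (2^-1 * x ^+ 2))).
    by apply/funext => y; rewrite IH /P mulrAC.
  move: d1; rewrite -/(T (hermite_poly n)) ef => -[_ <-]; case: d3 => _ ->.
  by [].
have pe : (hermite_poly n)^`() - (2 * 2^-1) *: ('X * hermite_poly n) + hermite_poly n.+1 =
    'X * hermite_poly n :> {poly R}.
  by rewrite hermite_polyS divff// scale1r mulrnAl mulr2n; ring.
have h : T ('X * hermite_poly n) xi th =
    - xi * T (hermite_poly n) xi (th + pi / 2) + T (hermite_poly n.+1) xi th.
  by rewrite -pe [LHS](trig_gaussD c0); congr (_ + _); exact: p1.
rewrite e IH in h.
have -> : T (hermite_poly n.+1) xi th = Num.sqrt (2 * pi) * cos (th - pi / 2 + n%:R * (pi / 2)) *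
    (((hermite_poly n)^`() - (2 * 2^-1) *: 'X * hermite_poly n).[xi] * expR (- (2^-1 * xi ^+ 2))) +
    xi * (Num.sqrt (2 * pi) * P n xi * cos (th + pi / 2 + n%:R * (pi / 2))) by rewrite h; ring.
rewrite /P hermite_polyS divff// scale1r !hornerD !hornerN !hornerM hornerMn hornerX.
have -> : th + n.+1%:R * (pi / 2) = th + n%:R * (pi / 2) + pi / 2 by rewrite -natr1; ring.
have -> : th + pi / 2 + n%:R * (pi / 2) = th + n%:R * (pi / 2) + pi / 2 by ring.
have -> : th - pi / 2 + n%:R * (pi / 2) = th + n%:R * (pi / 2) - pi / 2 by ring.
rewrite cosDpihalf cosB cos_pihalf sin_pihalf; ring.
Qed.

Lemma trig_hermite_fun n (xi th : R) :
  trig_int (@hermite_fun R n) xi th =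
  Num.sqrt (2 * pi) * hermite_fun n xi * cos (th + n%:R * (pi / 2)).
Proof.
transitivity (hermite_norm n *
    trig_int (fun x => (hermite_poly n).[x] * expR (- (2^-1 * x ^+ 2))) xi th).
  rewrite -trig_intZ; last by apply: L1_poly_gauss; rewrite invr_gt0.
  by congr (trig_int _ _ _); apply/funext => x; rewrite hermite_funE -mulrA.
by rewrite trig_hermite_poly hermite_funE; ring.
Qed.

End trigonometric_transform.

(** * Bargmann transform and completeness *)

Section completeness.
Context {R : realType}.
Local Notation mu := (@lebesgue_measure R).
Local Notation C := R[i].
Local Notation Re := (@complex.Re R).
Local Notation Im := (@complex.Im R).
Local Notation toC := (real_complex R).

Definition L2r (u : R -> R) := measurable_fun setT u /\ L1 (fun x => u x ^+ 2).

Lemma L2r_mul u v : L2r u -> L2r v -> L1 (fun x => u x * v x).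
Proof.
move=> [mu1 u2] [mv v2]; apply: (L1_le _ _ (L1D u2 v2)); first exact: measurable_funM.
move=> x; rewrite normrM -(real_normK (num_real (u x))) -(real_normK (num_real (v x))).
have := sqr_ge0 (`|u x| - `|v x|); have := normr_ge0 (u x); have := normr_ge0 (v x); nra.
Qed.

Lemma L2rD u v : L2r u -> L2r v -> L2r (fun x => u x + v x).
Proof.
move=> hu hv; split; first by apply: measurable_funD; [exact: hu.1|exact: hv.1].
have e x : u x ^+ 2 + 2 * (u x * v x) + v x ^+ 2 = (u x + v x) ^+ 2 by ring.
by have := L1D (L1D hu.2 (L1Z 2 (L2r_mul hu hv))) hv.2; under eq_fun do rewrite e.
Qed.

Lemma L2rZ k u : L2r u -> L2r (fun x => k * u x).
Proof.
move=> [mu1 u2]; split; first exact: measurable_funM.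
by have := L1Z (k ^+ 2) u2; under eq_fun do rewrite -exprMn.
Qed.

Lemma L2r_gauss (u : R -> R) K c : 0 < c -> measurable_fun setT u ->
  {ae mu, forall x, `|u x| <= K * expR (- (c * x ^+ 2))} -> L1 u /\ L2r u.
Proof.
move=> c0 mu1 uK; split; first by apply: (L1_ae_le mu1 uK); exact/L1Z/L1_gaussian0.
split => //; have c2 : 0 < 2 * c by rewrite mulr_gt0.
apply: (@L1_ae_le _ (fun x => K ^+ 2 * expR (- (2 * c * x ^+ 2)))).
- exact: measurable_funX.
- apply: ae_imp uK => x ux; rewrite normrX.
  rewrite (_ : _ * _ = (K * expR (- (c * x ^+ 2))) ^+ 2); first by rewrite lerXn2r ?nnegrE ?(le_trans _ ux).
  by rewrite exprMn [expR _ ^+ 2]expr2 -expRD; congr (_ * expR _); ring.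
- exact/L1Z/L1_gaussian0.
Qed.

Lemma L2r_gaussian (c : R) : 0 < c -> L2r (fun x => expR (- (c * x ^+ 2))).
Proof.
move=> c0; apply: (@L2r_gauss _ 1 c c0 _ _).2.
  by apply: continuous_measurable; exact: continuous_gaussian0.
by apply: aeW => x; rewrite mul1r ger0_norm// expR_ge0.
Qed.

Lemma L2r_hermite n : L2r (@hermite_fun R n).
Proof.
have [D D0 HD] := @hermite_fun_gauss R n.
have c0 : 0 < 4^-1 :> R by rewrite invr_gt0.
apply: (L2r_gauss c0 (measurable_hermite_fun n) _).2.
by apply: aeW => x; exact: HD.
Qed.

Definition rbargmann (u : R -> R) (z : C) : C :=
  Complex (\int[mu]_x (u x * Re (bargmann_kernel x z)))
          (\int[mu]_x (u x * Im (bargmann_kernel x z))).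

(** [p] stands for [Re] and [Im], so that the dominated convergence of the kernel series, with |u|
    times a Gaussian as majorant, is carried out once. *)
Lemma rbargmann_part (p : C -> R) (u : R -> R) (z : C) : L2r u ->
  p 0 = 0 -> (forall z w, p (z + w) = p z + p w) ->
  (forall a z, p (toC a * z) = a * p z) -> (forall z, `|p z| <= normc z) ->
  (forall v l, ccvg v l -> p (v n) @[n --> \oo] --> p l) ->
  p (\sum_(i < n) toC ((\int[mu]_x (u x * hermite_fun i x)) / Num.sqrt i`!%:R) * z ^+ i)
    @[n --> \oo] --> \int[mu]_x (u x * p (bargmann_kernel x z)).
Proof.
move=> hu p0 pD pZ pn pc.
have psum n (f : 'I_n -> C) : p (\sum_(i < n) f i) = \sum_(i < n) p (f i).
  exact: (big_morph p pD p0).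
pose h n x : R := p (\sum_(i < n) toC (hermite_fun i x / Num.sqrt i`!%:R) * z ^+ i).
have hE n x : h n x = \sum_(i < n) (hermite_fun i x / Num.sqrt i`!%:R) * p (z ^+ i).
  by rewrite /h psum; apply: eq_bigr => i _; rewrite pZ.
have hc x : h n x @[n --> \oo] --> p (bargmann_kernel x z).
  by apply: pc; exact: bargmann_kernel_series.
have mh n : measurable_fun setT (h n).
  rewrite (_ : h n = fun x => \sum_(i < n) (hermite_fun i x / Num.sqrt i`!%:R) * p (z ^+ i)).
    apply: measurable_sum => i.
    by apply: measurable_funM => //; apply: measurable_funM => //; exact: measurable_hermite_fun.
  by apply/funext => x; rewrite hE.
have [D D0 HD] := @hermite_fun_bound R _ (normc_ge0 z).
have hb n x : `|h n x| <= 2 * D * expR (- (4^-1 * x ^+ 2)).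
  rewrite hE; apply: le_trans (ler_norm_sum _ _ _) _.
  apply: le_trans (_ : (\sum_(i < n) D / 2 ^+ i) * expR (- (4^-1 * x ^+ 2)) <= _).
    rewrite mulr_suml; apply: ler_sum => i _; apply: le_trans (HD i x).
    rewrite normrM normrM (ger0_norm (_ : 0 <= (Num.sqrt i`!%:R)^-1)) ?invr_ge0//.
    by rewrite mulrAC ler_wpM2r ?invr_ge0// ler_wpM2l// -normcX.
  rewrite ler_wpM2r ?expR_ge0//.
  have := geometric_half 0 n (ltW D0); rewrite add0n big_mkord expr0 divr1 //.
have c0 : 0 < 4^-1 :> R by rewrite invr_gt0.
have [] := @Rint_dct R (fun n x => u x * h n x) (fun x => u x * p (bargmann_kernel x z))
  (fun x => `|u x * (2 * D * expR (- (4^-1 * x ^+ 2)))|).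
- by move=> n; apply: measurable_funM => //; exact: hu.1.
- apply: measurable_funM; first exact: hu.1.
  by apply: (measurable_fun_cvg mh) => x _; exact: hc.
- by apply: L1_norm; apply: L2r_mul => //; exact/L2rZ/L2r_gaussian.
- apply: aeW => x n; rewrite !(normrM (u x)) ler_wpM2l//.
  by apply: le_trans (hb n x) _; rewrite [leRHS]ger0_norm// mulr_ge0 ?expR_ge0// mulr_ge0// ltW.
- by apply: aeW => x; apply: cvgM; [exact: cvg_cst|exact: hc].
move=> _; suff -> : (fun n => \int[mu]_x (u x * h n x)) = (fun n =>
  p (\sum_(i < n) toC ((\int[mu]_x (u x * hermite_fun i x)) / Num.sqrt i`!%:R) * z ^+ i)) by [].
apply/funext => n; rewrite psum.
transitivity (\int[mu]_x (\sum_(i < n) p (z ^+ i) / Num.sqrt i`!%:R * (u x * hermite_fun i x))).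
  apply: eq_Rintegral => x _; rewrite hE mulr_sumr; apply: eq_bigr => i _; ring.
have uh i : L1 (fun x => u x * hermite_fun i x) by apply: L2r_mul => //; exact: L2r_hermite.
rewrite Rint_sum; last by move=> i; exact: L1Z.
by apply: eq_bigr => i _; rewrite pZ [LHS]RintegralZl//; [ring|exact: uh].
Qed.

Lemma rbargmann_unif (u : R -> R) : L2r u ->
  unif_sum (fun n => toC ((\int[mu]_x (u x * hermite_fun n x)) / Num.sqrt n`!%:R)) (rbargmann u).
Proof.
move=> hu; apply: unif_sumI => [rho rho0|z].
  have [D D0 HD] := hermite_fun_bound rho0.
  have c0 : 0 < 4^-1 :> R by rewrite invr_gt0.
  have ug : L1 (fun x => u x * expR (- (4^-1 * x ^+ 2))).
    by apply: L2r_mul => //; exact: L2r_gaussian.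
  exists (\int[mu]_x (D * `|u x * expR (- (4^-1 * x ^+ 2))|)).
    by apply: Rintegral_ge0 => x _; rewrite mulr_ge0 ?normr_ge0// ltW.
  move=> n; rewrite normc_toC normrM (ger0_norm (_ : 0 <= (Num.sqrt n`!%:R)^-1)) ?invr_ge0//.
  have uh : L1 (fun x => u x * hermite_fun n x) by apply: L2r_mul => //; exact: L2r_hermite.
  apply: le_trans (_ : (\int[mu]_x `|u x * hermite_fun n x|) * (rho ^+ n / Num.sqrt n`!%:R) <= _).
    rewrite -mulrA [_^-1 * _]mulrC ler_wpM2r ?divr_ge0 ?exprn_ge0//.
    exact: le_normr_Rintegral.
  rewrite mulrC [leRHS]mulrC -RintegralZl//; last exact: L1_norm.
  rewrite -RintegralZl//; last exact/L1Z/L1_norm.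
  apply: le_Rintegral => //; [exact/L1Z/L1_norm|exact/L1Z/L1Z/L1_norm|].
  move=> x _; rewrite !(normrM (u x)) (ger0_norm (expR_ge0 _)).
  have := ler_wpM2l (normr_ge0 (u x)) (HD n x).
  by congr (_ <= _); ring.
by split; apply: rbargmann_part => //;
  do ?[exact: ReDc|exact: ImDc|exact: Re_le_normc|exact: Im_le_normc|by move=> ? ? []];
  move=> a w; rewrite ?ReMc ?ImMc /= mul0r ?subr0 ?addr0.
Qed.

Lemma rbargmann_eq0 (u : R -> R) z : L2r u ->
  (forall n, \int[mu]_x (u x * hermite_fun n x) = 0) -> rbargmann u z = 0.
Proof.
move=> hu u0; apply: eq0_normc; apply/eqP; rewrite eq_le normc_ge0 andbT.
apply/ler_addgt0Pl => e e0; rewrite addr0.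
have [N /(_ N (leqnn _) z (lexx _))] := rbargmann_unif hu (normc z) e0.
by under eq_bigr do rewrite u0 mul0r mul0r; rewrite big1 ?subr0// => i _; rewrite rmorph0 mul0r.
Qed.

(** On the imaginary axis the Bargmann transform of u is the Fourier integral of u exp(-x^2 / 2), up
    to a nonzero factor; this opens the way to completeness. *)
Lemma bargmann_kernel_imag (x b : R) : bargmann_kernel x (Complex 0 b) =
  toC (pi `^ (- 4^-1) * expR (b ^+ 2 / 2)) *
  toC (expR (- (2^-1 * x ^+ 2))) * Complex (cos (x * (Num.sqrt 2 * b))) (sin (x * (Num.sqrt 2 * b))).
Proof.
rewrite /bargmann_kernel.
have -> : toC (Num.sqrt 2 * x) * Complex 0 b - 2^-1 * Complex 0 b ^+ 2 =
    Complex (b ^+ 2 / 2) (x * (Num.sqrt 2 * b)).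
  have -> : 2^-1 = toC 2^-1 by rewrite fmorphV rmorph_nat.
  by rewrite expr2; apply/eqP; rewrite eq_complex/=; apply/andP; split; apply/eqP; field.
by rewrite /cexp; apply/eqP; rewrite eq_complex/=; apply/andP; split; apply/eqP; ring.
Qed.

Lemma trig_int_eq0 (u : R -> R) xi th : L2r u ->
  (forall n, \int[mu]_x (u x * hermite_fun n x) = 0) ->
  trig_int (fun x => u x * expR (- (2^-1 * x ^+ 2))) xi th = 0.
Proof.
move=> hu u0; have c0 : 0 < 2^-1 :> R by rewrite invr_gt0.
have s2 : Num.sqrt 2 != 0 :> R by rewrite gt_eqF// sqrtr_gt0.
have v1 : L1 (fun x => u x * expR (- (2^-1 * x ^+ 2))).
  by apply: L2r_mul => //; exact: L2r_gaussian.
have k0 : pi `^ (- 4^-1) * expR ((xi / Num.sqrt 2) ^+ 2 / 2) != 0 :> R.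
  by rewrite mulf_neq0// gt_eqF ?expR_gt0// pi_pow_gt0.
have [E1 E2] : trig_int (fun x => u x * expR (- (2^-1 * x ^+ 2))) xi 0 = 0 /\
    trig_int (fun x => u x * expR (- (2^-1 * x ^+ 2))) xi (- (pi / 2)) = 0.
  have RI := rbargmann_eq0 (Complex 0 (xi / Num.sqrt 2)) hu u0.
  have e x : x * (Num.sqrt 2 * (xi / Num.sqrt 2)) = x * xi by field.
  have R0 : \int[mu]_x (u x * Re (bargmann_kernel x (Complex 0 (xi / Num.sqrt 2)))) = 0.
    exact: (congr1 Re RI).
  have I0 : \int[mu]_x (u x * Im (bargmann_kernel x (Complex 0 (xi / Num.sqrt 2)))) = 0.
    exact: (congr1 Im RI).
  split; apply: (mulfI k0); rewrite mulr0; [rewrite -[RHS]R0|rewrite -[RHS]I0];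
    rewrite /trig_int -RintegralZl//; try exact: L1_cos;
    apply: eq_Rintegral => x _; rewrite bargmann_kernel_imag e /=.
    by rewrite addr0; ring.
  by rewrite cosB cos_pihalf sin_pihalf; ring.
by rewrite trig_int_phase// E1 E2 !mulr0 subrr.
Qed.

Lemma measurable_gauss_comp d (T : measurableType d) (c : R) (g : T -> R) :
  measurable_fun setT g -> measurable_fun setT (fun x => expR (- (c * g x ^+ 2))).
Proof.
apply: (@measurableT_comp _ _ _ _ _ _ (fun y : R => expR (- (c * y ^+ 2)))).
by apply: continuous_measurable; exact: continuous_gaussian0.
Qed.

(** A Gaussian is itself the transform of a Gaussian, and Fubini's theorem turns the integral
    against it into one over transforms of v. *)
Lemma Rint_gauss_kernel_eq0 (v : R -> R) c t : 0 < c -> L1 v ->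
  (forall xi th, trig_int v xi th = 0) ->
  \int[mu]_x (v x * expR (- (c * (x - t) ^+ 2))) = 0.
Proof.
move=> c0 v1 v0.
have d0 : 0 < (4 * c)^-1 by rewrite invr_gt0 mulr_gt0.
have k0 : Num.sqrt (pi / (4 * c)^-1) != 0.
  by rewrite gt_eqF// sqrtr_gt0 divr_gt0// pi_gt0.
apply: (mulfI k0); rewrite mulr0 -RintegralZl//; last first.
  apply: (@L1_mulb _ 1) => //; first by apply: continuous_measurable; exact: continuous_quad_exp.
  by move=> x; rewrite ger0_norm ?expR_ge0// expR_le1 oppr_le0 mulr_ge0 ?sqr_ge0// ltW.
pose F (p : R * R) := v p.1 * (expR (- ((4 * c)^-1 * p.2 ^+ 2)) * cos (p.2 * (p.1 - t))).
transitivity (\int[mu]_x \int[mu]_xi F (x, xi)).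
  apply: eq_Rintegral => x _; rewrite /F/= RintegralZl//; last first.
    have := @L1_cos R _ (x - t) 0 (L1_gaussian0 d0).
    by under eq_fun do rewrite addr0.
  have := @trig_gaussian R _ (x - t) 0 d0.
  rewrite /trig_int; under eq_Rintegral do rewrite addr0.
  have -> : (4 * (4 * c)^-1)^-1 = c by field; rewrite gt_eqF.
  by move=> ->; rewrite cos0 mulr1 mulrCA.
rewrite (@Rint_fubini R F (fun x => `|v x|) (fun xi => expR (- ((4 * c)^-1 * xi ^+ 2)))).
- transitivity (\int[mu]_xi (0 : R)); last exact: Rint0.
  apply: eq_Rintegral => xi _; rewrite -(mulr0 (expR (- ((4 * c)^-1 * xi ^+ 2)))) -(v0 xi (- (xi * t))).
  rewrite /trig_int -RintegralZl//; last exact: L1_cos.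
  by apply: eq_Rintegral => x _; rewrite /F/= mulrBr [xi * x]mulrC mulrCA.
- apply: measurable_funM.
    by apply: (measurableT_comp (L1_measurable v1)); exact: measurable_fst.
  apply: measurable_funM.
    by apply: measurable_gauss_comp; exact: measurable_snd.
  apply: (@measurableT_comp _ _ _ _ _ _ (@cos R)).
    by apply: continuous_measurable; exact: continuous_cos.
  apply: measurable_funM; first exact: measurable_snd.
  by apply: measurable_funB => //; exact: measurable_fst.
- exact: L1_norm.
- exact: L1_gaussian0.
- move=> x y; rewrite /F/= normrM ler_wpM2l// normrM (ger0_norm (expR_ge0 _)).
  by rewrite ler_piMr ?expR_ge0// cos_abs_le1.
Qed.

Lemma indic_itv_dist (a d x t : R) : \1_`[a, d] x != \1_`[a, d] t :> R ->
  Num.min `|x - a| `|x - d| <= `|x - t|.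
Proof.
rewrite !indicE !mem_setE !in_itv/= ge_min.
case: (leP a x) => ax; case: (leP x d) => xd' /=; case: (leP a t) => at_;
  case: (leP t d) => td; rewrite /= ?eqxx// => _; apply/orP;
  try by [left; case: (ger0P (x - t)); case: (ger0P (x - a)); lra|
          right; case: (ger0P (x - t)); case: (ger0P (x - d)); lra].
Qed.

(** Where the indicator differs from its value at x, |x - t| is at least [de]. Half of the exponent
    yields the decay factor, and integrating the other half costs sqrt 2. *)
Lemma gauss_kernel_indicator (n : nat) (a d x : R) : x != a -> x != d ->
  `|Num.sqrt (pi / n.+1%:R) * \1_`[a, d] x -
    \int[mu]_t (\1_`[a, d] t * expR (- (n.+1%:R * (x - t) ^+ 2)))| <=
  Num.sqrt (pi / n.+1%:R) * (Num.sqrt 2 *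
    expR (- (Num.min `|x - a| `|x - d| ^+ 2 / 2)) ^+ n.+1).
Proof.
move=> xa xd; set m := n.+1%:R; set de := Num.min _ _.
have m0 : 0 < m :> R by rewrite ltr0n.
have m2 : 0 < m / 2 by rewrite divr_gt0.
have g1 : L1 (fun t => expR (- (m * (x - t) ^+ 2))).
  by under eq_fun => t do rewrite -sqrrN opprB; exact: L1_gaussian.
have i1 : L1 (fun t => \1_`[a, d] t * expR (- (m * (x - t) ^+ 2))).
  under eq_fun do rewrite mulrC; apply: (@L1_mulb _ 1) => //.
  by move=> t; rewrite indicE; case: (_ \in _); rewrite ?normr1 ?normr0.
rewrite -(Rint_gaussian x m0) mulrC.
under eq_Rintegral => t _ do rewrite -sqrrN opprB.
rewrite -RintegralZl// -RintegralB//; last exact: L1Z.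
under eq_Rintegral => t _ do rewrite -mulrBl.
have g2 : L1 (fun t => expR (- (m / 2 * (t - x) ^+ 2))) by exact: L1_gaussian.
have pt t : `|(\1_`[a, d] x - \1_`[a, d] t) * expR (- (m * (x - t) ^+ 2))| <=
    expR (- (de ^+ 2 / 2)) ^+ n.+1 * expR (- (m / 2 * (t - x) ^+ 2)).
  rewrite normrM (ger0_norm (expR_ge0 _)) -expRM_natl -expRD.
  have [->|ne] := eqVneq (\1_`[a, d] x) (\1_`[a, d] t : R).
    by rewrite subrr normr0 mul0r expR_ge0.
  apply: le_trans (_ : 1 * expR (- (m * (x - t) ^+ 2)) <= _).
    rewrite ler_wpM2r ?expR_ge0// !indicE.
    by case: (_ \in _); case: (_ \in _); rewrite ?subrr ?subr0 ?sub0r ?normrN ?normr1 ?normr0.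
  rewrite mul1r ler_expR.
  have h : de <= `|x - t| by exact: indic_itv_dist.
  have de0 : 0 <= de by rewrite /de le_min !normr_ge0.
  have : de ^+ 2 <= `|x - t| ^+ 2 by rewrite lerXn2r// nnegrE.
  rewrite real_normK ?num_real// => h2.
  have -> : m / 2 * (t - x) ^+ 2 = m * ((x - t) ^+ 2 / 2) by ring.
  rewrite -/m; have := ler_wpM2l (ltW m0) h2.
  set A := _ ^+ 2; set B := _ ^+ 2 => hAB; lra.
apply: le_trans (le_normr_Rintegral _ _) _ => //.
  by under eq_fun do rewrite mulrBl; apply: L1B => //; exact: L1Z.
apply: le_trans (_ : \int[mu]_t (expR (- (de ^+ 2 / 2)) ^+ n.+1 * expR (- (m / 2 * (t - x) ^+ 2))) <= _).
  apply: le_Rintegral => //; last exact: L1Z.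
  apply: L1_norm; under eq_fun do rewrite mulrBl.
  by apply: L1B => //; exact: L1Z.
rewrite RintegralZl// (Rint_gaussian x m2).
have -> : \int[mu]_t expR (- (m * (x - t) ^+ 2)) = Num.sqrt (pi / m).
  rewrite -(Rint_gaussian x m0); apply: eq_Rintegral => t _.
  by rewrite -[(x - t) ^+ 2]sqrrN opprB.
rewrite (_ : pi / (m / 2) = 2 * (pi / m)); last by field; rewrite gt_eqF.
rewrite sqrtrM//.
by rewrite le_eqVlt; apply/orP; left; apply/eqP; ring.
Qed.

(** By Fubini, v integrates to 0 against Gaussian smoothings of the indicator, which converge to it
    off the endpoints. The endpoints, where convergence may fail, form a null set. *)
Lemma Rint_itv_eq0 (v : R -> R) a d : L1 v ->
  (forall c t, 0 < c -> \int[mu]_x (v x * expR (- (c * (x - t) ^+ 2))) = 0) ->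
  \int[mu]_x (v x * \1_`[a, d] x) = 0.
Proof.
move=> v1 v0.
have i1 : L1 (\1_`[a, d] : R -> R).
  apply/integrableP; split; first exact: measurable_EFin.
  under eq_integral do rewrite /= ger0_norm//.
  have -> : (\int[mu]_x (\1_`[a, d] x)%:E = mu `[a, d]%classic)%E.
    by rewrite integral_indic// setIT.
  rewrite lebesgue_measure_itv/=.
  by case: ifP => _; rewrite ?ltry// -EFinB ltry.
pose k (n : nat) : R := (Num.sqrt (pi / n.+1%:R))^-1.
have k0 n : 0 < Num.sqrt (pi / n.+1%:R) :> R by rewrite sqrtr_gt0 divr_gt0// pi_gt0.
have le1 (n : nat) (y : R) : `|expR (- (n.+1%:R * y ^+ 2))| <= 1.
  by rewrite ger0_norm ?expR_ge0// expR_le1 oppr_le0 mulr_ge0 ?sqr_ge0.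
have ile1 (t : R) : `|\1_`[a, d] t : R| <= 1.
  by rewrite indicE; case: (_ \in _); rewrite ?normr1 ?normr0.
pose Phi n x := \int[mu]_t (\1_`[a, d] t * expR (- (n.+1%:R * (x - t) ^+ 2))).
pose F n (p : R * R) := v p.1 * (\1_`[a, d] p.2 * expR (- (n.+1%:R * (p.1 - p.2) ^+ 2))).
have mq n : measurable_fun setT (fun p : R * R => expR (- (n.+1%:R * (p.1 - p.2) ^+ 2))).
  by apply: measurable_gauss_comp; apply: measurable_funB; [exact: measurable_fst|exact: measurable_snd].
have mi2 : measurable_fun setT (fun p : R * R => \1_`[a, d] p.2 : R).
  by apply: (@measurableT_comp _ _ _ _ _ _ (\1_`[a, d] : R -> R)) => //; exact: measurable_snd.
have mF n : measurable_fun setT (F n).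
  apply: measurable_funM.
    by apply: (measurableT_comp (L1_measurable v1)); exact: measurable_fst.
  exact: measurable_funM.
have iPhi n x : L1 (fun t => \1_`[a, d] t * expR (- (n.+1%:R * (x - t) ^+ 2))).
  apply: (@L1_mulb _ 1) => //.
  by apply: (measurableT_comp (mq n) (measurable_pair1 x)).
have F0 n : \int[mu]_x (v x * Phi n x) = 0.
  transitivity (\int[mu]_x \int[mu]_t F n (x, t)).
    by apply: eq_Rintegral => x _; rewrite /Phi -RintegralZl//; exact: iPhi.
  rewrite (@Rint_fubini R (F n) (fun x => `|v x|) (fun t => `|\1_`[a, d] t|)) //.
  - transitivity (\int[mu]_xi (0 : R)); last exact: Rint0.
    apply: eq_Rintegral => t _; rewrite -(mulr0 (\1_`[a, d] t)) -(v0 n.+1%:R t)//.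
    rewrite -RintegralZl//; first by apply: eq_Rintegral => x _; rewrite /F/= mulrCA.
    apply: (@L1_mulb _ 1) => //.
    by apply: continuous_measurable; exact: continuous_quad_exp.
  - exact: L1_norm.
  - exact: L1_norm.
  - by move=> x y; rewrite /F/= !normrM ler_wpM2l// ler_piMr.
have mPhi n : measurable_fun setT (Phi n).
  (* The factor exp(-x^2) supplies the integrability in x that [L1_fubini_inner] asks for; it is
     divided out afterwards. *)
  pose G (p : R * R) := expR (- (1 * p.1 ^+ 2)) * (\1_`[a, d] p.2 * expR (- (n.+1%:R * (p.1 - p.2) ^+ 2))).
  have mG : measurable_fun setT G.
    apply: measurable_funM; last exact: measurable_funM.
    by apply: measurable_gauss_comp; exact: measurable_fst.
  have := @L1_fubini_inner R G (fun x => expR (- (1 * x ^+ 2))) (fun t => `|\1_`[a, d] t|) mG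
     (L1_gaussian0 ltr01) (L1_norm i1).
  move=> mI'; have mI : measurable_fun setT (fun x => \int[mu]_y G (x, y)).
    apply: mI' => x y.
    by rewrite /G/= !normrM ger0_norm ?expR_ge0// ler_wpM2l ?expR_ge0// ler_piMr.
    rewrite (_ : Phi n = fun x => expR (1 * x ^+ 2) * \int[mu]_t G (x, t)).
      apply: measurable_funM => //; apply: (measurableT_comp (@measurable_expR R)).
      by apply: measurable_funM => //; exact: measurable_funX.
    apply/funext => x; rewrite /G/= RintegralZl//; last exact: iPhi.
    by rewrite mulrA expRxMexpNx_1 mul1r.
have ebd x n : x != a -> x != d -> `|\1_`[a, d] x - k n * Phi n x| <=
    Num.sqrt 2 * expR (- (Num.min `|x - a| `|x - d| ^+ 2 / 2)) ^+ n.+1.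
  move=> xa xd; have := gauss_kernel_indicator n xa xd.
  rewrite -(ler_pM2l (_ : 0 < k n)); last by rewrite invr_gt0.
  rewrite -{1}[k n]ger0_norm; last by rewrite invr_ge0 ltW.
  by rewrite -normrM mulrBr !mulrA mulVf ?gt_eqF// !mul1r.
have aex : {ae mu, forall x, x != a /\ x != d}.
  have na y : mu.-negligible [set y].
    by apply/negligibleP => //; exact: lebesgue_measure_set1.
  have := negligibleU (na a) (na d).
  apply: negligibleS => x /= h.
  have [->|xa] := eqVneq x a; first by left.
  by have [->|xd] := eqVneq x d; [right|case: h].
have cv : \int[mu]_x (v x * (k n * Phi n x)) @[n --> \oo] --> \int[mu]_x (v x * \1_`[a, d] x).
  apply: (@Rint_dct R (fun n x => v x * (k n * Phi n x)) (fun x => v x * \1_`[a, d] x)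
     (fun x => (1 + Num.sqrt 2) * `|v x|) _ _ _ _ _).2.
  - by move=> n; apply: measurable_funM; [exact: L1_measurable|exact: measurable_funM].
  - by apply: measurable_funM; [exact: L1_measurable|].
  - exact/L1Z/L1_norm.
  - apply: ae_imp aex => x [xa xd] n; rewrite normrM mulrC ler_wpM2r//.
    have := ebd x n xa xd; rewrite distrC => h.
    rewrite -[_ * Phi _ _](subrK (\1_`[a, d] x)) addrC.
    apply: le_trans (ler_normD _ _) _; apply: lerD => //; apply: le_trans h _.
    by rewrite ler_piMr// exprn_ile1 ?expR_ge0// expR_le1 oppr_le0 mulr_ge0// ?sqr_ge0.
  - apply: ae_imp aex => x [xa xd]; apply: cvgM; first exact: cvg_cst.
    have de0 : 0 < Num.min `|x - a| `|x - d| by rewrite lt_min !normr_gt0 !subr_eq0 xa xd.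
    apply/cvgrPdist_le => e e0.
    have c0 : Num.sqrt 2 * expR (- (Num.min `|x - a| `|x - d| ^+ 2 / 2)) ^+ n.+1 @[n --> \oo] --> (0 : R).
      rewrite -(mulr0 (Num.sqrt 2)); apply: cvgM; first exact: cvg_cst.
      have := @cvg_expr R (expR (- (Num.min `|x - a| `|x - d| ^+ 2 / 2))).
      rewrite ger0_norm ?expR_ge0// expR_lt1 oppr_lt0 divr_gt0 ?exprn_gt0// => /(_ isT).
      by rewrite -(cvg_shiftS (fun n => expR _ ^+ n)).
    move/cvgrPdist_le : c0 => /(_ _ e0); apply: filterS => n; rewrite sub0r normrN.
    rewrite ger0_norm ?mulr_ge0 ?exprn_ge0 ?expR_ge0//.
    by apply: le_trans; exact: ebd.
have z n : \int[mu]_x (v x * (k n * Phi n x)) = 0.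
  rewrite -(mulr0 (k n)) -(F0 n) -RintegralZl//.
    by apply: eq_Rintegral => x _; rewrite mulrCA.
  apply: (@L1_mulb _ ((1 + Num.sqrt 2) / k n)) => // x.
  have kn : 0 < k n by rewrite invr_gt0.
  rewrite /Phi; apply: le_trans (le_normr_Rintegral _ _) _ => //; first exact: iPhi.
  apply: le_trans (_ : \int[mu]_t expR (- (n.+1%:R * (t - x) ^+ 2)) <= _).
    apply: le_Rintegral => //; [exact/L1_norm/iPhi|exact: L1_gaussian|].
    by move=> t _; rewrite normrM (ger0_norm (expR_ge0 _)) -sqrrN opprB ler_piMl ?expR_ge0.
  by rewrite Rint_gaussian// /k invrK ler_peMl ?sqrtr_ge0// lerDl sqrtr_ge0.
move: cv; under eq_fun do rewrite z.
by move/cvg_lim => <-//; rewrite lim_cst.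
Qed.

(** The integrals of v over all [-n, y] vanish, so Lebesgue differentiation in y gives v = 0 almost
    everywhere beyond -n. *)
Lemma L1_ae_eq0 (v : R -> R) : L1 v ->
  (forall c t, 0 < c -> \int[mu]_x (v x * expR (- (c * (x - t) ^+ 2))) = 0) ->
  {ae mu, forall x, v x = 0}.
Proof.
move=> v1 v0.
have iS (A : set R) : measurable A -> mu.-integrable A (EFin \o v).
  by move=> mA; exact: integrableS v1.
have locv : locally_integrable [set: R] v by apply: open_integrable_locally => //; exact: openT.
have H n : {ae mu, forall x, - n%:R < x -> v x = 0}.
  have := @FTC1 R v (BLeft (- n%:R)) (fun y => iS _ (measurable_itv _)) locv.
  apply: ae_imp => x + nx.
  move=> H; have [|_ <-] := H.
    by rewrite lte_fin.
  rewrite (_ : (fun _ => _) = cst 0) ?derive1_cst//.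
  apply/funext => y; rewrite Rintegral_mkcond -[RHS](Rint_itv_eq0 (- n%:R) y v1 v0).
  by apply: eq_Rintegral => t _; rewrite patchE indicE; case: ifPn => _; rewrite ?mulr1 ?mulr0.
have : {ae mu, forall x, forall n, - n%:R < x -> v x = 0} by apply/ae_foralln.
apply: ae_imp => x /(_ (Num.trunc `|x|).+1); apply.
rewrite ltrNl; apply: le_lt_trans (ler_norm _) _; rewrite normrN.
exact: truncnS_gt.
Qed.

(** Zero coefficients make the Bargmann transform vanish, hence the Fourier integrals of u exp(-x^2
    / 2), hence this function; and the Gaussian has no zeros. *)
Lemma hermite_complete (u : R -> R) : L2r u ->
  (forall n, \int[mu]_x (u x * hermite_fun n x) = 0) -> {ae mu, forall x, u x = 0}.
Proof.
move=> hu u0.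
have v1 : L1 (fun x => u x * expR (- (2^-1 * x ^+ 2))).
  by apply: L2r_mul => //; apply: L2r_gaussian; rewrite invr_gt0.
have := L1_ae_eq0 v1 (fun c t c0 => Rint_gauss_kernel_eq0 t c0 v1 (fun xi th => trig_int_eq0 xi th hu u0)).
apply: ae_imp => x /eqP; rewrite mulf_eq0 => /orP[/eqP//|].
by rewrite gt_eqF ?expR_gt0.
Qed.

End completeness.

(** * Plancherel inequality and the Fourier transform *)

Section bessel.
Context {R : realType}.
Local Notation mu := (@lebesgue_measure R).

Lemma L1_fubini_int (F : R * R -> R) (a b : R -> R) :
  measurable_fun setT F -> L1 a -> L1 b ->
  (forall x y, `|F (x, y)| <= a x * b y) -> L1 (fun x => \int[mu]_y F (x, y)).
Proof.
move=> mF a1 b1 Fab.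
apply: (@L1_le _ (fun x => a x * \int[mu]_y b y)).
- exact: L1_fubini_inner Fab.
- move=> x; have F1 : L1 (fun y => F (x, y)).
    apply: (L1_le _ (Fab x)); last exact: L1Z.
    exact: (measurableT_comp mF (measurable_pair1 x)).
  apply: le_trans (le_normr_Rintegral _ _) _ => //.
  rewrite -RintegralZl//; apply: le_Rintegral => //; [exact: L1_norm|exact: L1Z].
- by under eq_fun do rewrite mulrC; exact: L1Z.
Qed.

Lemma measurable_cos_comp d (T : measurableType d) (g : T -> R) :
  measurable_fun setT g -> measurable_fun setT (fun x => cos (g x)).
Proof.
apply: (@measurableT_comp _ _ _ _ _ _ (@cos R)).
by apply: continuous_measurable; exact: continuous_cos.
Qed.

Lemma measurable_trig_int (v : R -> R) th : L1 v ->
  measurable_fun setT (fun xi => trig_int v xi th).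
Proof.
move=> v1; have c0 : 0 < 1 :> R by [].
(* The Gaussian in xi makes the integrand absolutely integrable on the plane; it is divided out
   afterwards. *)
pose F (p : R * R) := expR (- (1 * p.1 ^+ 2)) * (v p.2 * cos (p.2 * p.1 + th)).
have mF : measurable_fun setT F.
  apply: measurable_funM.
    by apply: measurable_gauss_comp; exact: measurable_fst.
  apply: measurable_funM.
    by apply: (measurableT_comp (L1_measurable v1)); exact: measurable_snd.
  apply: measurable_cos_comp; apply: measurable_funD => //.
  by apply: measurable_funM; [exact: measurable_snd|exact: measurable_fst].
rewrite (_ : (fun _ => _) = fun xi => expR (1 * xi ^+ 2) * \int[mu]_x F (xi, x)).
  apply: measurable_funM.
    apply: (measurableT_comp (@measurable_expR R)).
    by apply: measurable_funM => //; exact: measurable_funX.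
  apply: (@L1_fubini_inner R F (fun x => expR (- (1 * x ^+ 2))) (fun x => `|v x|) mF).
  - exact: L1_gaussian0.
  - exact: L1_norm.
  - move=> x y; rewrite /F/= normrM (ger0_norm (expR_ge0 _)) ler_wpM2l ?expR_ge0//.
    by rewrite normrM ler_piMr// cos_abs_le1.
apply/funext => xi; rewrite /F/= RintegralZl//; last exact: L1_cos.
by rewrite mulrA expRxMexpNx_1 mul1r.
Qed.

(** The squared modulus of the unnormalised Fourier integral of a real [v]. *)
Definition trig_energy (v : R -> R) (xi : R) :=
  trig_int v xi 0 ^+ 2 + trig_int v xi (- (pi / 2)) ^+ 2.

Lemma measurable_trig_energy v : L1 v -> measurable_fun setT (trig_energy v).
Proof.
by move=> v1; apply: measurable_funD; apply: measurable_funX; exact: measurable_trig_int.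
Qed.

Lemma trig_energy_ge0 v xi : 0 <= trig_energy v xi.
Proof. by rewrite addr_ge0 ?sqr_ge0. Qed.

Lemma trig_int_phaseN (v : R -> R) xi th : L1 v ->
  trig_int v xi (- th) = cos th * trig_int v xi 0 + cos (th - pi / 2) * trig_int v xi (- (pi / 2)).
Proof.
by move=> v1; rewrite trig_int_phase// cosN sinN mulNr opprK cosB cos_pihalf sin_pihalf mulr0 add0r mulr1.
Qed.

Lemma trig_energyE (v : R -> R) xi : L1 v ->
  trig_energy v xi = \int[mu]_x (v x * trig_int v xi (- (x * xi))).
Proof.
move=> v1; rewrite /trig_energy.
transitivity (\int[mu]_x (trig_int v xi 0 * (v x * cos (x * xi + 0)) +
   trig_int v xi (- (pi / 2)) * (v x * cos (x * xi + - (pi / 2))))).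
  rewrite RintegralD//; try by apply: L1Z; exact: L1_cos.
  by rewrite !RintegralZl//; exact: L1_cos.
by apply: eq_Rintegral => x _; rewrite (trig_int_phaseN _ (x * xi))// (addr0 (x * xi)); ring.
Qed.

(* Inserting the factor exp (- e xi^2) makes the integral over xi absolutely convergent;
   for e -> 0 this yields the inequality half of Plancherel's theorem. *)
Lemma trig_energy_gauss (v : R -> R) e : L1 v -> 0 < e ->
  \int[mu]_xi (expR (- (e * xi ^+ 2)) * trig_energy v xi) =
  \int[mu]_x (v x * \int[mu]_y (v y *
     (Num.sqrt (pi / e) * expR (- ((4 * e)^-1 * (y - x) ^+ 2))))).
Proof.
move=> v1 e0; pose N := \int[mu]_x `|v x|.
have mv1 : measurable_fun setT (fun p : R * R => v p.1).
  by apply: (measurableT_comp (L1_measurable v1)); exact: measurable_fst.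
have mv2 : measurable_fun setT (fun p : R * R => v p.2).
  by apply: (measurableT_comp (L1_measurable v1)); exact: measurable_snd.
pose F (p : R * R) := expR (- (e * p.1 ^+ 2)) * (v p.2 * trig_int v p.1 (- (p.2 * p.1))).
have mF : measurable_fun setT F.
  apply: measurable_funM.
    by apply: measurable_gauss_comp; exact: measurable_fst.
  apply: measurable_funM => //.
  rewrite (_ : (fun _ => _) = fun p : R * R => cos (p.2 * p.1) * trig_int v p.1 0 +
    cos (p.2 * p.1 - pi / 2) * trig_int v p.1 (- (pi / 2))); last first.
    by apply/funext => p; rewrite trig_int_phaseN.
  have mm : measurable_fun setT (fun p : R * R => p.2 * p.1).
    by apply: measurable_funM; [exact: measurable_snd|exact: measurable_fst].
  have mt th : measurable_fun setT (fun p : R * R => trig_int v p.1 th).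
    by apply: (measurableT_comp (measurable_trig_int th v1)); exact: measurable_fst.
  by apply: measurable_funD; apply: measurable_funM => //; apply: measurable_cos_comp => //;
    exact: measurable_funB.
transitivity (\int[mu]_xi \int[mu]_x F (xi, x)).
  apply: eq_Rintegral => xi _; rewrite trig_energyE// -RintegralZl//.
  apply: (@L1_mulb _ N) => // [|x]; last exact: le_trig_int.
  rewrite (_ : (fun _ => _) = fun x => cos (x * xi) * trig_int v xi 0 +
      cos (x * xi - pi / 2) * trig_int v xi (- (pi / 2))); last first.
    by apply/funext => x; rewrite trig_int_phaseN.
  by apply: measurable_funD; apply: measurable_funM => //; apply: measurable_cos_comp => //;
    [|apply: measurable_funB => //]; exact: measurable_funM.
rewrite (@Rint_fubini R F (fun xi => expR (- (e * xi ^+ 2))) (fun x => `|v x| * N) mF).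
- apply: eq_Rintegral => x _.
  pose H (p : R * R) := expR (- (e * p.1 ^+ 2)) * (v p.2 * cos (p.2 * p.1 - x * p.1)).
  have mH : measurable_fun setT H.
    apply: measurable_funM.
      by apply: measurable_gauss_comp; exact: measurable_fst.
    apply: measurable_funM => //; apply: measurable_cos_comp; apply: measurable_funB.
      by apply: measurable_funM; [exact: measurable_snd|exact: measurable_fst].
    by apply: measurable_funM => //; exact: measurable_fst.
  have leH xi y : `|H (xi, y)| <= expR (- (e * xi ^+ 2)) * `|v y|.
    rewrite /H/= normrM (ger0_norm (expR_ge0 _)) ler_wpM2l ?expR_ge0//.
    by rewrite normrM ler_piMr// cos_abs_le1.
  transitivity (v x * \int[mu]_xi \int[mu]_y H (xi, y)).
    rewrite -RintegralZl//.
      apply: eq_Rintegral => xi _; rewrite /F/H/= mulrCA; congr (_ * _).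
      by rewrite /trig_int -RintegralZl//; exact: L1_cos.
    exact: (L1_fubini_int mH (L1_gaussian0 e0) (L1_norm v1) leH).
  congr (_ * _).
  rewrite (Rint_fubini mH (L1_gaussian0 e0) (L1_norm v1) leH).
  apply: eq_Rintegral => y _; rewrite /H/=.
  transitivity (v y * trig_int (fun xi => expR (- (e * xi ^+ 2))) (y - x) 0).
    rewrite /trig_int -RintegralZl//; last by apply: L1_cos; exact: L1_gaussian0.
    apply: eq_Rintegral => xi _; rewrite mulrCA; congr (_ * (_ * cos _)); ring.
  by rewrite trig_gaussian// cos0 mulr1.
- exact: L1_gaussian0.
- by under eq_fun do rewrite mulrC; apply: L1Z; exact: L1_norm.
- move=> x y; rewrite /F/= normrM (ger0_norm (expR_ge0 _)) ler_wpM2l ?expR_ge0//.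
  by rewrite normrM ler_wpM2l// le_trig_int.
Qed.

(** Schur's test: v(x) v(y) <= (v(x)^2 + v(y)^2) / 2, and the kernel has total mass sqrt(pi / e)
    sqrt(4 pi e) = 2 pi for every e. The Gaussian decay of [v] provides the product majorants for
    Fubini. *)
Lemma trig_energy_gauss_le (v : R -> R) K c e : measurable_fun setT v -> 0 < c -> 0 < e ->
  {ae mu, forall x, `|v x| <= K * expR (- (c * x ^+ 2))} ->
  \int[mu]_xi (expR (- (e * xi ^+ 2)) * trig_energy v xi) <= 2 * pi * \int[mu]_x (v x ^+ 2).
Proof.
move=> mv c0 e0 vK.
have [v1 v2] := L2r_gauss c0 mv vK.
rewrite trig_energy_gauss//.
set k0 := Num.sqrt (pi / e); set q := (4 * e)^-1.
have k00 : 0 <= k0 by exact: sqrtr_ge0.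
have q0 : 0 < q by rewrite invr_gt0 mulr_gt0.
have le1 (t : R) : `|k0 * expR (- (q * t ^+ 2))| <= k0.
  rewrite ger0_norm ?mulr_ge0 ?expR_ge0// ler_piMr// expR_le1 oppr_le0.
  by rewrite mulr_ge0 ?sqr_ge0 ?(ltW q0).
have mv1 : measurable_fun setT (fun p : R * R => v p.1).
  by apply: (measurableT_comp mv); exact: measurable_fst.
have mv2 : measurable_fun setT (fun p : R * R => v p.2).
  by apply: (measurableT_comp mv); exact: measurable_snd.
have mk : measurable_fun setT (fun p : R * R => k0 * expR (- (q * (p.2 - p.1) ^+ 2))).
  apply: measurable_funM => //; apply: measurable_gauss_comp.
  by apply: measurable_funB; [exact: measurable_snd|exact: measurable_fst].
pose H (p : R * R) := v p.1 * (v p.2 * (k0 * expR (- (q * (p.2 - p.1) ^+ 2)))).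
pose G (p : R * R) := v p.1 ^+ 2 * (k0 * expR (- (q * (p.2 - p.1) ^+ 2))).
pose G' (p : R * R) := v p.2 ^+ 2 * (k0 * expR (- (q * (p.2 - p.1) ^+ 2))).
(* (2 x - y)^2 >= 0 gives (y - x)^2 >= y^2 / 2 - x^2, so the kernel is dominated by a multiple of
   exp(de x^2) exp(-de y^2 / 2); [de <= c] keeps v^2 exp(de x^2) integrable. *)
pose de := Num.min q c.
have de0 : 0 < de by rewrite lt_min q0.
pose a x := v x ^+ 2 * (k0 * expR (de * x ^+ 2)).
pose b (y : R) := expR (- (de / 2 * y ^+ 2)).
have a1 : L1 a.
  have ma : measurable_fun setT a.
    apply: measurable_funM; first exact: measurable_funX.
    apply: measurable_funM => //; apply: (measurableT_comp (@measurable_expR R)).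
    by apply: measurable_funM => //; exact: measurable_funX.
  apply: (L1_ae_le ma (_ : {ae mu, forall x, `|a x| <= K ^+ 2 * k0 * expR (- (c * x ^+ 2))})).
    apply: ae_imp vK => x vx; rewrite /a normrM normrX [`|k0 * _|]ger0_norm ?mulr_ge0 ?expR_ge0//.
    apply: le_trans (_ : (K * expR (- (c * x ^+ 2))) ^+ 2 * (k0 * expR (c * x ^+ 2)) <= _).
      apply: ler_pM; rewrite ?exprn_ge0 ?mulr_ge0 ?expR_ge0//.
      - by rewrite lerXn2r ?nnegrE// (le_trans _ vx).
      - rewrite ler_wpM2l// ler_expR ler_wpM2r ?sqr_ge0//.
        by rewrite /de ge_min lexx orbT.
    rewrite exprMn [expR _ ^+ 2]expr2.
    rewrite [leLHS](_ : _ = K ^+ 2 * k0 * expR (- (c * x ^+ 2)) *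
       (expR (c * x ^+ 2) * expR (- (c * x ^+ 2)))); last by ring.
    by rewrite expRxMexpNx_1 mulr1.
  by apply: L1Z; exact: L1_gaussian0.
have b1 : L1 b by apply: L1_gaussian0; rewrite divr_gt0.
have kab x y : k0 * expR (- (q * (y - x) ^+ 2)) <= k0 * expR (de * x ^+ 2) * b y.
  rewrite -mulrA ler_wpM2l// /b -expRD ler_expR.
  have h1 : de * (y - x) ^+ 2 <= q * (y - x) ^+ 2.
    by rewrite ler_wpM2r ?sqr_ge0// /de ge_min lexx.
  have h2 : 0 <= de * (2 * x - y) ^+ 2 by rewrite mulr_ge0 ?sqr_ge0 ?(ltW de0).
  nra.
have Gab x y : `|G (x, y)| <= a x * b y.
  rewrite ger0_norm; last by rewrite /G/= mulr_ge0 ?sqr_ge0 ?mulr_ge0 ?expR_ge0.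
  rewrite [leRHS](_ : _ = v x ^+ 2 * (k0 * expR (de * x ^+ 2) * b y)); last by rewrite /a; ring.
  by rewrite /G/= ler_wpM2l ?sqr_ge0//; exact: kab.
have Gab' x y : `|G' (x, y)| <= b x * a y.
  rewrite mulrC; have := Gab y x; rewrite /G/G'/=.
  by rewrite -[(y - x) ^+ 2]sqrrN opprB.
have mG : measurable_fun setT G.
  by apply: measurable_funM => //; exact: measurable_funX.
have mG' : measurable_fun setT G'.
  by apply: measurable_funM => //; exact: measurable_funX.
have mH : measurable_fun setT H.
  by apply: measurable_funM => //; exact: measurable_funM.
have LG := L1_fubini_int mG a1 b1 Gab.
have LG' := L1_fubini_int mG' b1 a1 Gab'.
have LH : L1 (fun x => \int[mu]_y H (x, y)).
  apply: (@L1_fubini_int H (fun x => `|v x|) (fun y => k0 * `|v y|) mH (L1_norm v1)).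
    exact/L1Z/L1_norm.
  by move=> x y; rewrite /H/= !(normrM (v _)) ler_wpM2l// mulrC ler_wpM2r.
have secG x : L1 (fun y => G (x, y)).
  apply: (L1_le _ (Gab x)); last exact: L1Z.
  exact: (measurableT_comp mG (measurable_pair1 x)).
have secG' x : L1 (fun y => G' (x, y)).
  apply: (L1_le _ (Gab' x)); last exact: L1Z.
  exact: (measurableT_comp mG' (measurable_pair1 x)).
have secV x : L1 (fun y => v y * (k0 * expR (- (q * (y - x) ^+ 2)))).
  apply: (@L1_mulb _ k0) => //.
  exact: (measurableT_comp mk (measurable_pair1 x)).
have secH x : L1 (fun y => H (x, y)).
  by rewrite /H/=; apply: L1Z; exact: secV.
have IG : \int[mu]_x \int[mu]_y G (x, y) = 2 * pi * \int[mu]_x (v x ^+ 2).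
  rewrite -RintegralZl//; last exact: v2.2.
  apply: eq_Rintegral => x _; rewrite /G/= RintegralZl//; last by apply: L1Z; exact: L1_gaussian.
  rewrite RintegralZl//; last exact: L1_gaussian.
  rewrite Rint_gaussian// mulrC /k0 -sqrtrM ?divr_ge0 ?pi_ge0 ?(ltW e0)//.
  rewrite (_ : pi / e * (pi / q) = (2 * pi) ^+ 2); first by rewrite sqrtr_sqr ger0_norm// mulr_ge0// pi_ge0.
  by rewrite /q; field; rewrite gt_eqF.
have IG' : \int[mu]_x \int[mu]_y G' (x, y) = 2 * pi * \int[mu]_x (v x ^+ 2).
  rewrite (@Rint_fubini R G' b a mG' b1 a1 Gab') -IG.
  apply: eq_Rintegral => y _; apply: eq_Rintegral => x _; rewrite /G/G'/=.
  by rewrite -[(y - x) ^+ 2]sqrrN opprB.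
have -> : \int[mu]_x (v x * \int[mu]_y (v y * (k0 * expR (- (q * (y - x) ^+ 2))))) =
    \int[mu]_x \int[mu]_y H (x, y).
  apply: eq_Rintegral => x _; rewrite /H/= RintegralZl//; exact: secV.
apply: le_trans (_ : \int[mu]_x (2^-1 * \int[mu]_y G (x, y) + 2^-1 * \int[mu]_y G' (x, y)) <= _).
  apply: le_Rintegral => //; first by apply: L1D; exact: L1Z.
  move=> x _; rewrite -(RintegralZl _ measurableT (secG x)) -(RintegralZl _ measurableT (secG' x)).
  rewrite -RintegralD//; try exact: L1Z.
  apply: le_Rintegral => //; [exact: secH|by apply: L1D; exact: L1Z|].
  move=> y _; rewrite /H/G/G'/=; set k := k0 * _.
  have kk : 0 <= k by rewrite mulr_ge0 ?expR_ge0.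
  rewrite -subr_ge0 (_ : _ - _ = 2^-1 * k * (v x - v y) ^+ 2); last by field.
  by apply: mulr_ge0; rewrite ?sqr_ge0// mulr_ge0.
rewrite RintegralD//; try exact: L1Z.
rewrite !RintegralZl// IG IG' le_eqVlt; apply/orP; left; apply/eqP; by field.
Qed.

(** Monotone convergence as the regularising factor increases to 1. The integral is extended real
    because its finiteness is part of the claim. *)
Lemma trig_energy_le (v : R -> R) K c : measurable_fun setT v -> 0 < c ->
  {ae mu, forall x, `|v x| <= K * expR (- (c * x ^+ 2))} ->
  (\int[mu]_xi (trig_energy v xi)%:E <= (2 * pi * \int[mu]_x (v x ^+ 2))%:E)%E.
Proof.
move=> mv c0 vK; have [v1 v2] := L2r_gauss c0 mv vK.
pose g (n : nat) (xi : R) := expR (- ((n.+1%:R)^-1 * xi ^+ 2)) * trig_energy v xi.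
have n0 (n : nat) : 0 < n.+1%:R^-1 :> R by rewrite invr_gt0.
have mg n : measurable_fun setT (g n).
  apply: measurable_funM; last exact: measurable_trig_energy.
  exact: measurable_gauss_comp.
pose N := \int[mu]_x `|v x|.
have eb xi : trig_energy v xi <= 2 * N ^+ 2.
  have h th : trig_int v xi th ^+ 2 <= N ^+ 2.
    rewrite -(real_normK (num_real (trig_int v xi th))) lerXn2r ?nnegrE//.
      by apply: Rintegral_ge0.
    exact: le_trig_int.
  by rewrite mulr_natl mulr2n lerD.
have g1 n : L1 (g n).
  apply: (@L1_le _ (fun xi => 2 * N ^+ 2 * expR (- ((n.+1%:R)^-1 * xi ^+ 2)))) => //.
    move=> xi; rewrite /g ger0_norm ?mulr_ge0 ?expR_ge0 ?trig_energy_ge0//.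
    by rewrite mulrC ler_wpM2r ?expR_ge0.
  by apply: L1Z; exact: L1_gaussian0.
have gc xi : (g n xi)%:E @[n --> \oo] --> (trig_energy v xi)%:E.
  apply: cvg_EFin; first exact: nearW.
  have e : expR (- ((n.+1%:R)^-1 * xi ^+ 2)) @[n --> \oo] --> expR (- (0 * xi ^+ 2)).
    apply: (@continuous_cvg _ _ _ _ _ _ expR); first exact: continuous_expR.
    apply: cvgN; apply: cvgM; last exact: cvg_cst.
    exact: cvg_harmonic.
  rewrite mul0r oppr0 expR0 in e.
  by rewrite /= -[X in _ --> X]mul1r; apply: cvgM; [exact: e|exact: cvg_cst].
have nd xi : {homo (fun n => (g n xi)%:E) : n m / (n <= m)%N >-> (n <= m)%E}.
  move=> n m nm; rewrite lee_fin ler_wpM2r ?trig_energy_ge0// ler_expR lerN2.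
  by rewrite ler_wpM2r ?sqr_ge0// lef_pV2 ?posrE ?ltr0n// ler_nat.
have g0 n xi : (0 <= (g n xi)%:E)%E by rewrite lee_fin mulr_ge0 ?expR_ge0 ?trig_energy_ge0.
have := @cvg_monotone_convergence _ _ R mu setT measurableT (fun n xi => (g n xi)%:E)
  (fun n => measurable_EFin (mg n)) (fun n xi _ => g0 n xi) (fun xi _ => nd xi).
rewrite [X in _ --> X](_ : _ = \int[mu]_xi (trig_energy v xi)%:E)%E; last first.
  by apply: eq_integral => xi _; apply/cvg_lim => //; exact: gc.
move=> cv; rewrite -(cvg_lim _ cv)//; apply: lime_le; first by apply/cvg_ex; eexists; exact: cv.
apply: nearW => n; rewrite Rint_fin// lee_fin.
exact: trig_energy_gauss_le vK.
Qed.

End bessel.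

(** * The L^2 Fourier transform on functions of Gaussian decay *)

Section fourier_transform.
Context {R : realType}.
Local Notation mu := (@lebesgue_measure R).
Local Notation C := R[i].
Local Notation Re := (@complex.Re R).
Local Notation Im := (@complex.Im R).
Local Notation toC := (real_complex R).

Lemma Lfun2P (u : R -> R) : u \in Lfun mu 2%:E <-> L2r u.
Proof.
split=> [u2|[mu1 /integrableP[_ u2]]].
  split; last exact: Lfun2_integrable_sqr.
  by move: u2; rewrite inE => /andP[]; rewrite inE.
rewrite inE; apply/andP; split; rewrite inE//=.
rewrite /finite_norm unlock /Lnorm; apply: poweR_lty.
apply: le_lt_trans u2; rewrite le_eqVlt; apply/orP; left; apply/eqP.
apply: eq_integral => x _; rewrite !abse_EFin poweR_EFin; congr EFin.
by rewrite powR_mulrn// normrX.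
Qed.

Lemma L2normE (g : R -> C) : L2norm g = ((\int[mu]_x (normc (g x) ^+ 2)%:E) `^ 2^-1)%E.
Proof.
rewrite /L2norm unlock /Lnorm; congr (_ `^ _)%E; apply: eq_integral => x _ /=.
by rewrite powR_mulrn// ger0_norm ?normc_ge0.
Qed.

Lemma L2norm_le (g : R -> C) (e : R) : 0 <= e ->
  (\int[mu]_x (normc (g x) ^+ 2)%:E <= (e ^+ 2)%:E)%E <-> (L2norm g <= e%:E)%E.
Proof.
move=> e0; have i0 : (0 <= \int[mu]_x (normc (g x) ^+ 2)%:E)%E.
  by apply: integral_ge0 => x _; rewrite lee_fin sqr_ge0.
have ee : (((e ^+ 2)%:E : \bar R) `^ 2^-1 = e%:E)%E.
  by rewrite poweR_EFin powR12_sqrt ?sqr_ge0// sqrtr_sqr ger0_norm.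
rewrite L2normE -ee; split=> h.
  by apply: gt0_ler_poweR => //; rewrite in_itv/= leey ?lee_fin ?sqr_ge0 ?i0.
have := @gt0_ler_poweR R 2 (ler0n _ _) _ _ _ _ h.
rewrite -!poweRrM mulVf// !poweRe1 ?lee_fin ?sqr_ge0//; apply.
- by rewrite in_itv/= leey poweR_ge0.
- by rewrite ee in_itv/= leey lee_fin e0.
Qed.

(** Any rate c > 0 gives absolutely convergent Fourier integrals and the L^2 bound, and the class is
    stable under truncation. *)
Definition gauss_decay (v : R -> R) := measurable_fun setT v /\
  exists K c, 0 < c /\ {ae mu, forall x, `|v x| <= K * expR (- (c * x ^+ 2))}.

Lemma gauss_decay_L1 v : gauss_decay v -> L1 v.
Proof. by case=> mv [K [c [c0 vK]]]; have [] := L2r_gauss c0 mv vK. Qed.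

Lemma gauss_decay_L2 v : gauss_decay v -> L2r v.
Proof. by case=> mv [K [c [c0 vK]]]; have [] := L2r_gauss c0 mv vK. Qed.

Lemma gauss_decay_mul (v w : R -> R) : gauss_decay v -> measurable_fun setT w ->
  (forall x, `|w x| <= 1) -> gauss_decay (fun x => v x * w x).
Proof.
case=> mv [K [c [c0 vK]]] mw w1; split; first exact: measurable_funM.
exists K, c; split => //; apply: ae_imp vK => x; apply: le_trans.
by rewrite normrM ler_piMr.
Qed.

Lemma L1_trig_energy v : gauss_decay v -> L1 (trig_energy v).
Proof.
move=> dv; have v1 := gauss_decay_L1 dv; case: dv => mv [K [c [c0 vK]]].
apply/integrableP; split; first by apply: measurable_EFin; exact: measurable_trig_energy.
under eq_integral do rewrite /= ger0_norm ?trig_energy_ge0//.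
by apply: le_lt_trans (trig_energy_le mv c0 vK) _; exact: ltry.
Qed.

Lemma Rint_trig_energy_le v : gauss_decay v ->
  \int[mu]_xi trig_energy v xi <= 2 * pi * \int[mu]_x (v x ^+ 2).
Proof.
move=> dv; rewrite -lee_fin -Rint_fin; last exact: L1_trig_energy.
by case: dv => mv [K [c [c0 vK]]]; exact: trig_energy_le vK.
Qed.

(* The absolutely convergent Fourier integral of v + i w. *)
Definition fhat (v w : R -> R) (xi : R) : C :=
  toC (Num.sqrt (2 * pi))^-1 *
  Complex (trig_int v xi 0 + trig_int w xi (- (pi / 2)))
          (trig_int w xi 0 - trig_int v xi (- (pi / 2))).

Lemma normc_fhat_sqr_le v w xi : normc (fhat v w xi) ^+ 2 <=
  pi^-1 * (trig_energy v xi + trig_energy w xi).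
Proof.
have p0 : 0 < pi :> R := pi_gt0 R.
rewrite /fhat normcM exprMn normc_toC real_normK ?num_real// exprVn sqr_sqrtr ?mulr_ge0 ?pi_ge0//.
rewrite normc_sqr/= /trig_energy invfM [2^-1 * _]mulrC -mulrA ler_pM2l ?invr_gt0//.
set a := trig_int v _ _; set b := trig_int w _ _; set d := trig_int w _ _; set e := trig_int v _ _.
have := sqr_ge0 (a - b); have := sqr_ge0 (d + e); lra.
Qed.

Lemma measurable_fhat v w : L1 v -> L1 w ->
  measurable_fun setT (fun xi => Re (fhat v w xi)) /\ measurable_fun setT (fun xi => Im (fhat v w xi)).
Proof.
move=> v1 w1; have m u th : L1 u -> measurable_fun setT (fun xi => trig_int u xi th).
  exact: measurable_trig_int.
rewrite /fhat; split.
  under eq_fun do rewrite ReMc /= mul0r subr0.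
  by apply: measurable_funM => //; apply: measurable_funD; exact: m.
under eq_fun do rewrite ImMc /= mul0r addr0.
by apply: measurable_funM => //; apply: measurable_funB; exact: m.
Qed.

Lemma normc_sqr_ge_Re (z : C) : Re z ^+ 2 <= normc z ^+ 2.
Proof. by rewrite normc_sqr lerDl sqr_ge0. Qed.

Lemma normc_sqr_ge_Im (z : C) : Im z ^+ 2 <= normc z ^+ 2.
Proof. by rewrite normc_sqr lerDr sqr_ge0. Qed.

Lemma L2_fhat v w : gauss_decay v -> gauss_decay w -> L2 (fhat v w).
Proof.
move=> dv dw; have [m1 m2] := measurable_fhat (gauss_decay_L1 dv) (gauss_decay_L1 dw).
have E : L1 (fun xi => pi^-1 * (trig_energy v xi + trig_energy w xi)).
  by apply/L1Z/L1D; exact: L1_trig_energy.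
split; apply/Lfun2P; split => //.
  apply: (L1_le _ _ E); first exact: measurable_funX.
  move=> xi; rewrite ger0_norm ?sqr_ge0//; apply: le_trans (normc_sqr_ge_Re _) _.
  exact: normc_fhat_sqr_le.
apply: (L1_le _ _ E); first exact: measurable_funX.
move=> xi; rewrite ger0_norm ?sqr_ge0//; apply: le_trans (normc_sqr_ge_Im _) _.
exact: normc_fhat_sqr_le.
Qed.

(** The constant is 2 where Plancherel's theorem has 1, because real and imaginary parts are
    estimated apart; this is harmless, as only a convergence to 0 is drawn from it. *)
Lemma int_normc_fhat_le v w : gauss_decay v -> gauss_decay w ->
  (\int[mu]_xi (normc (fhat v w xi) ^+ 2)%:E <=
    (2 * (\int[mu]_x (v x ^+ 2) + \int[mu]_x (w x ^+ 2)))%:E)%E.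
Proof.
move=> dv dw; have [m1 m2] := measurable_fhat (gauss_decay_L1 dv) (gauss_decay_L1 dw).
have E : L1 (fun xi => pi^-1 * (trig_energy v xi + trig_energy w xi)).
  by apply/L1Z/L1D; exact: L1_trig_energy.
apply: le_trans (_ : (\int[mu]_xi (pi^-1 * (trig_energy v xi + trig_energy w xi))%:E <= _)%E).
  apply: ge0_le_integral => //.
  - by move=> x _; rewrite lee_fin sqr_ge0.
  - apply: measurable_EFin; under eq_fun do rewrite normc_sqr.
    by apply: measurable_funD; exact: measurable_funX.
  - by apply: measurable_EFin; exact: L1_measurable.
  - by move=> x _; rewrite lee_fin normc_fhat_sqr_le.
rewrite Rint_fin// lee_fin RintegralZl//; last by apply: L1D; exact: L1_trig_energy.
rewrite RintegralD//; [|exact: L1_trig_energy|exact: L1_trig_energy].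
rewrite mulrC ler_pdivrMr ?pi_gt0//.
have := Rint_trig_energy_le dv; have := Rint_trig_energy_le dw.
set a := \int[mu]_x trig_energy v x; set b := \int[mu]_x trig_energy w x; lra.
Qed.

Definition trunc_ind (n : nat) : R -> R := \1_`[- n%:R, n%:R].

Lemma trunc_ind_le1 n x : `|trunc_ind n x| <= 1.
Proof. by rewrite /trunc_ind indicE; case: (_ \in _); rewrite ?normr1 ?normr0. Qed.

Lemma measurable_trunc_ind n : measurable_fun setT (trunc_ind n).
Proof. exact: measurable_indic. Qed.

Lemma truncated_fourierE n (f : R -> C) xi : L1 (fun x => Re (f x)) -> L1 (fun x => Im (f x)) ->
  truncated_fourier n f xi =
  fhat (fun x => Re (f x) * trunc_ind n x) (fun x => Im (f x) * trunc_ind n x) xi.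
Proof.
move=> f1 f2; rewrite /truncated_fourier /fhat; congr (_ * _).
have l1 := L1_mulb (measurable_trunc_ind n) (trunc_ind_le1 n) f1.
have l2 := L1_mulb (measurable_trunc_ind n) (trunc_ind_le1 n) f2.
have cs t : cos (t * xi + - (pi / 2)) = - sin (- (t * xi)).
  by rewrite cosB cos_pihalf sin_pihalf mulr0 add0r mulr1 sinN opprK.
have cc t : cos (t * xi + 0) = cos (- (t * xi)) by rewrite addr0 cosN.
rewrite /cintegral /trig_int; congr Complex.
  rewrite Rintegral_mkcond -RintegralD//; try exact: L1_cos.
  apply: eq_Rintegral => t _; rewrite cs cc patchE /trunc_ind indicE.
  by case: ifPn => _; rewrite ?ReMc/= ?mulr1 ?mulr0 ?mul0r ?addr0//; ring.
rewrite Rintegral_mkcond -RintegralB//; try exact: L1_cos.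
apply: eq_Rintegral => t _; rewrite cs cc patchE /trunc_ind indicE.
by case: ifPn => _; rewrite ?ImMc/= ?mulr1 ?mulr0 ?mul0r ?subr0//; ring.
Qed.

Lemma fhatB v w v' w' xi : L1 v -> L1 w -> L1 v' -> L1 w' ->
  fhat v w xi - fhat v' w' xi = fhat (fun x => v x - v' x) (fun x => w x - w' x) xi.
Proof.
move=> v1 w1 v1' w1'; have tB u u' th : L1 u -> L1 u' ->
    trig_int (fun x => u x - u' x) xi th = trig_int u xi th - trig_int u' xi th.
  move=> u1 u1'; rewrite -mulN1r -trig_intZ// -trig_intD//; last exact: L1Z.
  by congr trig_int; apply/funext => x; rewrite mulN1r.
rewrite /fhat !tB// -mulrBr; congr (_ * _).
by apply/eqP; rewrite eq_complex/=; apply/andP; split; apply/eqP; ring.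
Qed.

Lemma cvg_tail v : L2r v ->
  \int[mu]_x ((v x * trunc_ind n x - v x) ^+ 2) @[n --> \oo] --> (0 : R).
Proof.
move=> v2; rewrite -(@Rint0 R).
apply: (@Rint_dct R (fun n x => (v x * trunc_ind n x - v x) ^+ 2) (fun=> 0) (fun x => v x ^+ 2) _ _ _ _ _).2.
- move=> n; apply: measurable_funX; apply: measurable_funB; last exact: v2.1.
  by apply: measurable_funM; [exact: v2.1|exact: measurable_trunc_ind].
- by [].
- exact: v2.2.
- apply: aeW => x n; rewrite ger0_norm ?sqr_ge0// /trunc_ind indicE.
  by case: (_ \in _); rewrite ?mulr1 ?mulr0 ?subrr ?sub0r ?sqrrN ?expr0n ?sqr_ge0.
- apply: aeW => x; apply: cvg_near_cst; exists (Num.trunc `|x|).+1 => // n /= nx.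
  rewrite /trunc_ind indicE mem_set ?mulr1 ?subrr ?expr0n//=.
  rewrite in_itv/= -ler_norml; apply: le_trans (ltW (truncnS_gt _)) _.
  by rewrite ler_nat.
Qed.

(** By linearity the distance to the truncated transform is that of [fhat] applied to the part of f
    outside [-n, n], whose L^2 norm tends to 0. *)
Lemma is_fourier_fhat (f : R -> C) : gauss_decay (fun x => Re (f x)) ->
  gauss_decay (fun x => Im (f x)) ->
  is_fourier f (fhat (fun x => Re (f x)) (fun x => Im (f x))).
Proof.
move=> d1 d2; split; first exact: L2_fhat.
have l1 := gauss_decay_L1 d1; have l2 := gauss_decay_L1 d2.
set v := fun x => Re (f x); set w := fun x => Im (f x).
have dt u : gauss_decay u -> forall n, gauss_decay (fun x => u x * trunc_ind n x - u x).
  move=> du n; have := @gauss_decay_mul u (fun x => trunc_ind n x - 1) du.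
  rewrite (_ : (fun x => u x * (trunc_ind n x - 1)) = (fun x => u x * trunc_ind n x - u x)); last first.
    by apply/funext => x; rewrite mulrBr mulr1.
  apply.
    by apply: measurable_funB => //; exact: measurable_trunc_ind.
  move=> x; rewrite /trunc_ind indicE; case: (_ \in _).
    by rewrite subrr normr0.
  by rewrite sub0r normrN normr1.
have cT : 2 * (\int[mu]_x ((v x * trunc_ind n x - v x) ^+ 2) +
    \int[mu]_x ((w x * trunc_ind n x - w x) ^+ 2)) @[n --> \oo] --> (2 * (0 + 0) : R).
  apply: cvgM; first exact: cvg_cst.
  by apply: cvgD; apply: cvg_tail; exact: gauss_decay_L2.
rewrite addr0 mulr0 in cT.
pose M n : R := 2 * (\int[mu]_x ((v x * trunc_ind n x - v x) ^+ 2) +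
  \int[mu]_x ((w x * trunc_ind n x - w x) ^+ 2)).
have M0 n : 0 <= M n.
  by rewrite mulr_ge0// addr_ge0//; apply: Rintegral_ge0 => // x _; exact: sqr_ge0.
apply: (@squeeze_cvge _ _ _ _ (fun=> 0%E) _ (fun n => (Num.sqrt (M n))%:E)).
- apply: nearW => n; apply/andP; split.
    by rewrite L2normE poweR_ge0.
  apply/L2norm_le; first exact: sqrtr_ge0.
  rewrite sqr_sqrtr//; apply: le_trans (int_normc_fhat_le (dt _ d1 n) (dt _ d2 n)).
  rewrite le_eqVlt; apply/orP; left; apply/eqP; apply: eq_integral => xi _.
  rewrite truncated_fourierE// fhatB//; apply: gauss_decay_L1 => //.
    by apply: gauss_decay_mul => //; [exact: measurable_trunc_ind|exact: trunc_ind_le1].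
  by apply: gauss_decay_mul => //; [exact: measurable_trunc_ind|exact: trunc_ind_le1].
- exact: cvg_cst.
- apply: cvg_EFin; first exact: nearW.
  rewrite -(@sqrtr0 R); apply: (@continuous_cvg _ _ _ _ _ _ Num.sqrt); first exact: sqrt_continuous.
  exact: cT.
Qed.

(** Both are L^2 limits of the same sequence t_n, and |g - h|^2 <= 2 |t_n - g|^2 + 2 |t_n - h|^2
    allows one to work with squared integrals. *)
Lemma is_fourier_uniq (f g h : R -> C) : L1 (fun x => Re (f x)) -> L1 (fun x => Im (f x)) ->
  is_fourier f g -> is_fourier f h -> {ae mu, forall xi, g xi = h xi}.
Proof.
move=> f1 f2 [[/Lfun2P[mg1 _] /Lfun2P[mg2 _]] cg] [[/Lfun2P[mh1 _] /Lfun2P[mh2 _]] ch].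
have mT n : measurable_fun setT (fun xi => Re (truncated_fourier n f xi)) /\
    measurable_fun setT (fun xi => Im (truncated_fourier n f xi)).
  under [X in measurable_fun _ X /\ _]eq_fun do rewrite truncated_fourierE//.
  under [X in _ /\ measurable_fun _ X]eq_fun do rewrite truncated_fourierE//.
  by apply: measurable_fhat; apply: L1_mulb; [exact: measurable_trunc_ind|exact: trunc_ind_le1| |
    exact: measurable_trunc_ind|exact: trunc_ind_le1|].
have mn (u w : R -> C) : measurable_fun setT (fun x => Re (u x)) -> measurable_fun setT (fun x => Im (u x)) ->
    measurable_fun setT (fun x => Re (w x)) -> measurable_fun setT (fun x => Im (w x)) ->
    measurable_fun setT (fun x => normc (u x - w x) ^+ 2).
  move=> a1 a2 b1 b2; under eq_fun do rewrite normc_sqr !(ReDc, ImDc, raddfN)/=.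
  by apply: measurable_funD; apply: measurable_funX; exact: measurable_funB.
pose J (u w : R -> C) := (\int[mu]_x (normc (u x - w x) ^+ 2)%:E)%E.
have I0 u w : (0 <= J u w)%E by apply: integral_ge0 => x _; rewrite lee_fin sqr_ge0.
have tri n : (J g h <= 2%:E * J (truncated_fourier n f) g + 2%:E * J (truncated_fourier n f) h)%E.
  have [m1 m2] := mT n.
  rewrite -ge0_integralZl//; last 2 first.
  - by apply: measurable_EFin; exact: mn.
  - by move=> x _; rewrite lee_fin sqr_ge0.
  rewrite -ge0_integralZl//; last 2 first.
  - by apply: measurable_EFin; exact: mn.
  - by move=> x _; rewrite lee_fin sqr_ge0.
  rewrite -ge0_integralD//; last 4 first.
  - by move=> x _; rewrite -EFinM lee_fin mulr_ge0// sqr_ge0.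
  - by apply: measurable_funeM; apply: measurable_EFin; exact: mn.
  - by move=> x _; rewrite -EFinM lee_fin mulr_ge0// sqr_ge0.
  - by apply: measurable_funeM; apply: measurable_EFin; exact: mn.
  apply: ge0_le_integral => //.
  - by move=> x _; rewrite lee_fin sqr_ge0.
  - by apply: measurable_EFin; exact: mn.
  - by apply: emeasurable_funD; apply: measurable_funeM; apply: measurable_EFin; exact: mn.
  - move=> x _; rewrite -!EFinM -EFinD lee_fin.
    set t := truncated_fourier n f x.
    have : normc (g x - h x) <= normc (t - g x) + normc (t - h x).
      rewrite (normcB t (g x)) (_ : g x - h x = (g x - t) + (t - h x)); first exact: le_normcD.
      by rewrite addrA subrK.
    move=> h1; have := normc_ge0 (g x - h x).
    set a := normc _ in h1 *; set b := normc _ in h1 *; set d := normc _ in h1 *.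
    move=> a0; have := sqr_ge0 (b - d); have : a ^+ 2 <= (b + d) ^+ 2.
      by rewrite lerXn2r// nnegrE// (le_trans a0).
    nra.
have Ie (e : R) : 0 < e -> (J g h <= (4 * e ^+ 2)%:E)%E.
  move=> e0; have lee u : L2norm (fun xi => truncated_fourier n f xi - u xi) @[n --> \oo] --> 0%E ->
      \forall n \near \oo, (J (truncated_fourier n f) u <= (e ^+ 2)%:E)%E.
    move=> /fine_cvgP[fu /cvgrPdist_lt /(_ _ e0)]; apply: filterS2 fu => n fu.
    rewrite sub0r normrN ger0_norm; last by rewrite fine_ge0// L2normE poweR_ge0.
    move=> ue; apply/(L2norm_le _ (ltW e0)).
    by rewrite -(fineK fu) lee_fin ltW.
  have [n _ /(_ n (leqnn n)) [hg hh]] : \forall n \near \oo,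
     (J (truncated_fourier n f) g <= (e ^+ 2)%:E)%E /\ (J (truncated_fourier n f) h <= (e ^+ 2)%:E)%E.
    by apply/near_andP; split; exact: lee.
  apply: le_trans (tri n) _.
  apply: (@le_trans _ _ (2%:E * (e ^+ 2)%:E + 2%:E * (e ^+ 2)%:E)%E).
    by apply: leeD; apply: lee_wpmul2l.
  by rewrite -!EFinM -EFinD lee_fin; lra.
have Igh : J g h = 0%E.
  apply/eqP; rewrite eq_le I0 andbT; apply/lee_addgt0Pr => e e0; rewrite add0e.
  have s0 : 0 < Num.sqrt (e / 4) by rewrite sqrtr_gt0 divr_gt0.
  apply: le_trans (Ie _ s0) _; rewrite lee_fin sqr_sqrtr ?divr_ge0 ?(ltW e0)//.
  by rewrite mulrC divfK.
have mgh := measurable_EFin (mn g h mg1 mg2 mh1 mh2).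
have /(ae_eq_integral_abs mu measurableT mgh) : (\int[mu]_x `|(EFin \o (fun x : R => normc (g x - h x) ^+ 2)%R) x| = 0)%E.
  rewrite -Igh; apply: eq_integral => x _; by rewrite /= ger0_norm// sqr_ge0.
apply: ae_imp => x /(_ I) /= [] /eqP; rewrite sqrf_eq0 => /eqP /eq0_normc /eqP.
by rewrite subr_eq0 => /eqP.
Qed.

(** Existence of a transform excludes the default value of [xget], and uniqueness identifies the
    chosen function almost everywhere. *)
Lemma fourier_fhat (f : R -> C) : gauss_decay (fun x => Re (f x)) ->
  gauss_decay (fun x => Im (f x)) ->
  {ae mu, forall xi, fourier f xi = fhat (fun x => Re (f x)) (fun x => Im (f x)) xi}.
Proof.
move=> d1 d2; have F := is_fourier_fhat d1 d2.
apply: (is_fourier_uniq (gauss_decay_L1 d1) (gauss_decay_L1 d2) _ F).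
exact: (@xgetPex _ (fun=> 0) [set g | is_fourier f g] (ex_intro _ _ F)).
Qed.

Lemma hermite_coefE (f : R -> C) n : hermite_coef f n =
  Complex (\int[mu]_x (Re (f x) * hermite_fun n x)) (\int[mu]_x (Im (f x) * hermite_fun n x)).
Proof.
rewrite /hermite_coef /cintegral; congr Complex; apply: eq_Rintegral => x _.
  by rewrite ReMc /= mulr0 subr0.
by rewrite ImMc /= mulr0 add0r.
Qed.

Lemma hermite_fun_bounded n : exists B, forall x, `|hermite_fun n x| <= B :> R.
Proof.
have [D D0 HD] := @hermite_fun_gauss R n; exists D => x; apply: le_trans (HD x) _.
by rewrite ler_piMr ?(ltW D0)// expR_le1 oppr_le0 mulr_ge0 ?sqr_ge0// invr_ge0.
Qed.

Lemma L1_hermite n : L1 (@hermite_fun R n).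
Proof.
have [D D0 HD] := @hermite_fun_gauss R n.
apply: (L1_le (measurable_hermite_fun n) HD); apply: L1Z; apply: L1_gaussian0.
by rewrite invr_gt0.
Qed.

(** Fubini's theorem moves the transform from [v] to the Hermite function, where [trig_hermite_fun]
    evaluates it. *)
Lemma Rint_trig_int_hermite v n th : L1 v ->
  \int[mu]_xi (trig_int v xi th * hermite_fun n xi) =
  Num.sqrt (2 * pi) * cos (th + n%:R * (pi / 2)) * \int[mu]_x (v x * hermite_fun n x).
Proof.
move=> v1; have hL := L1_hermite n.
pose F (p : R * R) := hermite_fun n p.1 * (v p.2 * cos (p.2 * p.1 + th)).
have mF : measurable_fun setT F.
  apply: measurable_funM.
    by apply: (measurableT_comp (measurable_hermite_fun n)); exact: measurable_fst.
  apply: measurable_funM.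
    by apply: (measurableT_comp (L1_measurable v1)); exact: measurable_snd.
  apply: measurable_cos_comp; apply: measurable_funD => //.
  by apply: measurable_funM; [exact: measurable_snd|exact: measurable_fst].
transitivity (\int[mu]_xi \int[mu]_x F (xi, x)).
  by apply: eq_Rintegral => xi _; rewrite mulrC /trig_int -RintegralZl//; exact: L1_cos.
rewrite (@Rint_fubini R F (fun x => `|hermite_fun n x|) (fun x => `|v x|) mF).
- have [B hB] := hermite_fun_bounded n.
  rewrite -RintegralZl//; last exact: (L1_mulb (measurable_hermite_fun n) hB v1).
  apply: eq_Rintegral => x _; rewrite /F/=.
  transitivity (v x * trig_int (@hermite_fun R n) x th).
    rewrite /trig_int -RintegralZl//; last exact: L1_cos.
    by apply: eq_Rintegral => xi _; rewrite mulrCA [xi * x]mulrC.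
  by rewrite trig_hermite_fun; ring.
- exact: L1_norm.
- exact: L1_norm.
- by move=> x y; rewrite /F/= normrM ler_wpM2l// normrM ler_piMr// cos_abs_le1.
Qed.

Lemma phase_pow n : toC (cos (n%:R * (pi / 2))) - toC (sin (n%:R * (pi / 2))) * Complex 0 1 =
  Complex 0 (-1) ^+ n :> C.
Proof.
elim: n => [|n IH]; first by rewrite mul0r cos0 sin0 rmorph0 mul0r subr0 expr0 rmorph1.
rewrite exprS -IH -natr1 mulrDl mul1r cosDpihalf sinDpihalf.
by apply/eqP; rewrite eq_complex/=; apply/andP; split; apply/eqP; ring.
Qed.

Lemma hermite_coef_fhat v w n : gauss_decay v -> gauss_decay w ->
  hermite_coef (fhat v w) n =
  Complex 0 (-1) ^+ n * Complex (\int[mu]_x (v x * hermite_fun n x)) (\int[mu]_x (w x * hermite_fun n x)).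
Proof.
move=> dv dw; rewrite hermite_coefE -phase_pow.
have v1 := gauss_decay_L1 dv; have w1 := gauss_decay_L1 dw.
have s0 : Num.sqrt (2 * pi) != 0 :> R by rewrite gt_eqF// sqrtr_gt0 mulr_gt0// pi_gt0.
have hL := L1_hermite n.
have tL (u : R -> R) th : L1 u -> L1 (fun xi => trig_int u xi th * hermite_fun n xi).
  move=> u1; under eq_fun do rewrite mulrC.
  apply: (@L1_mulb _ (\int[mu]_x `|u x|)) => //; first exact: measurable_trig_int.
  by move=> x; exact: le_trig_int.
have cs : cos (- (pi / 2) + n%:R * (pi / 2)) = sin (n%:R * (pi / 2)) :> R.
  by rewrite addrC cosB cos_pihalf sin_pihalf mulr0 add0r mulr1.
have e1 : \int[mu]_xi (Re (fhat v w xi) * hermite_fun n xi) =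
    (Num.sqrt (2 * pi))^-1 * (\int[mu]_xi (trig_int v xi 0 * hermite_fun n xi) +
      \int[mu]_xi (trig_int w xi (- (pi / 2)) * hermite_fun n xi)).
  rewrite -RintegralD//; try exact: tL.
  rewrite -RintegralZl//; last by apply: L1D; exact: tL.
  by apply: eq_Rintegral => xi _; rewrite /fhat ReMc/=; ring.
have e2 : \int[mu]_xi (Im (fhat v w xi) * hermite_fun n xi) =
    (Num.sqrt (2 * pi))^-1 * (\int[mu]_xi (trig_int w xi 0 * hermite_fun n xi) -
      \int[mu]_xi (trig_int v xi (- (pi / 2)) * hermite_fun n xi)).
  rewrite -RintegralB//; try exact: tL.
  rewrite -RintegralZl//; last by apply: L1B; exact: tL.
  by apply: eq_Rintegral => xi _; rewrite /fhat ImMc/=; ring.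
rewrite e1 e2 !Rint_trig_int_hermite// cs add0r.
by apply/eqP; rewrite eq_complex/=; apply/andP; split; apply/eqP; field.
Qed.

End fourier_transform.

(** * Coefficient bounds and Cauchy estimates *)

Section coefficients.
Context {R : realType}.
Local Notation mu := (@lebesgue_measure R).
Local Notation C := R[i].
Local Notation Re := (@complex.Re R).
Local Notation Im := (@complex.Im R).
Local Notation toC := (real_complex R).

(* The bound (B_r) with the supremum in the Young conjugate resolved: rho = e^s, m = 1 / r. *)
Definition coef_bound (omega : R -> R) (m : R) (a : nat -> C) := exists2 K : R, 0 < K &
  forall n rho, 1 < rho -> normc (a n) * rho ^+ n <= K * Num.sqrt n`!%:R * expR (m * omega rho).

(** With rho = e^s and logarithms taken, the estimates for all s > 0 bound the supremum defining the
    conjugate at r n. A zero coefficient is treated apart: for a nonzero one they bound the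
    conjugate by a finite number, so the value +oo is compatible only with a zero coefficient. *)
Lemma cond_B_coef_bound (omega : R -> R) (f : R -> C) (r : R) : 0 < r ->
  cond_B omega f r <-> coef_bound omega r^-1 (hermite_coef f).
Proof.
move=> r0; split=> -[K K0 H]; exists K => // n.
  move=> rho rho1; have rho0 : 0 < rho by rewrite (lt_trans ltr01).
  have h : ((ln rho * (r * n%:R) - omega rho)%:E <= young_conjugate (phi_of omega) (r * n%:R))%E.
    apply: ereal_sup_ubound; exists (ln rho); first exact: ln_gt0.
    by rewrite /phi_of lnK.
  have := H n => {}H.
  have h2 : (expeR (- (r^-1%:E * young_conjugate (phi_of omega) (r * n%:R))) <=
      (expR (- (r^-1 * (ln rho * (r * n%:R) - omega rho))))%:E)%E.
    rewrite -[leRHS]/(expeR (- (r^-1 * (ln rho * (r * n%:R) - omega rho)))%:E) lee_expeR EFinN leeN2 EFinM.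
    by apply: lee_wpmul2l => //; rewrite lee_fin invr_ge0 ltW.
  have s0 : 0 < Num.sqrt n`!%:R :> R := sqrt_fact_gt0 n.
  have := le_trans H (lee_wpmul2l _ h2); rewrite lee_fin => /(_ (ltW (mulr_gt0 K0 s0))).
  rewrite -EFinM lee_fin => {}H.
  have := ler_wpM2r (exprn_ge0 n (ltW rho0)) H; move/le_trans; apply.
  rewrite le_eqVlt; apply/orP; left; apply/eqP.
  have -> : rho ^+ n = expR (n%:R * ln rho) by rewrite expRM_natl lnK ?posrE.
  rewrite -(mulrA (K * _)) -expRD; congr (_ * expR _).
  by field; rewrite gt_eqF.
have s0 : 0 < K * Num.sqrt n`!%:R :> R by rewrite mulr_gt0// sqrt_fact_gt0.
have [->|a0] := eqVneq (hermite_coef f n) 0.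
  by rewrite normc0; apply: mule_ge0; [rewrite lee_fin ltW|exact: expeR_ge0].
have na0 : 0 < normc (hermite_coef f n).
  by rewrite lt_neqAle normc_ge0 andbT eq_sym; apply: contra_neq a0 => /eq0_normc.
pose L := r * ln (K * Num.sqrt n`!%:R / normc (hermite_coef f n)).
have q0 : 0 < K * Num.sqrt n`!%:R / normc (hermite_coef f n) by rewrite divr_gt0.
have yL : (young_conjugate (phi_of omega) (r * n%:R) <= L%:E)%E.
  apply: ge_ereal_sup => _ [s s_gt0 <-]; rewrite lee_fin.
  have := H n (expR s); rewrite expR_gt1 => /(_ s_gt0) {}H.
  have : expR (s * n%:R - r^-1 * omega (expR s)) <= K * Num.sqrt n`!%:R / normc (hermite_coef f n).
    rewrite ler_pdivlMr// expRD expRN [leLHS]mulrAC ler_pdivrMr ?expR_gt0//.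
    by rewrite mulrC [s * _]mulrC expRM_natl.
  rewrite -ler_ln ?posrE ?expR_gt0// expRK => {}H.
  rewrite /phi_of /L -(ler_pM2l (_ : 0 < r^-1)) ?invr_gt0// mulKf ?gt_eqF//.
  by rewrite mulrBr mulrCA mulKf ?gt_eqF.
apply: (@le_trans _ _ ((K * Num.sqrt n`!%:R)%:E * expeR (- (r^-1%:E * L%:E)))%E).
  have -> : (- (r^-1%:E * L%:E) = (- ln (K * Num.sqrt n`!%:R / normc (hermite_coef f n)))%:E)%E.
    by rewrite -EFinM -EFinN /L mulKf ?gt_eqF.
  rewrite /= -EFinM lee_fin expRN lnK ?posrE//.
  by rewrite invfM invrK mulrCA mulrA mulVf ?mul1r// gt_eqF.
apply: lee_wpmul2l; first by rewrite lee_fin ltW.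
by rewrite lee_expeR leeN2; apply: lee_wpmul2l => //; rewrite lee_fin invr_ge0 ltW.
Qed.

Lemma even_odd_sum (c : nat -> C) (z : C) m :
  \sum_(i < m + m) c i * z ^+ i =
  \sum_(i < m) c (i + i)%N * (z ^+ 2) ^+ i + z * \sum_(i < m) c (i + i).+1 * (z ^+ 2) ^+ i.
Proof.
elim: m => [|m IH]; first by rewrite !big_ord0 mulr0 addr0.
rewrite addnS addSn !big_ord_recr/= IH -exprM mul2n -addnn (exprS z (m + m)); ring.
Qed.

(* Separating even and odd exponents halves the degree, which replaces the contour
   integral in Cauchy's estimate. *)
Lemma cauchy_estimate j (c : nat -> C) (rho B : R) : 0 < rho ->
  (forall z, normc z = rho -> normc (\sum_(i < 2 ^ j) c i * z ^+ i) <= B) ->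
  forall n, (n < 2 ^ j)%N -> normc (c n) * rho ^+ n <= B.
Proof.
elim: j c rho B => [|j IH] c rho B rho0 hc n.
  rewrite expn0 ltnS leqn0 => /eqP ->; rewrite expr0 mulr1.
  have := hc (toC rho); rewrite normc_toC gtr0_norm// => /(_ erefl).
  by rewrite expn0 big_ord_recr big_ord0 /= add0r expr0 mulr1.
have sq (w : C) : normc w = rho ^+ 2 -> exists2 z : C, normc z = rho & z ^+ 2 = w.
  move=> nw; exists (sqrtc w); last exact: sqr_sqrtc.
  apply/eqP; rewrite -(@eqrXn2 _ 2)// ?normc_ge0 ?ltW//.
  by rewrite -normcX sqr_sqrtc nw.
(* For the polynomial p, 2 P = p(z) + p(-z) and 2 z Q = p(z) - p(-z), so both parts inherit the
   bound B; every w of modulus rho^2 arises as z^2. *)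
have E w : normc w = rho ^+ 2 -> normc (\sum_(i < 2 ^ j) c (i + i)%N * w ^+ i) <= B /\
    normc (\sum_(i < 2 ^ j) (toC rho * c (i + i).+1) * w ^+ i) <= B.
  case/sq => z nz zw.
  have h1 := hc z nz; have := hc (- z); rewrite normcN => /(_ nz).
  rewrite expnS mul2n -addnn !even_odd_sum sqrrN zw in h1 *.
  set P := \sum_(i < _) c (i + i)%N * _ in h1 *; set Q := \sum_(i < _) c (i + i).+1 * _ in h1 *.
  move=> h2; have t2 : normc (2 : C) = 2.
    by rewrite -[2]/(2%:R) -(rmorph_nat toC) normc_toC ger0_norm.
  have e1 : 2 * normc P <= B + B.
    rewrite -t2 -normcM (_ : 2 * P = (P + z * Q) + (P + - z * Q)); last by ring.
    by apply: le_trans (le_normcD _ _) _; exact: lerD.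
  have e2 : 2 * normc (z * Q) <= B + B.
    rewrite -t2 -normcM (_ : 2 * (z * Q) = (P + z * Q) - (P + - z * Q)); last by ring.
    by apply: le_trans (le_normcD _ _) _; rewrite normcN; exact: lerD.
  split; first by lra.
  under eq_bigr do rewrite -mulrA.
  rewrite -mulr_sumr -/Q normcM normc_toC gtr0_norm// -nz -normcM; lra.
rewrite expnS mul2n -addnn => nj.
have rho2 : 0 < rho ^+ 2 by rewrite exprn_gt0.
rewrite -(odd_double_half n) in nj *; case: (odd n) nj => /= nj.
  have h : (n./2 < 2 ^ j)%N by move: nj; rewrite add1n -addnn; lia.
  have := IH (fun i => toC rho * c (i + i).+1) _ _ rho2 (fun w nw => (E w nw).2) _ h.
  rewrite add1n -addnn normcM normc_toC gtr0_norm// -exprM mul2n -addnn.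
  by rewrite exprS mulrCA mulrA.
have h : (n./2 < 2 ^ j)%N by move: nj; rewrite add0n -addnn; lia.
have := IH (fun i => c (i + i)%N) _ _ rho2 (fun w nw => (E w nw).1) _ h.
by rewrite add0n -addnn -exprM mul2n -addnn.
Qed.

Lemma polar_quadrant (z : C) : 0 < normc z -> 0 <= Re z -> 0 <= Im z ->
  exists2 t, 0 <= t <= pi / 2 & z = cexp (Complex (ln (normc z)) t).
Proof.
move=> n0 re im; set rho := normc z in n0 *.
have h : -1 <= Re z / rho <= 1.
  apply/andP; split; first by rewrite (le_trans _ (divr_ge0 re (ltW n0)))// oppr_le0.
  by rewrite ler_pdivrMr// mul1r; apply: le_trans (ler_norm _) (Re_le_normc z).
exists (acos (Re z / rho)).
  rewrite acos_ge0//=; have := acosK h; case: leP => // lt.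
  rewrite -(subrK (pi / 2) (acos (Re z / rho))) cosDpihalf => e.
  have : 0 < sin (acos (Re z / rho) - pi / 2).
    apply: sin_gt0_pi; rewrite subr_gt0 lt/=.
    by have := acos_lepi h; have := pi_gt0 R; lra.
  by rewrite -oppr_lt0 e ltNge divr_ge0// ltW.
rewrite /cexp /= lnK ?posrE// acosK// sin_acos//.
have -> : Num.sqrt (1 - (Re z / rho) ^+ 2) = Im z / rho.
  have -> : 1 - (Re z / rho) ^+ 2 = (Im z / rho) ^+ 2.
    rewrite !exprMn exprVn; have -> : Re z ^+ 2 = rho ^+ 2 - Im z ^+ 2 by rewrite normc_sqr addrK.
    by field; rewrite gt_eqF.
  by rewrite sqrtr_sqr ger0_norm// divr_ge0// ltW.
by rewrite ![rho * _]mulrC !divfK ?gt_eqF//; case: (z).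
Qed.

(** The growth estimate is available in the closed first quadrant; rotations by powers of i bring
    the rest of the circle there. *)
Lemma polar_iterate (P : C -> Prop) (rho : R) : 0 < rho ->
  (forall k t, 0 <= t <= pi / 2 -> P (Complex 0 1 ^+ k * cexp (Complex (ln rho) t))) ->
  forall z, normc z = rho -> P z.
Proof.
move=> rho0 H z nz.
have ni : normc (Complex 0 1 : C) = 1 by rewrite /= expr0n expr1n add0r sqrtr1.
have nI k w : normc (Complex 0 1 ^+ k * w : C) = normc w.
  by rewrite normcM normcX ni expr1n mul1r.
have i4 : Complex 0 1 ^+ 4 = 1 :> C.
  by rewrite !exprS expr0 mulr1; apply/eqP; rewrite eq_complex/=; apply/andP; split; apply/eqP; ring.
suff [k [j [kj [re im]]]] : exists k j, Complex 0 1 ^+ (j + k) = 1 :> C /\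
    (0 <= Re (Complex 0 1 ^+ k * z) /\ 0 <= Im (Complex 0 1 ^+ k * z)).
  have [|t t0 e] := @polar_quadrant (Complex 0 1 ^+ k * z) _ re im; first by rewrite nI nz.
  have -> : z = Complex 0 1 ^+ j * (Complex 0 1 ^+ k * z) by rewrite mulrA -exprD kj mul1r.
  by rewrite e nI nz; exact: H.
case: z {nz} => a b.
have [a0|a0] := leP 0 a; have [b0|b0] := leP 0 b.
- by exists 0%N, 0%N; rewrite expr0 mul1r.
- exists 1%N, 3%N; split => //; rewrite expr1 /=; lra.
- exists 3%N, 1%N; split => //; rewrite !exprS expr0 mulr1 /=; lra.
- exists 2%N, 2%N; split => //; rewrite !exprS expr0 mulr1 /=; lra.
Qed.

Lemma unif_sum_uniq (c : nat -> C) F G z : unif_sum c F -> unif_sum c G -> F z = G z.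
Proof.
move=> cF cG; apply/eqP; rewrite -subr_eq0; apply/eqP; apply: eq0_normc.
apply/eqP; rewrite eq_le normc_ge0 andbT; apply/ler_addgt0Pl => e e0; rewrite addr0.
have e2 : 0 < e / 2 by rewrite divr_gt0.
have [N1 h1] := cF (normc z) _ e2; have [N2 h2] := cG (normc z) _ e2.
have {}h1 := h1 (maxn N1 N2) (leq_maxl _ _) z (lexx _).
have {}h2 := h2 (maxn N1 N2) (leq_maxr _ _) z (lexx _).
rewrite [e]splitr; set S := \sum_(i < _) _ in h1 h2.
rewrite (_ : F z - G z = (F z - S) - (G z - S)); last by rewrite opprB addrA subrK.
by apply: le_trans (le_normcD _ _) _; rewrite normcN; exact: lerD.
Qed.

Lemma unif_sum_rotate (c : nat -> C) F (k : C) : normc k = 1 -> unif_sum c F ->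
  unif_sum (fun n => c n * k ^+ n) (fun z => F (k * z)).
Proof.
move=> k1 cF rho e e0; have [N h] := cF rho e e0; exists N => M NM z zr.
under eq_bigr do rewrite -mulrA -exprMn.
by apply: h => //; rewrite normcM k1 mul1r.
Qed.

(** The estimate for polynomials is applied to the partial sum of length 2^(N + n), a power of two
    beyond both the convergence threshold N and the index n. *)
Lemma unif_sum_cauchy (c : nat -> C) F (rho B : R) : 0 < rho -> unif_sum c F ->
  (forall z, normc z = rho -> normc (F z) <= B) ->
  forall n, normc (c n) * rho ^+ n <= B.
Proof.
move=> rho0 cF FB n; apply/ler_addgt0Pl => e e0.
have [N h] := cF rho e e0.
have N2 : (N <= 2 ^ (N + n))%N by apply: leq_trans (ltnW (ltn_expl _ (ltnSn 1))) _; rewrite leq_exp2l// leq_addr.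
have n2 : (n < 2 ^ (N + n))%N by apply: leq_trans (ltn_expl _ (ltnSn 1)) _; rewrite leq_exp2l// leq_addl.
apply: (@cauchy_estimate (N + n)) => // z nz.
have := h _ N2 z; rewrite nz lexx => /(_ isT) h1.
rewrite -[X in normc X](subKr (F z)).
apply: le_trans (le_normcD _ _) _; rewrite normcN addrC; apply: lerD => //.
exact: FB.
Qed.

(** * Consequences of the growth of the weight *)

Section weight.
Variables (omega : R -> R).
Hypotheses (omega_weight : weight_function omega) (omega_integral : integral_bigO omega).

Let omega_ge0 x : 0 <= x -> 0 <= omega x.
Proof. by case: omega_weight => h _ _; exact: h. Qed.

Let omega_le x y : 0 <= x -> x <= y -> omega x <= omega y.
Proof. by case: omega_weight => _ h _; exact: h. Qed.

Lemma omega_add_le x y : 0 <= x -> 0 <= y -> omega (x + y) <= omega (2 * x) + omega (2 * y).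
Proof.
move=> x0 y0; have [xy|yx] := leP x y.
  have : omega (x + y) <= omega (2 * y) by apply: omega_le; lra.
  by have := omega_ge0 (mulr_ge0 (ler0n R 2) x0); lra.
have : omega (x + y) <= omega (2 * x) by apply: omega_le; lra.
by have := omega_ge0 (mulr_ge0 (ler0n R 2) y0); lra.
Qed.

(** The growth estimate based at the radius x itself, so that the ratio of radii is the constant
    c. *)
Lemma omega_dilate (c : R) : 1 <= c -> exists2 K, 1 <= K &
  forall x, 0 <= x -> omega (c * x) <= K * (omega x + 1).
Proof.
move=> c1; have [K [g [K1 _ H]]] := omega_growth omega_weight omega_integral.
have cg : 0 <= c `^ g := powR_ge0 _ _.
have h : 1 <= K * (1 + c `^ g).
  by have := mulr_ge0 (le_trans ler01 K1) cg; lra.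
exists (K * (1 + c `^ g)) => // x x0.
have c0 : 0 <= c by rewrite (le_trans ler01).
move: x0; rewrite le_eqVlt => /predU1P[<-|x0].
  rewrite mulr0; have o0 := omega_ge0 (lexx 0).
  by apply: le_trans (ler_wpM2r _ h); rewrite ?addr_ge0//; lra.
apply: le_trans (H x (c * x) x0 (mulr_ge0 c0 (ltW x0))) _.
by rewrite mulfK ?gt_eqF// mulrAC.
Qed.

(** [omega] is O(x^g) with g < 2. The radius [r0] is where A x^g and e x^2 cross; below it a
    constant suffices. *)
Lemma omega_quad (e : R) : 0 < e -> exists2 D, 0 <= D &
  forall x, 0 <= x -> omega x <= e * x ^+ 2 + D.
Proof.
move=> e0; have [K [g [K1 /andP[g0 g2] H]]] := omega_growth omega_weight omega_integral.
pose A := K * (omega 1 + 1).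
have A0 : 0 < A.
  apply: mulr_gt0; first exact: lt_le_trans ltr01 K1.
  by have := omega_ge0 (@ler01 R); lra.
have g2' : 0 < 2 - g by rewrite subr_gt0.
pose r0 := (A / e) `^ ((2 - g)^-1).
have Ae : 0 < A / e by rewrite divr_gt0.
have r00 : 0 <= r0 by exact: powR_ge0.
exists (A + A * r0 `^ g) => [|x x0].
  by have := mulr_ge0 (ltW A0) (powR_ge0 r0 g); lra.
apply: le_trans (H 1 x ltr01 x0) _; rewrite divr1 -/A mulrDr mulr1.
suff h : A * x `^ g <= e * x ^+ 2 + A * r0 `^ g by lra.
have [xr|rx] := leP x r0.
  apply: (@le_trans _ _ (A * r0 `^ g)); last by rewrite lerDr mulr_ge0 ?sqr_ge0 ?(ltW e0).
  by rewrite ler_pM2l// ge0_ler_powR ?nnegrE ?(ltW g0).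
apply: (@le_trans _ _ (e * x ^+ 2)); last by rewrite lerDl mulr_ge0 ?powR_ge0 ?(ltW A0).
have xp : 0 < x := le_lt_trans r00 rx.
rewrite -ler_pdivrMl// mulrA [e^-1 * A]mulrC.
have -> : x ^+ 2 = x `^ (2 - g) * x `^ g.
  by rewrite -powRD ?subrK ?powR_mulrn ?ltW// gt_eqF// implybT.
rewrite ler_wpM2r ?powR_ge0//.
have -> : A / e = r0 `^ (2 - g) by rewrite /r0 -powRrM mulVf ?powRr1 ?gt_eqF// ltW.
by rewrite ge0_ler_powR ?nnegrE ?(ltW g2') ?(ltW xp) ?(ltW rx).
Qed.

End weight.

End coefficients.

(** * Weighted bounds *)

Section hermite_expansion.
Context {R : realType}.
Local Notation mu := (@lebesgue_measure R).

(** The Hermite series of u converges pointwise to a function g obeying the bound. Dominated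
    convergence and orthonormality give g the coefficients of u, so completeness yields u = g almost
    everywhere. *)
Lemma hermite_expansion_le (u W : R -> R) (D D' : R) : L2r u -> 0 <= D -> 0 <= D' ->
  (forall x, 0 <= W x) -> (forall x, W x <= D' * expR (- (4^-1 * x ^+ 2))) ->
  (forall n x, `|\int[mu]_y (u y * hermite_fun n y)| * `|hermite_fun n x| <= D / 2 ^+ n * W x) ->
  {ae mu, forall x, `|u x| <= 2 * D * W x}.
Proof.
move=> hu D0 D0' W0 WD H.
pose b n := \int[mu]_y (u y * hermite_fun n y).
pose s N x := \sum_(i < N) b i * hermite_fun i x.
have sle N x : `|s N x| <= 2 * D * W x.
  apply: le_trans (ler_norm_sum _ _ _) _.
  apply: le_trans (_ : (\sum_(i < N) D / 2 ^+ i) * W x <= _).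
    by rewrite mulr_suml; apply: ler_sum => i _; rewrite normrM; exact: H.
  rewrite ler_wpM2r//; have := geometric_half 0 N D0.
  by rewrite add0n big_mkord expr0 divr1.
have ms N : measurable_fun setT (s N).
  apply: measurable_sum => i; apply: measurable_funM => //.
  exact: measurable_hermite_fun.
have sc x : cvgn (s ^~ x).
  rewrite (_ : s ^~ x = series (fun i => b i * hermite_fun i x)); last first.
    by apply/funext => N; rewrite /series/= big_mkord.
  apply: normed_cvg; apply: (@series_le_cvg _ _ (fun n => W x * (D / 2 ^+ n))) => //.
  - by move=> n /=; exact: normr_ge0.
  - by move=> n; rewrite mulr_ge0// divr_ge0// exprn_ge0.
  - by move=> n /=; rewrite normrM [leRHS]mulrC; exact: H.
  - have := @is_cvg_geometric_series R (W x * D) 2^-1.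
    rewrite ger0_norm ?invr_ge0// invf_lt1// ltr1n => /(_ isT).
    by under [X in cvgn (series X) -> _]eq_fun do rewrite /geometric/= exprVn -mulrA.
pose g x := limn (s ^~ x).
have sg x : s N x @[N --> \oo] --> g x by exact: sc.
have mg : measurable_fun setT g by apply: (measurable_fun_cvg ms) => x _; exact: sg.
have gle x : `|g x| <= 2 * D * W x.
  have cg : `|s N x| @[N --> \oo] --> `|g x| by apply: cvg_norm; exact: sg.
  rewrite -(cvg_lim _ cg)//; apply: limr_le; first by apply/cvg_ex; eexists; exact: cg.
  by apply: nearW => N.
have c0 : 0 < 4^-1 :> R by rewrite invr_gt0.
have gg x : `|g x| <= 2 * D * D' * expR (- (4^-1 * x ^+ 2)).
  apply: le_trans (gle x) _; rewrite -[leRHS]mulrA ler_wpM2l//; exact: mulr_ge0.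
have g2 : L2r g.
  by apply: (@L2r_gauss R g (2 * D * D') 4^-1 c0 mg _).2; apply: aeW => x; exact: gg.
have gb m : \int[mu]_x (g x * hermite_fun m x) = b m.
  have [] := @Rint_dct R (fun N x => s N x * hermite_fun m x) (fun x => g x * hermite_fun m x)
    (fun x => `|2 * D * D' * expR (- (4^-1 * x ^+ 2)) * hermite_fun m x|).
  - by move=> N; apply: measurable_funM => //; exact: measurable_hermite_fun.
  - by apply: measurable_funM => //; exact: measurable_hermite_fun.
  - apply: L1_norm; apply: L2r_mul; last exact: L2r_hermite.
    by apply: L2rZ; exact: L2r_gaussian.
  - apply: aeW => x N; rewrite !(normrM _ (hermite_fun m x)) ler_wpM2r//.
    apply: le_trans (sle N x) _; apply: le_trans (ler_norm _).
    by rewrite -[leRHS]mulrA ler_wpM2l//; exact: mulr_ge0.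
  - by apply: aeW => x; apply: cvgM; [exact: sg|exact: cvg_cst].
  move=> _ cv; rewrite -(cvg_lim _ cv)//; apply/cvg_lim => //.
  apply: cvg_near_cst; exists m.+1 => // N /= mN.
  have hh i : L1 (fun x : R => hermite_fun i x * hermite_fun m x) by apply: L2r_mul; exact: L2r_hermite.
  transitivity (\int[mu]_x (\sum_(i < N) b i * (hermite_fun i x * hermite_fun m x))).
    by apply: eq_Rintegral => x _; rewrite mulr_suml; apply: eq_bigr => i _; exact/esym/mulrA.
  rewrite Rint_sum; last by move=> i; exact: L1Z.
  have e i : \int[mu]_x (b i * (hermite_fun i x * hermite_fun m x)) = b i * (i == m)%:R.
    rewrite -(hermite_orthonormal i m); exact: (RintegralZl _ measurableT (hh i)).
  under eq_bigr do rewrite e.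
  rewrite (bigD1 (Ordinal mN))//= eqxx mulr1 big1 ?addr0// => i im.
  by rewrite (negbTE im : (i == m :> nat) = false) mulr0.
have v2 : L2r (fun x => u x + -1 * g x) by apply: L2rD => //; exact: L2rZ.
have vh n : \int[mu]_x ((u x + -1 * g x) * hermite_fun n x) = 0.
  have uh : L1 (fun x => u x * hermite_fun n x) by apply: L2r_mul => //; exact: L2r_hermite.
  have gh : L1 (fun x => g x * hermite_fun n x) by apply: L2r_mul => //; exact: L2r_hermite.
  transitivity (\int[mu]_x (u x * hermite_fun n x - g x * hermite_fun n x)).
    by apply: eq_Rintegral => x _; set h := hermite_fun n x; ring.
  by rewrite RintegralB// gb subrr.
have := hermite_complete v2 vh.
apply: ae_imp => x /eqP; rewrite mulN1r subr_eq0 => /eqP ->; exact: gle.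
Qed.

End hermite_expansion.

Section weighted_bounds.
Context {R : realType}.
Local Notation mu := (@lebesgue_measure R).
Local Notation C := R[i].
Local Notation Re := (@complex.Re R).
Local Notation Im := (@complex.Im R).
Local Notation toC := (real_complex R).
Variables (omega : R -> R).
Hypotheses (omega_weight : weight_function omega) (omega_integral : integral_bigO omega).

Let omega_ge0 x : 0 <= x -> 0 <= omega x.
Proof. by case: omega_weight => h _ _; exact: h. Qed.

Let omega_le x y : 0 <= x -> x <= y -> omega x <= omega y.
Proof. by case: omega_weight => _ h _; exact: h. Qed.

Lemma weight_gauss_le (l : R) : 0 < l -> exists2 D, 0 <= D & forall x,
  expR (- (2^-1 * x ^+ 2) + l * omega `|x|) <= D * expR (- (4^-1 * x ^+ 2)).
Proof.
(* With this value l omega(|x|) consumes at most x^2 / 4, half of the Gaussian exponent, up to a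
   constant. *)
move=> l0; have e0 : 0 < (4 * l)^-1 by rewrite invr_gt0 mulr_gt0.
have [D D0 H] := omega_quad omega_weight omega_integral e0.
exists (expR (l * D)) => [|x]; first exact: expR_ge0.
rewrite -expRD ler_expR; have := ler_wpM2l (ltW l0) (H _ (normr_ge0 x)).
rewrite real_normK ?num_real// mulrDr (_ : l * ((4 * l)^-1 * x ^+ 2) = 4^-1 * x ^+ 2); last first.
  by field; rewrite gt_eqF.
lra.
Qed.

(* The factor e^2 in rho = 3 e^2 Y yields e^{- 2 n}: one e^{- n} compensates
   m omega (3 e^2 sqrt n) <= n + O(1), the other makes the series converge. *)
Lemma coef_bound_term : exists2 K1, 0 < K1 & forall m (a : nat -> C), 0 < m -> coef_bound omega m a ->
  exists2 D, 0 <= D & forall n x, normc (a n) * `|hermite_fun n x| <=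
    D / 2 ^+ n * expR (- (2^-1 * x ^+ 2) + K1 * m * omega `|x|).
Proof.
pose E : R := 3 * expR 2.
have E1 : 1 <= E.
  have : 1 <= expR 2 :> R by rewrite -expR0 ler_expR.
  by rewrite /E; lra.
have E0 : 0 < E := lt_le_trans ltr01 E1.
have [K1 K11 HK] := omega_dilate omega_weight omega_integral E1.
exists K1; first exact: lt_le_trans ltr01 K11.
move=> m a m0 [K K0 H].
have e0 : 0 < (m * E ^+ 2)^-1 by rewrite invr_gt0 mulr_gt0 ?exprn_gt0.
have [D0 D00 HD] := omega_quad omega_weight omega_integral e0.
pose D := K * expR (m * (K1 + omega E + D0)).
exists D => [|n x]; first by rewrite mulr_ge0 ?expR_ge0// ltW.
(* |x| and sqrt n are what [hermite_poly_le] asks for, and 1 makes [E * Y] exceed 1. By taking a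
   maximum, omega(E Y) is bounded by the sum of its three values. *)
pose Y := Num.max (Num.max `|x| 1) (Num.sqrt n%:R).
have xY : `|x| <= Y by rewrite /Y !le_max lexx.
have Y1 : 1 <= Y by rewrite /Y !le_max lexx orbT.
have nY : Num.sqrt n%:R <= Y by rewrite /Y le_max lexx orbT.
have Y0 : 0 < Y := lt_le_trans ltr01 Y1.
have nY2 : n%:R <= Y ^+ 2.
  by rewrite -[leLHS](sqr_sqrtr (ler0n R n)) lerXn2r ?nnegrE ?sqrtr_ge0 ?(ltW Y0).
have EY1 : 1 < E * Y.
  apply: lt_le_trans (_ : E <= _); last by rewrite ler_peMr// ltW.
  have : 1 <= expR 2 :> R by rewrite -expR0 ler_expR.
  by rewrite /E; lra.
have ho : omega (E * Y) <= omega (E * `|x|) + omega E + omega (E * Num.sqrt n%:R).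
  have o1 : 0 <= omega (E * `|x|) by apply: omega_ge0; rewrite mulr_ge0// ltW.
  have o2 : 0 <= omega E by apply: omega_ge0; rewrite ltW.
  have o3 : 0 <= omega (E * Num.sqrt n%:R) by apply: omega_ge0; rewrite mulr_ge0 ?sqrtr_ge0// ltW.
  rewrite /Y; case: (leP (Num.max `|x| 1) (Num.sqrt n%:R)) => _; first lra.
  by case: (leP `|x| 1) => _; rewrite ?mulr1; lra.
have hn : m * omega (E * Num.sqrt n%:R) <= n%:R + m * D0.
  have := ler_wpM2l (ltW m0) (HD _ (mulr_ge0 (ltW E0) (sqrtr_ge0 n%:R))).
  rewrite [(E * _) ^+ 2]exprMn sqr_sqrtr// mulrDr.
  rewrite (_ : m * ((m * E ^+ 2)^-1 * (E ^+ 2 * n%:R)) = n%:R)//.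
  by field; rewrite !gt_eqF.
have hx : m * omega (E * `|x|) <= m * (K1 * (omega `|x| + 1)) by rewrite ler_wpM2l ?HK// ltW.
have hm : m * omega (E * Y) <= m * (K1 + omega E + D0) + K1 * m * omega `|x| + n%:R.
  have := ler_wpM2l (ltW m0) ho; lra.
have s0 : 0 < Num.sqrt n`!%:R :> R := sqrt_fact_gt0 n.
have hh : `|hermite_fun n x| <= (3 * Y) ^+ n / Num.sqrt n`!%:R * expR (- (2^-1 * x ^+ 2)).
  apply: le_trans (hermite_fun_le n x) _; rewrite ler_wpM2r ?expR_ge0//.
  apply: ler_pM => //; first exact: hermite_poly_le.
  rewrite lef_pV2 ?posrE// ?sqrtr_gt0 ?mulr_gt0 ?exprn_gt0 ?ltr0n ?fact_gt0//.
  by rewrite ler_wsqrtr// ler_peMl// exprn_ege1// ler1n.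
have an : normc (a n) <= K * Num.sqrt n`!%:R * expR (m * omega (E * Y)) / (E * Y) ^+ n.
  by rewrite ler_pdivlMr ?exprn_gt0 ?mulr_gt0//; exact: H.
apply: le_trans (ler_pM (normc_ge0 _) (normr_ge0 _) an hh) _.
have -> : (E * Y) ^+ n = (3 * Y) ^+ n * expR (2 * n%:R).
  by rewrite /E mulrAC exprMn -expRM_natl [2 * _]mulrC.
have Yn : (3 * Y) ^+ n != 0 by rewrite expf_neq0// mulf_neq0// gt_eqF.
have sn : Num.sqrt n`!%:R != 0 :> R by rewrite gt_eqF.
rewrite [leLHS](_ : _ = K * expR (m * omega (E * Y)) * (expR (2 * n%:R))^-1 * expR (- (2^-1 * x ^+ 2))); last first.
  by field; rewrite Yn sn gt_eqF ?expR_gt0.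
apply: le_trans (_ : K * (expR (m * (K1 + omega E + D0)) * expR (K1 * m * omega `|x|) * expR n%:R) *
    (expR (2 * n%:R))^-1 * expR (- (2^-1 * x ^+ 2)) <= _).
  rewrite ler_wpM2r ?expR_ge0// ler_wpM2r ?invr_ge0 ?expR_ge0// ler_wpM2l ?(ltW K0)//.
  by rewrite -!expRD ler_expR.
rewrite -expRN expRD /D.
have e2 : expR n%:R * expR (- (2 * n%:R)) <= (2 ^+ n)^-1 :> R.
  rewrite -expRD (_ : _ + _ = - n%:R); last by ring.
  rewrite expRN lef_pV2 ?posrE ?expR_gt0 ?exprn_gt0// -[n%:R]mulr1 expRM_natl.
  by rewrite lerXn2r ?nnegrE ?expR_ge0//; have := expR_ge1Dx (1 : R); lra.
set A := expR (m * _); set B := expR (K1 * _ * _); set G := expR (- (2^-1 * _)).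
rewrite [leLHS](_ : _ = K * A * G * B * (expR n%:R * expR (- (2 * n%:R)))); last by ring.
rewrite [leRHS](_ : _ = K * A * G * B * (2 ^+ n)^-1); last by ring.
by rewrite ler_wpM2l// !mulr_ge0 ?expR_ge0// ltW.
Qed.

(** The expansion is applied to the real and the imaginary part. [K1] is chosen before m and f, as
    the statement for every lambda requires. *)
Lemma coef_bound_gaussian_bound : exists2 K1, 0 < K1 & forall m (f : R -> C), 0 < m ->
  L2r (fun x => Re (f x)) -> L2r (fun x => Im (f x)) ->
  coef_bound omega m (hermite_coef f) -> gaussian_bound omega (K1 * m) f.
Proof.
have [K1 K10 H] := coef_bound_term; exists K1 => // m f m0 f1 f2 /(H m _ m0)[D D0 {}H].
have [D' D0' HW] := weight_gauss_le (mulr_gt0 K10 m0).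
have W0 x : 0 <= expR (- (2^-1 * x ^+ 2) + K1 * m * omega `|x|) by exact: expR_ge0.
have b1 := hermite_expansion_le f1 D0 D0' W0 HW.
have b2 := hermite_expansion_le f2 D0 D0' W0 HW.
exists (4 * D + 1); first by rewrite ltr_wpDl// mulr_ge0.
apply: (ae_imp2 _ (b1 _) (b2 _)) => [x h1 h2|n x|n x].
- apply: le_trans (normc_le_ReIm _) _.
  have := W0 x; set W := expR _ in h1 h2 *; nra.
- apply: le_trans (H n x); rewrite ler_wpM2r//.
  by apply: le_trans (Re_le_normc _); rewrite hermite_coefE.
- apply: le_trans (H n x); rewrite ler_wpM2r//.
  by apply: le_trans (Im_le_normc _); rewrite hermite_coefE.
Qed.

Lemma gaussian_bound_decay l (f : R -> C) : 0 < l -> L2r (fun x => Re (f x)) -> L2r (fun x => Im (f x)) ->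
  gaussian_bound omega l f -> gauss_decay (fun x => Re (f x)) /\ gauss_decay (fun x => Im (f x)).
Proof.
move=> l0 f1 f2 [K K0 H]; have [D D0 HD] := weight_gauss_le l0.
have c0 : 0 < 4^-1 :> R by rewrite invr_gt0.
have aux x : normc (f x) <= K * expR (- (2^-1 * x ^+ 2) + l * omega `|x|) ->
    normc (f x) <= K * D * expR (- (4^-1 * x ^+ 2)).
  by move/le_trans; apply; rewrite -mulrA ler_wpM2l ?(ltW K0).
split; (split; first by [exact: f1.1|exact: f2.1]); exists (K * D), 4^-1; split => //;
  apply: ae_imp H => x /aux; apply: le_trans; [exact: Re_le_normc|exact: Im_le_normc].
Qed.

Lemma Rint_norm_ae_le (f g : R -> R) : L1 f -> L1 g -> {ae mu, forall x, `|f x| <= g x} ->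
  `|\int[mu]_x f x| <= \int[mu]_x g x.
Proof.
move=> f1 g1 fg; apply: le_trans (le_normr_Rintegral _ _) _ => //.
rewrite -lee_fin -!Rint_fin//; last exact: L1_norm.
have mf := measurable_EFin (L1_measurable (L1_norm f1)).
have mg := measurable_EFin (L1_measurable g1).
have -> : (\int[mu]_x (g x)%:E = \int[mu]_x `|g x|%:E)%E.
  apply: ae_eq_integral => //; first exact: measurable_EFin (L1_measurable (L1_norm g1)).
  by apply: ae_imp fg => x h _; rewrite /= ger0_norm// (le_trans _ h).
apply: ae_ge0_le_integral => //.
- exact: measurable_EFin (L1_measurable (L1_norm g1)).
- by apply: ae_imp fg => x h _; rewrite lee_fin (le_trans h)// ler_norm.
Qed.

Lemma normc_bargmann_kernel (t : R) (z : C) : normc (bargmann_kernel t z) <=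
  expR (- (2^-1 * t ^+ 2) + (Num.sqrt 2 * t * Re z - (Re z ^+ 2 - Im z ^+ 2) / 2)).
Proof.
rewrite /bargmann_kernel normcM normc_toC normc_cexp expRD.
rewrite ger0_norm ?mulr_ge0 ?expR_ge0 ?(ltW (@pi_pow_gt0 R))//.
have -> : Re (toC (Num.sqrt 2 * t) * z - 2^-1 * z ^+ 2) =
    Num.sqrt 2 * t * Re z - (Re z ^+ 2 - Im z ^+ 2) / 2.
  have -> : 2^-1 = toC 2^-1 by rewrite fmorphV rmorph_nat.
  by case: z => a b; rewrite expr2 /=; field.
rewrite ler_wpM2r ?expR_ge0// ler_piMl ?expR_ge0//; exact: pi_pow_le1.
Qed.

Lemma measurable_bargmann_kernel (z : C) :
  measurable_fun setT (fun t => Re (bargmann_kernel t z)) /\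
  measurable_fun setT (fun t => Im (bargmann_kernel t z)).
Proof.
have mh n : measurable_fun setT (fun t => hermite_fun n t / Num.sqrt n`!%:R : R).
  by apply: measurable_funM => //; exact: measurable_hermite_fun.
split.
  apply: (@measurable_fun_cvg _ _ _ _ (fun N t => Re (\sum_(i < N) toC (hermite_fun i t / Num.sqrt i`!%:R) * z ^+ i))).
    move=> N; elim: N => [|N IH]; first by under eq_fun do rewrite big_ord0; exact: measurable_cst.
    under eq_fun do rewrite big_ord_recr ReDc ReMc mul0r subr0.
    apply: measurable_funD; first exact: IH.
    by apply: measurable_funM; [exact: mh|exact: measurable_cst].
  by move=> t _; have [] := bargmann_kernel_series t z.
apply: (@measurable_fun_cvg _ _ _ _ (fun N t => Im (\sum_(i < N) toC (hermite_fun i t / Num.sqrt i`!%:R) * z ^+ i))).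
  move=> N; elim: N => [|N IH]; first by under eq_fun do rewrite big_ord0; exact: measurable_cst.
  under eq_fun do rewrite big_ord_recr ImDc ImMc mul0r addr0.
  apply: measurable_funD; first exact: IH.
  by apply: measurable_funM; [exact: mh|exact: measurable_cst].
by move=> t _; have [] := bargmann_kernel_series t z.
Qed.

(** With c = Re z / sqrt 2, completing the square turns the Gaussian of the bound times the kernel
    into exp(-(t - c)^2 + (Im z)^2 / 2). The weight is moved to the centre by omega(|t|) <= omega(2
    |t - c|) + omega(2 |c|), where |c| <= |z|. *)
Lemma rbargmann_le (l : R) (w : R -> R) (K : R) : 0 < l -> measurable_fun setT w -> 0 <= K ->
  {ae mu, forall t, `|w t| <= K * expR (- (2^-1 * t ^+ 2) + l * omega `|t|)} ->
  exists2 M, 0 <= M & forall z, normc (rbargmann w z) <=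
    M * expR (Im z ^+ 2 / 2 + l * omega (2 * normc z)).
Proof.
move=> l0 mw K0 wK.
(* For this value l omega(2 |t - c|) uses up (t - c)^2 / 2, half of the exponent; the other half is
   integrated. *)
have e0 : 0 < (8 * l)^-1 by rewrite invr_gt0 mulr_gt0.
have [D D0 HD] := omega_quad omega_weight omega_integral e0.
have c0 : 0 < 2^-1 :> R by rewrite invr_gt0.
have s2 : Num.sqrt 2 ^+ 2 = 2 :> R by rewrite sqr_sqrtr.
have s1 : 1 <= Num.sqrt 2 :> R by rewrite -{1}(@sqrtr1 R) ler_wsqrtr// ler1n.
have s0 : 0 < Num.sqrt 2 :> R := lt_le_trans ltr01 s1.
pose M1 := K * expR (l * D) * Num.sqrt (pi / 2^-1).
exists (2 * M1) => [|z]; first by rewrite !mulr_ge0 ?expR_ge0 ?sqrtr_ge0.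
set a := Re z; set b := Im z.
pose c := a / Num.sqrt 2.
pose B := K * expR (l * D) * expR (b ^+ 2 / 2 + l * omega (2 * normc z)).
have cz : `|c| <= normc z.
  rewrite /c normrM [`|_^-1|]ger0_norm ?invr_ge0// ler_pdivrMr//.
  apply: le_trans (Re_le_normc z) _; rewrite ler_peMr ?normc_ge0//.
have wt t : l * omega `|t| <= 2^-1 * (t - c) ^+ 2 + l * D + l * omega (2 * normc z).
  have h1 : `|t| <= `|t - c| + `|c| by rewrite -{1}(subrK c t) ler_normD.
  have h2 := omega_le (normr_ge0 t) h1.
  have h3 := omega_add_le omega_weight (normr_ge0 (t - c)) (normr_ge0 c).
  have h4 : omega (2 * `|c|) <= omega (2 * normc z) by apply: omega_le; rewrite ?mulr_ge0// ler_wpM2l.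
  have h5 := HD (2 * `|t - c|) (mulr_ge0 (ler0n _ _) (normr_ge0 _)).
  have h6 : omega `|t| <= (8 * l)^-1 * (2 * `|t - c|) ^+ 2 + D + omega (2 * normc z) by lra.
  have := ler_wpM2l (ltW l0) h6; rewrite !mulrDr.
  rewrite exprMn real_normK ?num_real// (_ : l * ((8 * l)^-1 * (2 ^+ 2 * (t - c) ^+ 2)) = 2^-1 * (t - c) ^+ 2)//.
  by field; rewrite gt_eqF.
have kb t : K * expR (- (2^-1 * t ^+ 2) + l * omega `|t|) * normc (bargmann_kernel t z) <=
    B * expR (- (2^-1 * (t - c) ^+ 2)).
  apply: le_trans (ler_wpM2l _ (normc_bargmann_kernel t z)) _; first by rewrite mulr_ge0 ?expR_ge0.
  rewrite /B -!mulrA ler_wpM2l// -!expRD ler_expR.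
  have := wt t; rewrite -/a -/b.
  have -> : Num.sqrt 2 * (t * a) = 2 * (t * c).
    rewrite [RHS](_ : _ = Num.sqrt 2 ^+ 2 * (t * c)); last by rewrite s2.
    by rewrite /c; field; rewrite gt_eqF.
  have -> : a ^+ 2 = 2 * c ^+ 2 by rewrite /c exprMn exprVn s2; field.
  set o1 := l * omega _; set o2 := l * omega _; set ld := l * D.
  rewrite !sqrrB; lra.
have gL : L1 (fun t => B * expR (- (2^-1 * (t - c) ^+ 2))) by apply: L1Z; exact: L1_gaussian.
have part (k : R -> R) : measurable_fun setT k -> (forall t, `|k t| <= normc (bargmann_kernel t z)) ->
    `|\int[mu]_t (w t * k t)| <= M1 * expR (b ^+ 2 / 2 + l * omega (2 * normc z)).
  move=> mk hk.
  have bd : {ae mu, forall t, `|w t * k t| <= B * expR (- (2^-1 * (t - c) ^+ 2))}.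
    apply: ae_imp wK => t h; apply: le_trans (kb t); rewrite normrM.
    by apply: ler_pM.
  have wk1 : L1 (fun t => w t * k t) by apply: (L1_ae_le _ bd gL); exact: measurable_funM.
  apply: le_trans (Rint_norm_ae_le wk1 gL bd) _.
  rewrite RintegralZl//; last exact: L1_gaussian.
  by rewrite Rint_gaussian// /B /M1 mulrAC.
have [m1 m2] := measurable_bargmann_kernel z.
have p1 := part _ m1 (fun t => Re_le_normc _).
have p2 := part _ m2 (fun t => Im_le_normc _).
apply: le_trans (normc_le_ReIm _) _.
by rewrite -(mulrA 2 M1) mulr_natl mulr2n; exact: lerD p1 p2.
Qed.

Definition cbargmann (f : R -> C) (z : C) : C :=
  rbargmann (fun x => Re (f x)) z + Complex 0 1 * rbargmann (fun x => Im (f x)) z.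

Lemma cbargmann_unif (f : R -> C) : L2r (fun x => Re (f x)) -> L2r (fun x => Im (f x)) ->
  unif_sum (fun n => hermite_coef f n * toC (Num.sqrt n`!%:R)^-1) (cbargmann f).
Proof.
move=> f1 f2; have := unif_sumD (rbargmann_unif f1) (unif_sumZ (Complex 0 1) (rbargmann_unif f2)).
congr unif_sum; apply/funext => n; rewrite hermite_coefE.
by apply/eqP; rewrite eq_complex/=; apply/andP; split; apply/eqP; ring.
Qed.

Lemma cbargmann_le (l : R) (f : R -> C) : 0 < l ->
  measurable_fun setT (fun x => Re (f x)) -> measurable_fun setT (fun x => Im (f x)) ->
  gaussian_bound omega l f ->
  exists2 M, 0 <= M & forall z, normc (cbargmann f z) <=
    M * expR (Im z ^+ 2 / 2 + l * omega (2 * normc z)).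
Proof.
move=> l0 m1 m2 [K K0 H].
have [M1 M10 H1] : exists2 M, 0 <= M & forall z, normc (rbargmann (fun x => Re (f x)) z) <=
    M * expR (Im z ^+ 2 / 2 + l * omega (2 * normc z)).
  apply: (rbargmann_le l0 m1 (ltW K0)); apply: ae_imp H => t; apply: le_trans.
  exact: Re_le_normc.
have [M2 M20 H2] : exists2 M, 0 <= M & forall z, normc (rbargmann (fun x => Im (f x)) z) <=
    M * expR (Im z ^+ 2 / 2 + l * omega (2 * normc z)).
  apply: (rbargmann_le l0 m2 (ltW K0)); apply: ae_imp H => t; apply: le_trans.
  exact: Im_le_normc.
exists (M1 + M2) => [|z]; first exact: addr_ge0.
rewrite mulrDl; apply: le_trans (le_normcD _ _) _; apply: lerD; first exact: H1.
by rewrite normcM /= expr0n expr1n add0r sqrtr1 mul1r; exact: H2.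
Qed.

Lemma gaussian_bounds_coef_bound : exists2 K3, 0 < K3 & forall (l : R) (f h : R -> C), 0 < l ->
  L2r (fun x => Re (f x)) -> L2r (fun x => Im (f x)) ->
  L2r (fun x => Re (h x)) -> L2r (fun x => Im (h x)) ->
  gaussian_bound omega l f -> gaussian_bound omega l h ->
  (forall n, hermite_coef h n = Complex 0 (-1) ^+ n * hermite_coef f n) ->
  coef_bound omega (K3 * l) (hermite_coef f).
Proof.
have [K [g [K1 /andP[g0 g2] HK]]] := omega_growth omega_weight omega_integral.
have K0 : 0 < K := lt_le_trans ltr01 K1.
have cg : 0 < cos (g * (pi / 4)).
  have p0 := pi_gt0 R; apply: cos_gt0_pihalf; apply/andP; split.
    by have := mulr_gt0 g0 p0; lra.
  have : g * pi < 2 * pi by rewrite ltr_pM2r.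
  lra.
(* 2^g comes from the argument 2 |z| of the weight, the cosine from the harmonic majorant. *)
pose S := 1 + 2 `^ g / cos (g * (pi / 4)).
have S0 : 0 < S by rewrite ltr_pwDl// divr_ge0 ?powR_ge0// ltW.
exists (K * S); first exact: mulr_gt0.
move=> l f h l0 f1 f2 h1 h2 fb hb hc.
have [M1 M10 B1] := cbargmann_le l0 f1.1 f2.1 fb.
have [M2 M20 B2] := cbargmann_le l0 h1.1 h2.1 hb.
pose cf n := hermite_coef f n * toC (Num.sqrt n`!%:R)^-1.
have uF : unif_sum cf (cbargmann f) := cbargmann_unif f1 f2.
have nNi : normc (Complex 0 (-1) : C) = 1 by rewrite /= expr0n sqrrN expr1n add0r sqrtr1.
have ni : normc (Complex 0 1 : C) = 1 by rewrite /= expr0n expr1n add0r sqrtr1.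
have rot z : cbargmann h z = cbargmann f (Complex 0 (-1) * z).
  apply: (@unif_sum_uniq R (fun n => cf n * Complex 0 (-1) ^+ n) _
    (fun z => cbargmann f (Complex 0 (-1) * z)) z).
    have := cbargmann_unif h1 h2; congr unif_sum; apply/funext => n.
    by rewrite hc /cf; ring.
  exact: unif_sum_rotate nNi uF.
pose M := M1 + M2 + 1.
have M0 : 0 < M by rewrite /M ltr_wpDl// addr_ge0.
have FB z : normc (cbargmann f z) <=
    M * expR (Num.min (Re z ^+ 2) (Im z ^+ 2) / 2 + l * omega (2 * normc z)).
  have [re|im] := leP (Re z ^+ 2) (Im z ^+ 2).
    have e : z = Complex 0 (-1) * (Complex 0 1 * z).
      by case: z {re} => a b; apply/eqP; rewrite eq_complex/=; apply/andP; split; apply/eqP; ring.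
    rewrite {1}e -rot; apply: le_trans (B2 _) _; rewrite normcM ni mul1r.
    have -> : Im (Complex 0 1 * z) = Re z by case: z {re e} => a b /=; ring.
    by rewrite ler_wpM2r ?expR_ge0// /M; lra.
  apply: le_trans (B1 _) _.
  by rewrite ler_wpM2r ?expR_ge0// /M; lra.
(* 1/2 is the additive constant of [phragmen_lindelof], and [l * K * S] stems from the 1 in
   omega(rho) + 1. *)
pose M' := M * expR (2^-1 + l * K * S).
exists M' => [|n rho rho1]; first by rewrite mulr_gt0 ?expR_gt0.
have rho0 : 0 < rho := lt_trans ltr01 rho1.
(* The majorant depends on rho: the growth estimate is based at the radius where the result is read
   off, so that there B rho^g is the constant multiple 2^g of A. *)
pose A := l * K * (omega rho + 1).
have A0 : 0 <= A by rewrite !mulr_ge0 ?(ltW l0) ?(ltW K0)// addr_ge0// omega_ge0// ltW.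
pose B := A * (2 / rho) `^ g.
have B0 : 0 <= B by rewrite mulr_ge0 ?powR_ge0.
have ws s : l * omega (2 * expR s) <= A + B * expR (g * s).
  have r0 : 0 <= 2 * expR s by rewrite mulr_ge0 ?expR_ge0.
  have := ler_wpM2l (ltW l0) (HK rho _ rho0 r0).
  have -> : 2 * expR s / rho = 2 / rho * expR s by rewrite mulrAC.
  rewrite powRM ?expR_ge0 ?divr_ge0 ?(ltW rho0)//.
  have -> : expR s `^ g = expR (g * s) by rewrite /powR gt_eqF ?expR_gt0// expRK.
  by rewrite /B /A => /le_trans; apply; rewrite le_eqVlt; apply/orP; left; apply/eqP; ring.
have nI k w : normc (Complex 0 1 ^+ k * w : C) = normc w.
  by rewrite normcM normcX ni expr1n mul1r.
(* Multiplication by i swaps the two squares up to sign of the coordinates, so the hypothesis of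
   [phragmen_lindelof] is the same for every rotated function. *)
have minI k w : Num.min (Re (Complex 0 1 ^+ k * w : C) ^+ 2) (Im (Complex 0 1 ^+ k * w) ^+ 2) =
    Num.min (Re w ^+ 2) (Im w ^+ 2).
  elim: k => [|k <-]; first by rewrite expr0 mul1r.
  rewrite (exprS _ k) -mulrA; set v := _ * w.
  have -> : Re (Complex 0 1 * v) = - Im v by case: (v) => a b /=; ring.
  have -> : Im (Complex 0 1 * v) = Re v by case: (v) => a b /=; ring.
  by rewrite sqrrN minC.
have sup z : normc z = rho -> normc (cbargmann f z) <= M' * expR (K * S * l * omega rho).
  apply: (@polar_iterate R (fun z => normc (cbargmann f z) <= M' * expR (K * S * l * omega rho)) rho rho0) => k t tp.
  have uk := unif_sum_rotate (_ : normc (Complex 0 1 ^+ k) = 1) uF.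
  have {}uk := uk (etrans (normcX _ _) (etrans (congr1 (fun y => y ^+ k) ni) (expr1n _ _))).
  have := @phragmen_lindelof R _ _ M A B g uk M0 A0 B0 _ _ (ln rho) t (ltW (ln_gt0 rho1)) tp.
  rewrite g0 g2 => /(_ isT) PL; apply: le_trans (PL _) _ => [s' t' s0 tp'|].
    apply: le_trans (FB _) _; rewrite ler_wpM2l ?(ltW M0)// ler_expR minI nI normc_cexp /=.
    rewrite -addrA; apply: lerD; last exact: ws.
    rewrite !exprMn -expRM_natl -minr_pMr ?expR_ge0// mulrC mulrA.
    by rewrite le_eqVlt; apply/orP; left; apply/eqP; ring.
  rewrite /M' -[leRHS]mulrA ler_wpM2l ?(ltW M0)// -expRD ler_expR.
  have -> : expR (g * ln rho) = rho `^ g by rewrite /powR gt_eqF.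
  have -> : B / cos (g * (pi / 4)) * rho `^ g = A * (2 `^ g / cos (g * (pi / 4))).
    have -> : 2 `^ g = (2 / rho) `^ g * rho `^ g.
      by rewrite -powRM ?divr_ge0 ?(ltW rho0)// divfK// gt_eqF.
    by rewrite /B; ring.
  rewrite le_eqVlt; apply/orP; left; apply/eqP; rewrite /A /S; ring.
have := unif_sum_cauchy rho0 uF sup n.
rewrite /cf normcM normc_toC ger0_norm ?invr_ge0// mulrAC ler_pdivrMr ?sqrt_fact_gt0//.
by rewrite -[X in _ -> _ <= X]mulrAC.
Qed.

End weighted_bounds.

Theorem theorem1p3 (R : realType) (omega : R -> R)
    (omega_weight : weight_function omega)
    (phi_convex : convex_function (setT : set R^o) (phi_of omega))
    (omega_integral : integral_bigO omega)
    (f : R -> R[i]) (f_L2 : L2 f) :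
  ((exists2 lambda : R, 0 < lambda & cond_A omega f lambda) <->
   (exists2 r : R, 0 < r & cond_B omega f r)) /\
  ((forall lambda : R, 0 < lambda -> cond_A omega f lambda) <->
   (forall r : R, 0 < r -> cond_B omega f r)).
Proof.
have [/Lfun2P f1 /Lfun2P f2] := f_L2.
have [K1 K10 H1] := coef_bound_gaussian_bound omega_weight omega_integral.
have [K3 K30 H3] := gaussian_bounds_coef_bound omega_weight omega_integral.
have nNi n : normc (Complex 0 (-1) ^+ n : R[i]) = 1.
  by rewrite normcX /= expr0n sqrrN expr1n add0r sqrtr1 expr1n.
have AC l : 0 < l -> cond_A omega f l -> coef_bound omega (K3 * l) (hermite_coef f).
  move=> l0 [fb gb]; have [d1 d2] := gaussian_bound_decay omega_weight omega_integral l0 f1 f2 fb.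
  set h := fhat (fun x => complex.Re (f x)) (fun x => complex.Im (f x)).
  have [/Lfun2P h1 /Lfun2P h2] : L2 h := L2_fhat d1 d2.
  apply: (H3 l f h) => //.
    case: gb => K K0 gb; exists K => //.
    by apply: ae_imp2 (fourier_fhat d1 d2) gb => x ->.
  by move=> n; rewrite hermite_coef_fhat// (hermite_coefE f).
(* The bound for f comes first: it provides the Gaussian decay under which [fourier f] is [fhat],
   whose coefficients have the same moduli, so the same estimate applies again. *)
have CA m : 0 < m -> coef_bound omega m (hermite_coef f) -> cond_A omega f (K1 * m).
  move=> m0 cb; have fb := H1 m f m0 f1 f2 cb; split => //.
  have [d1 d2] := gaussian_bound_decay omega_weight omega_integral (mulr_gt0 K10 m0) f1 f2 fb.
  set h := fhat (fun x => complex.Re (f x)) (fun x => complex.Im (f x)).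
  have [/Lfun2P h1 /Lfun2P h2] : L2 h := L2_fhat d1 d2.
  have [|K K0 hb] := H1 m h m0 h1 h2.
    case: cb => K K0 cb; exists K => // n rho rho1.
    by rewrite hermite_coef_fhat// normcM nNi mul1r -(hermite_coefE f); exact: cb.
  by exists K => //; apply: ae_imp2 (fourier_fhat d1 d2) hb => x ->.
split; split.
- move=> [l l0 /(AC _ l0) cb]; exists (K3 * l)^-1; first by rewrite invr_gt0 mulr_gt0.
  by apply/cond_B_coef_bound; rewrite ?invrK// invr_gt0 mulr_gt0.
- move=> [r r0 /(cond_B_coef_bound omega f r0) cb]; exists (K1 * r^-1).
    by rewrite mulr_gt0// invr_gt0.
  by apply: CA => //; rewrite invr_gt0.
(* Here the constants must not depend on lambda: r is reached from lambda = 1 / (K3 r), and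
   conversely lambda from r = K1 / lambda. *)
- move=> HA r r0; apply/(cond_B_coef_bound omega f r0).
  have l0 : 0 < (K3 * r)^-1 by rewrite invr_gt0 mulr_gt0.
  by have := AC _ l0 (HA _ l0); rewrite invfM mulVKf ?gt_eqF.
- move=> HB l l0; have r0 : 0 < K1 / l by rewrite divr_gt0.
  have := HB _ r0 => /(cond_B_coef_bound omega f r0) cb.
  have m0 : 0 < (K1 / l)^-1 by rewrite invr_gt0.
  by have := CA _ m0 cb; rewrite invf_div mulrC divfK ?gt_eqF.
Qed.
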